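(* Let $\nu,\mu$ be normal weights on $\mathbb D$, let $\alpha>-1$ and let $\omega$ be a weight function such that $\{\nu,\omega\}$ is a normal pair with $\nu(r)\omega(r)=(1-r^2)^\alpha$ for $0\le r<1$. Let $g\in\mathcal B^0_\mu$ and let $\phi$ be an analytic self-map of $\mathbb D$ such that $S_g^\phi:\mathcal H^\infty_\nu\to\mathcal B_\mu$ is bounded. Then the following statements are equivalent. (a) $S_g^\phi:\mathcal H^0_\nu\to\mathcal B_\mu$ is nuclear. (b) $S_g^\phi:\mathcal H^\infty_\nu\to\mathcal B_\mu$ is nuclear. (c) $S_g^\phi:\mathcal H^0_\nu\to\mathcal B^0_\mu$ is nuclear. (d) $S_g^\phi:\mathcal H^\infty_\nu\to\mathcal B^0_\mu$ is nuclear. (e) $$\int_{\mathbb D}\left[\sup_{z\in\mathbb D}\frac{\mu(z)|g(z)|}{|1-\bar\zeta\phi(z)|^{\alpha+3}}\right]\frac{(1-|\zeta|^2)^\alpha}{\nu(\zeta)}\,dA(\zeta)<\infty.$$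
   Context: $\mathbb D$ is the open unit disk in $\mathbb C$, $H(\mathbb D)$ the space of analytic functions on $\mathbb D$, and $dA$ normalized Lebesgue measure on $\mathbb D$. For $g\in H(\mathbb D)$ and an analytic map $\phi:\mathbb D\to\mathbb D$, $(S_g^\phi f)(z)=\int_0^z f'(\phi(\zeta))g(\zeta)\,d\zeta$ for $f\in H(\mathbb D)$, $z\in\mathbb D$. A radial weight is a continuous positive function $\nu$ on $\mathbb D$ with $\nu(z)=\nu(|z|)$, non-increasing in $|z|$. It is normal if: (I) there is $\beta>0$ such that $r\mapsto\nu(r)/(1-r^2)^\beta$ is almost increasing on $[0,1)$; and (II) there is $\gamma>0$ such that $r\mapsto\nu(r)/(1-r^2)^\gamma$ is almost decreasing on $[0,1)$. (A function $h$ is almost increasing if there is $C>0$ with $h(r)\le C h(s)$ for all $r\le s$; almost decreasing if $h(s)\le C h(r)$ for all $r\le s$.) $\{\nu,\omega\}$ is a normal pair if $\nu$ is normal, $\omega$ is radial, positive and continuous with $\int_0^1\omega(r)\,dr<\infty$, and $\nu(r)\omega(r)=(1-r^2)^\alpha$, $0\le r<1$, for some $\alpha>\beta-1$, where $\beta>0$ is an exponent as in (I) for $\nu$. $\mathcal H^\infty_\nu=\{f\in H(\mathbb D):\|f\|_{\mathcal H^\infty_\nu}=\sup_{z\in\mathbb D}\nu(z)|f(z)|<\infty\}$ and $\mathcal H^0_\nu=\{f\in H(\mathbb D):\lim_{|z|\to1^-}\nu(z)|f(z)|=0\}$, with the norm of $\mathcal H^\infty_\nu$. The weighted Bloch space is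 $\mathcal B_\mu=\{f\in H(\mathbb D):\sup_{z\in\mathbb D}\mu(z)|f'(z)|<\infty\}$ with norm $|f(0)|+\sup_{z\in\mathbb D}\mu(z)|f'(z)|$, and $\mathcal B^0_\mu=\{f\in H(\mathbb D):\lim_{|z|\to1^-}\mu(z)|f'(z)|=0\}$ with the same norm. A linear operator $T:X\to Y$ between Banach spaces is nuclear if there are sequences $(x_k')\subset X'$ (the dual of $X$) and $(y_k)\subset Y$ with $\sum_k\|x_k'\|\|y_k\|<\infty$ and $Tx=\sum_k x_k'(x)y_k$ for all $x\in X$. *)

(* Defs.v *)
From HB Require Import structures.
From mathcomp Require Import all_boot all_order all_algebra.
From mathcomp Require Import complex.
From mathcomp Require Import all_classical all_reals all_analysis.

Set Implicit Arguments.
Unset Strict Implicit.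
Unset Printing Implicit Defensive.

Import Order.TTheory GRing.Theory Num.Theory.
Import numFieldNormedType.Exports.

Local Open Scope classical_set_scope.
Local Open Scope ring_scope.
Local Open Scope complex_scope.

(* R[i] seen as a numFieldType, so that the generic structure of normed module
   over itself applies; the derivative below is then the complex derivative. *)
Definition cplx (R : realType) : numFieldType := R[i].

Notation cmod := ComplexField.Normc.normc.

Section Disk.
Context {R : realType}.
Local Notation C := (cplx R).

Definition disk : set C := [set z | cmod z < 1].

(* Elements of H(D) are represented by their extension by zero to C; this makes
   the representation unique, so that the norms below are definite. *)
Definition HD : set (C -> C) :=
  [set f | (forall z, disk z -> derivable f z 1) /\
           (forall z, ~ disk z -> f z = 0)].

(* Only the values of [phi] on the disk matter. *)
Definition analytic_self_map (phi : C -> C) : Prop :=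
  forall z, disk z -> derivable phi z 1 /\ disk (phi z).

(* Any path from 0 to [z] gives the same value for analytic [h]; the segment is
   used here. *)
Definition primitive0 (h : C -> C) (z : C) : C :=
  let u := fun t : R => h ((t%:C : C) * z) in
  z * ((\int[lebesgue_measure]_(t in `[0%R, 1%R]) complex.Re (u t))
       +i* (\int[lebesgue_measure]_(t in `[0%R, 1%R]) complex.Im (u t)) : C).

Definition S_op (g phi : C -> C) (f : C -> C) : C -> C :=
  patch (fun=> 0) disk (primitive0 (fun w => derive1 f (phi w) * g w)).

(* Integral against area measure normalized so that the disk has mass 1. *)
Definition disk_integral (F : C -> \bar R) : \bar R :=
  ((pi^-1)%:E *
   \int[(@lebesgue_measure R \x @lebesgue_measure R)%E]_(p in
        [set p : R * R | disk (p.1 +i* p.2)]) F (p.1 +i* p.2))%E.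

Definition radial_positive_continuous (nu : C -> R) : Prop :=
  [/\ {in disk, continuous nu},
      forall z, disk z -> 0 < nu z &
      forall z, disk z -> nu z = nu (cmod z)%:C].

Definition radial_weight (nu : C -> R) : Prop :=
  radial_positive_continuous nu /\
  forall z w, disk z -> disk w -> cmod z <= cmod w -> nu w <= nu z.

Definition almost_increasing (h : R -> R) : Prop :=
  exists2 K : R, 0 < K &
    forall r s, 0 <= r -> r <= s -> s < 1 -> h r <= K * h s.

Definition almost_decreasing (h : R -> R) : Prop :=
  exists2 K : R, 0 < K &
    forall r s, 0 <= r -> r <= s -> s < 1 -> h s <= K * h r.

Definition incr_exponent (nu : C -> R) (b : R) : Prop :=
  0 < b /\ almost_increasing (fun r => nu r%:C / (1 - r ^+ 2) `^ b).

Definition decr_exponent (nu : C -> R) (c : R) : Prop :=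
  0 < c /\ almost_decreasing (fun r => nu r%:C / (1 - r ^+ 2) `^ c).

Definition normal_weight (nu : C -> R) : Prop :=
  [/\ radial_weight nu,
      exists b, incr_exponent nu b &
      exists c, decr_exponent nu c].

Definition product_is_power (nu omega : C -> R) (alpha : R) : Prop :=
  forall r : R, 0 <= r -> r < 1 ->
    nu r%:C * omega r%:C = (1 - r ^+ 2) `^ alpha.

Definition normal_pair (nu omega : C -> R) : Prop :=
  [/\ normal_weight nu,
      radial_positive_continuous omega,
      (\int[lebesgue_measure]_(r in `[0%R, 1%R[) (omega r%:C)%:E < +oo)%E &
      exists alpha b, [/\ incr_exponent nu b, b - 1 < alpha &
        product_is_power nu omega alpha]].

Definition weighted_sup (nu : C -> R) (f : C -> C) : \bar R :=
  ereal_sup [set (nu z * cmod (f z))%:E | z in disk].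

Definition vanishes_at_boundary (nu : C -> R) (f : C -> C) : Prop :=
  forall e : R, 0 < e -> exists2 r : R, r < 1 &
    forall z, r < cmod z -> cmod z < 1 -> nu z * cmod (f z) < e.

(* A subspace of a complex vector space together with a norm on it; the norm is
   extended-real valued and is finite on the carrier. *)
Record nspace (V : lmodType C) := NSpace {
  carrier :> V -> Prop ;
  nnorm : V -> \bar R }.

Definition Hinf (nu : C -> R) : nspace (C -> C) :=
  NSpace [set f | HD f /\ (weighted_sup nu f < +oo)%E] (weighted_sup nu).

Definition Hzero (nu : C -> R) : nspace (C -> C) :=
  NSpace [set f | HD f /\ vanishes_at_boundary nu f] (weighted_sup nu).

Definition bloch_norm (mu : C -> R) (f : C -> C) : \bar R :=
  ((cmod (f 0))%:E + weighted_sup mu (derive1 f))%E.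

Definition Bloch (mu : C -> R) : nspace (C -> C) :=
  NSpace [set f | HD f /\ (weighted_sup mu (derive1 f) < +oo)%E] (bloch_norm mu).

Definition Bloch0 (mu : C -> R) : nspace (C -> C) :=
  NSpace [set f | HD f /\ vanishes_at_boundary mu (derive1 f)] (bloch_norm mu).

Section Operators.
Variables V W : lmodType C.

Definition bounded_operator (X : nspace V) (Y : nspace W) (T : V -> W) : Prop :=
  (forall x, X x -> Y (T x)) /\
  exists M : R, forall x, X x -> (nnorm Y (T x) <= M%:E * nnorm X x)%E.

Definition dual_norm (X : nspace V) (l : V -> C) : \bar R :=
  ereal_sup [set (cmod (l x))%:E | x in [set x | X x /\ (nnorm X x <= 1)%E]].

(* Functionals are linear and bounded on the carrier of [X]; their values
   elsewhere are irrelevant. *)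
Definition dual (X : nspace V) : set (V -> C) :=
  [set l | (forall (a : C) x y, X x -> X y -> l (a *: x + y) = a * l x + l y) /\
           (dual_norm X l < +oo)%E].

Definition nuclear (X : nspace V) (Y : nspace W) (T : V -> W) : Prop :=
  (forall x, X x -> Y (T x)) /\
  exists (x' : nat -> V -> C) (y : nat -> W),
    [/\ forall k, dual X (x' k),
        forall k, Y (y k),
        (\sum_(0 <= k <oo) (dual_norm X (x' k) * nnorm Y (y k)) < +oo)%E &
        forall x, X x ->
          nnorm Y (T x - \sum_(0 <= k < n) x' k x *: y k) @[n --> \oo] --> 0%E].

End Operators.

End Disk.

(* Main.v *)
(* Let r_n = 1 - 2^-n, let the lattice consist of the 2^n equally spaced points of
   the circles |z| = r_n, and let K_s(zeta) be the supremum over z of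
   mu(z) |g(z)| / |1 - conj(zeta) phi(z)|^s.  Everything is compared with

     L(s): the sum over n and over the lattice points zeta of level n of
           2^(-n (s - 1)) / nu(r_n) K_s(zeta) is finite.

   Nuclearity on H^0_nu gives L(N + 1) for large N, by testing on the functions
   z -> (1 - conj(zeta) z)^-N: for a functional x' the weighted sum of the
   |x'(f_zeta)| is at most the norm of x' times a discrete Forelli-Rudin sum.  Such
   sums also show that L(s) does not depend on s > b + 2, where b is the exponent of
   the lower growth condition on nu.

   Conversely, f' is P_0 f' plus the sum over n of P_(n+1) f' - P_n f', where P_n F(w)
   is the Taylor polynomial of degree N - 1 of F at r_n w, evaluated at w.  By
   Cauchy's formula each difference is a limit of means, over the 2^p-th roots of
   unity, of f' times a kernel which is O(2^(-n N) / |1 - conj(zeta) w|^(N + 1)) near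
   the lattice point zeta.  Telescoping these means in p writes f'(phi) g as a series
   of point evaluations of f' times functions, which converges absolutely under
   L(N + 1) and has its terms in the little Bloch space.

   Finally L(alpha + 3) is the integral condition (e) discretised over squares: the
   integrand is comparable to its value at a lattice point on a square of side
   comparable to 2^-n around it. *)
Require Import Defs.
From mathcomp Require Import all_boot all_order all_algebra.
From mathcomp Require Import complex ring lra zify.
From mathcomp Require Import all_classical all_reals all_analysis measurable_realfun.
Import Order.TTheory GRing.Theory Num.Theory.
Import numFieldNormedType.Exports.
Set Implicit Arguments.
Unset Strict Implicit.
Unset Printing Implicit Defensive.
Local Open Scope classical_set_scope.
Local Open Scope ring_scope.
Local Open Scope complex_scope.

(** * Complex derivatives *)

(** The four nuclearity statements differ only by inclusions of domain and target, so two arrows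
    carry the content: from the weakest, H^0_nu into the Bloch space, to L(alpha + 3), and from
    there to the strongest, H^inf_nu into the little Bloch space. The hypothesis alpha > b - 1 says
    exactly that s = alpha + 3 lies in the range s > b + 2.

    The exponent has to change on the way because alpha need not be an integer, while test functions
    and kernels are integer powers. A lattice is used instead of an area integral since a functional
    on H^0_nu applies to finite combinations without any vector-valued integration.

    Taylor polynomials of degree N - 1 make the kernel of a level small of order N, so that N + 1
    can be taken as large as needed. The means run over 2^p-th roots because their nodes are nested:
    at depth q a lattice point has 2^q nodes, the mean has weight 2^-q, and a difference of
    neighbours gains another 2^-q, which leaves a convergent series. *)

Section ComplexModulus.
Context {R : realType}.
Local Notation C := (cplx R).
Implicit Types x y z w : C.

Lemma cmodE z : `|z| = (cmod z)%:C :> C.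
Proof. by []. Qed.

Lemma cmod_def z : cmod z = Num.sqrt (complex.Re z ^+ 2 + complex.Im z ^+ 2).
Proof. by case: z. Qed.

Lemma cmod_ge0 z : 0 <= cmod z.
Proof. by rewrite cmod_def sqrtr_ge0. Qed.

Lemma cmod0 : cmod (0 : C) = 0.
Proof. exact: Normc.normc0. Qed.

Lemma cmod1 : cmod (1 : C) = 1.
Proof. exact: Normc.normc1. Qed.

Lemma cmodM z w : cmod (z * w) = cmod z * cmod w.
Proof. exact: Normc.normcM. Qed.

Lemma cmodV z : cmod z^-1 = (cmod z)^-1.
Proof. exact: Normc.normcV. Qed.

Lemma cmodf z w : cmod (z / w) = cmod z / cmod w.
Proof. by rewrite cmodM cmodV. Qed.

Lemma cmodX z n : cmod (z ^+ n) = cmod z ^+ n.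
Proof. by elim: n => [|n IH]; rewrite ?cmod1 // !exprS cmodM IH. Qed.

Lemma cmodN z : cmod (- z) = cmod z.
Proof. exact: (@normcN R). Qed.

Lemma cmodD z w : cmod (z + w) <= cmod z + cmod w.
Proof. exact: (@le_normcD R). Qed.

Lemma cmodB z w : cmod (z - w) <= cmod z + cmod w.
Proof. by rewrite -(cmodN w) cmodD. Qed.

Lemma cmodC z w : cmod (z - w) = cmod (w - z).
Proof. by rewrite -cmodN opprB. Qed.

Lemma cmodB3 x z w : cmod (z - w) <= cmod (z - x) + cmod (x - w).
Proof. by rewrite -[z - w](subrKA x) cmodD. Qed.

Lemma cmod_subl z w : cmod z - cmod w <= cmod (z - w).
Proof. by rewrite lerBlDr -{1}(subrK w z) cmodD. Qed.

Lemma cmod_real (a : R) : cmod (a%:C : C) = `|a|.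
Proof. by rewrite cmod_def /= expr0n addr0 sqrtr_sqr. Qed.

Lemma cmod_nat n : cmod (n%:R : C) = n%:R.
Proof. by rewrite -[n%:R in LHS](rmorph_nat (real_complex R)) cmod_real normr_nat. Qed.

Lemma cmod_eq0 z : (cmod z == 0) = (z == 0).
Proof. by apply/eqP/eqP => [/Normc.eq0_normc//|->]; exact: cmod0. Qed.

Lemma cmod_gt0 z : (0 < cmod z) = (z != 0).
Proof. by rewrite lt_neqAle cmod_ge0 andbT eq_sym cmod_eq0. Qed.

Lemma cmod_sum (I : Type) (r : seq I) (P : pred I) (F : I -> C) :
  cmod (\sum_(i <- r | P i) F i) <= \sum_(i <- r | P i) cmod (F i).
Proof.
elim/big_ind2: _ => // [|a b c d h1 h2]; first by rewrite cmod0.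
exact: le_trans (cmodD _ _) (lerD h1 h2).
Qed.

Lemma cmodJ z : cmod (conjc z : C) = cmod z.
Proof. by rewrite !cmod_def; case: z => a b /=; rewrite sqrrN. Qed.

Lemma Re_le_cmod z : `|complex.Re z| <= cmod z.
Proof.
rewrite cmod_def -sqrtr_sqr ler_sqrt ?addr_ge0 ?sqr_ge0//.
by rewrite lerDl sqr_ge0.
Qed.

Lemma Im_le_cmod z : `|complex.Im z| <= cmod z.
Proof.
rewrite cmod_def -sqrtr_sqr ler_sqrt ?addr_ge0 ?sqr_ge0//.
by rewrite lerDr sqr_ge0.
Qed.

Lemma cmod_le_ReIm z : cmod z <= `|complex.Re z| + `|complex.Im z|.
Proof.
case: z => a b /=.
rewrite -[leRHS]ger0_norm ?addr_ge0// -sqrtr_sqr ler_sqrt ?sqr_ge0//.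
rewrite sqrrD !real_normK ?num_real//.
by rewrite lerD2r lerDl mulrn_wge0// mulr_ge0.
Qed.

Lemma sqr_cmod z : cmod z ^+ 2 = complex.Re z ^+ 2 + complex.Im z ^+ 2.
Proof. by rewrite cmod_def sqr_sqrtr// addr_ge0 ?sqr_ge0. Qed.

Lemma mulcJ z : z * (conjc z : C) = (cmod z ^+ 2)%:C.
Proof.
rewrite sqr_cmod; case: z => a b /=; apply/eqP; rewrite eq_complex /=.
by apply/andP; split; apply/eqP; ring.
Qed.

Lemma ReB z w : complex.Re (z - w) = complex.Re z - complex.Re w.
Proof. by case: z => ? ?; case: w. Qed.

Lemma ImB z w : complex.Im (z - w) = complex.Im z - complex.Im w.
Proof. by case: z => ? ?; case: w. Qed.

Lemma disk0 : disk (0 : C).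
Proof. by change (cmod (0 : C) < 1); rewrite cmod0 ltr01. Qed.

Lemma cmod_convex z w (t r : R) : 0 <= t -> t <= 1 -> cmod z <= r -> cmod w <= r ->
  cmod (z + t%:C * (w - z)) <= r.
Proof.
move=> t0 t1 hz hw.
have -> : z + t%:C * (w - z) = (1 - t)%:C * z + t%:C * w.
  by rewrite rmorphB rmorph1; ring.
apply: le_trans (cmodD _ _) _; rewrite !cmodM !cmod_real ger0_norm ?subr_ge0//.
rewrite ger0_norm//; nra.
Qed.

End ComplexModulus.

Section ComplexLimits.
Context {R : realType}.
Local Notation C := (cplx R).
Implicit Types (u v : nat -> C) (l m z w : C).

(** Convergence in C is stated through the real sequence of moduli, so that squeezing and sums of
    limits take place in R. *)
Definition clim u l : Prop := (cmod (u n - l) @[n --> \oo]) --> (0 : R).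

Lemma climP u l : clim u l <->
  forall e, 0 < e -> exists N, forall n, (N <= n)%N -> cmod (u n - l) < e.
Proof.
split=> [/cvgrPdist_lt h e e0|h].
  have [N _ hN] := h e e0; exists N => n /hN.
  by rewrite /= sub0r normrN ger0_norm ?cmod_ge0.
apply/cvgrPdist_lt => e /h [N hN]; exists N => // n /= /hN.
by rewrite sub0r normrN ger0_norm ?cmod_ge0.
Qed.

Lemma clim_le u l (b : nat -> R) : (forall n, cmod (u n - l) <= b n) ->
  b n @[n --> \oo] --> (0 : R) -> clim u l.
Proof.
move=> h hb; apply: squeeze_cvgr hb; last exact: (cvg_cst 0).
by apply: nearW => n; rewrite cmod_ge0 h.
Qed.

Lemma clim_cst l : clim (fun=> l) l.
Proof. by rewrite /clim; under eq_fun do rewrite subrr cmod0; exact: cvg_cst. Qed.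

Lemma climD u v l m : clim u l -> clim v m -> clim (fun n => u n + v n) (l + m).
Proof.
move=> hu hv; apply: (@clim_le _ _ (fun n => cmod (u n - l) + cmod (v n - m))).
  by move=> n; rewrite opprD addrACA cmodD.
by rewrite -[0 in X in _ --> X]addr0; exact: cvgD.
Qed.

Lemma climMl a u l : clim u l -> clim (fun n => a * u n) (a * l).
Proof.
move=> hu; apply: (@clim_le _ _ (fun n => cmod a * cmod (u n - l))).
  by move=> n; rewrite -mulrBr cmodM.
by rewrite -[0 in X in _ --> X](mulr0 (cmod a)); exact: cvgMl_tmp.
Qed.

Lemma climN u l : clim u l -> clim (fun n => - u n) (- l).
Proof.
by move=> /(climMl (-1)); rewrite mulN1r; under eq_fun do rewrite mulN1r.
Qed.

Lemma climB u v l m : clim u l -> clim v m -> clim (fun n => u n - v n) (l - m).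
Proof. by move=> hu /climN; exact: climD. Qed.

Lemma clim_cmod_le u l (B : R) : clim u l -> (forall n, cmod (u n) <= B) -> cmod l <= B.
Proof.
move=> /climP h hB; apply/ler_addgt0Pr => e /h [N hN].
have := hN N (leqnn _); rewrite cmodC => h1.
rewrite -(subrK (u N) l); apply: le_trans (cmodD _ _) _.
by rewrite addrC lerD// ltW.
Qed.

Lemma clim_sum (I : Type) (r : seq I) (P : pred I) (U : I -> nat -> C) (L : I -> C) :
  (forall i, P i -> clim (U i) (L i)) ->
  clim (fun n => \sum_(i <- r | P i) U i n) (\sum_(i <- r | P i) L i).
Proof.
move=> h; elim: r => [|i r IH].
  by under eq_fun do rewrite big_nil; rewrite big_nil; exact: clim_cst.
under eq_fun do rewrite big_cons; rewrite big_cons.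
by case: ifP => hi //; apply: climD => //; exact: h.
Qed.

Lemma clim_shift u l k : clim u l -> clim (fun n => u (n + k)%N) l.
Proof. by move=> h; rewrite /clim (cvg_shiftn k (fun n => cmod (u n - l))). Qed.

(** Completeness is inherited from R: real and imaginary parts are 1-Lipschitz for [cmod], hence
    Cauchy. *)
Lemma clim_cauchy u :
  (forall e : R, 0 < e -> exists N : nat, forall n k : nat,
     (N <= n)%N -> (N <= k)%N -> cmod (u n - u k) <= e) -> exists l, clim u l.
Proof.
move=> h.
have aux (p : C -> R) : (forall z w, p (z - w) = p z - p w) ->
    (forall z, `|p z| <= cmod z) -> cvgn (p \o u).
  move=> hp hle; apply/cauchy_cvgP/cauchyP => e e0.
  have /h [N hN] : 0 < e / 2 by rewrite divr_gt0.
  exists (p (u N)); exists N => // n /= hn; rewrite /ball /= -hp.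
  apply: le_lt_trans (hle _) _; apply: le_lt_trans (hN _ _ _ hn) _ => //.
  by rewrite ltr_pdivrMr// mulr_natr mulr2n ltrDl.
have /cvg_ex [a ha] := aux _ ReB Re_le_cmod.
have /cvg_ex [b hb] := aux _ ImB Im_le_cmod.
exists (a +i* b : C).
apply: (@clim_le _ _ (fun n => `|complex.Re (u n) - a| + `|complex.Im (u n) - b|)).
  by move=> n; apply: le_trans (cmod_le_ReIm _) _; rewrite ReB ImB.
rewrite -[0 in X in _ --> X]addr0; apply: cvgD.
  by apply/norm_cvg0P; rewrite -(subrr a); apply: cvgB => //; exact: cvg_cst.
by apply/norm_cvg0P; rewrite -(subrr b); apply: cvgB => //; exact: cvg_cst.
Qed.

End ComplexLimits.

Section ComplexDerivative.
Context {R : realType}.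
Local Notation C := (cplx R).

(* Taking [io] to be the identity gives the complex derivative, taking it to be
   the inclusion of the reals gives the derivative of a path. *)
Definition hasd (T : Type) (io : T -> C) (f : T -> C) (z : T) (d : C) : Prop :=
  forall e : R, 0 < e -> exists2 dl : R, 0 < dl & forall w : T,
    cmod (io w - io z) < dl ->
    cmod (f w - f z - d * (io w - io z)) <= e * cmod (io w - io z).

Definition isd (f : C -> C) z d := hasd (fun x : C => x) f z d.
Definition isrd (u : R -> C) t d := hasd (fun x : R => x%:C : C) u t d.

Section Calculus.
Variables (T : Type) (io : T -> C).
Implicit Types (f g : T -> C) (z w : T) (d e : C).
Local Notation D := (hasd io).

Lemma hasd_lip f z d : D f z d -> exists2 dl : R, 0 < dl & forall w,
  cmod (io w - io z) < dl -> cmod (f w - f z) <= (cmod d + 1) * cmod (io w - io z).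
Proof.
move=> /(_ 1 ltr01) [dl dl0 h]; exists dl => // w /h h1.
rewrite -(subrK (d * (io w - io z)) (f w - f z)).
apply: le_trans (cmodD _ _) _; rewrite cmodM mulrDl mul1r addrC lerD2l.
by rewrite -[leRHS]mul1r.
Qed.

Lemma hasd_cont f z d : D f z d -> forall e : R, 0 < e -> exists2 dl : R, 0 < dl & 
  forall w, cmod (io w - io z) < dl -> cmod (f w - f z) <= e.
Proof.
move=> /hasd_lip [dl dl0 h] e e0.
have c0 : 0 < cmod d + 1 by rewrite ltr_wpDl ?cmod_ge0.
exists (Num.min dl (e / (cmod d + 1))).
  by rewrite lt_min dl0 divr_gt0.
move=> w; rewrite lt_min => /andP[/h h1 h2]; apply: le_trans h1 _.
by rewrite mulrC -ler_pdivlMr// ltW.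
Qed.

Lemma hasd_eq f z d d' : D f z d -> d = d' -> D f z d'.
Proof. by move=> h <-. Qed.

Lemma hasd_near f g z d (r : R) : 0 < r ->
  (forall w, cmod (io w - io z) < r -> f w = g w) -> D f z d -> D g z d.
Proof.
move=> r0 h hf e /hf [dl dl0 h1]; exists (Num.min dl r); first by rewrite lt_min dl0.
move=> w; rewrite lt_min => /andP[/h1 h2 /h <-].
by rewrite -h// subrr cmod0.
Qed.

Lemma hasd_ext f g z d : f =1 g -> D f z d -> D g z d.
Proof. by move=> h; apply: (@hasd_near _ _ _ _ 1). Qed.

Lemma hasd_cst c z : D (fun=> c) z 0.
Proof.
move=> e e0; exists 1 => // w _.
by rewrite subrr mul0r subrr cmod0 mulr_ge0 ?cmod_ge0// ltW.
Qed.

Lemma hasd_io z : D io z 1.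
Proof.
move=> e e0; exists 1 => // w _.
by rewrite mul1r subrr cmod0 mulr_ge0 ?cmod_ge0// ltW.
Qed.

Lemma hasdD f g z d e : D f z d -> D g z e -> D (fun x => f x + g x) z (d + e).
Proof.
move=> hf hg a a0; have a20 : 0 < a / 2 by rewrite divr_gt0.
have [r r0 h1] := hf _ a20; have [s s0 h2] := hg _ a20.
exists (Num.min r s); first by rewrite lt_min r0.
move=> w; rewrite lt_min => /andP[/h1 {}h1 /h2 {}h2].
rewrite [X in cmod X](_ : _ = (f w - f z - d * (io w - io z)) +
  (g w - g z - e * (io w - io z))); last by ring.
by apply: le_trans (cmodD _ _) _; lra.
Qed.

Lemma hasdM f g z d e : D f z d -> D g z e ->
  D (fun x => f x * g x) z (d * g z + f z * e).
Proof.
move=> hf hg a a0.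
set K : R := cmod (g z) + cmod d + cmod (f z) + 2.
have K0 : 0 < K by rewrite /K ltr_wpDl ?addr_ge0 ?cmod_ge0.
(* [b] is at most 1, so that |g w| <= |g z| + 1, and [b * K <= a], where [K] dominates the
   coefficients of the three error terms. *)
set b := Num.min 1 (a / K).
have b0 : 0 < b by rewrite /b lt_min ltr01 divr_gt0.
have [r r0 h1] := hf _ b0; have [s s0 h2] := hg _ b0; have [t t0 h3] := hasd_cont hg b0.
exists (Num.min r (Num.min s t)); first by rewrite !lt_min r0 s0.
move=> w; rewrite !lt_min => /andP[/h1 {}h1 /andP[/h2 {}h2 /h3 {}h3]].
rewrite [X in cmod X](_ : _ = (f w - f z - d * (io w - io z)) * g w +
   (d * (io w - io z)) * (g w - g z) + f z * (g w - g z - e * (io w - io z))); last by ring.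
have b1 : b <= 1 by rewrite /b ge_min lexx.
have bK : b * K <= a by rewrite -ler_pdivlMr// /b ge_min lexx orbT.
have gw : cmod (g w) <= cmod (g z) + 1.
  by rewrite -(subrK (g z) (g w)); apply: le_trans (cmodD _ _) _; rewrite addrC lerD2l; exact: le_trans h3 b1.
apply: le_trans (cmodD _ _) _; apply: le_trans (lerD (cmodD _ _) (lexx _)) _.
rewrite !cmodM.
set H := cmod (io w - io z) in h1 h2 *.
have H0 : 0 <= H by exact: cmod_ge0.
have e1 : cmod (f w - f z - d * (io w - io z)) * cmod (g w) <= b * H * (cmod (g z) + 1).
  by apply: ler_pM => //; exact: cmod_ge0.
have e2 : cmod d * H * cmod (g w - g z) <= cmod d * H * b.
  by apply: ler_wpM2l => //; rewrite mulr_ge0 ?cmod_ge0.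
have e3 : cmod (f z) * cmod (g w - g z - e * (io w - io z)) <= cmod (f z) * (b * H).
  by apply: ler_wpM2l => //; exact: cmod_ge0.
apply: le_trans (lerD (lerD e1 e2) e3) _.
have : b * K * H <= a * H by exact: ler_wpM2r.
have : 0 <= b * H by rewrite mulr_ge0// ltW.
rewrite /K; nra.
Qed.

Lemma hasdMl c f z d : D f z d -> D (fun x => c * f x) z (c * d).
Proof. by move=> /(hasdM (hasd_cst c z)) /hasd_eq; apply; rewrite mul0r add0r. Qed.

Lemma hasdMr c f z d : D f z d -> D (fun x => f x * c) z (d * c).
Proof. by move=> /hasdM /(_ (hasd_cst c z)) /hasd_eq; apply; rewrite mulr0 addr0. Qed.

Lemma hasdN f z d : D f z d -> D (fun x => - f x) z (- d).
Proof.
move=> /(hasdMl (-1)) h; apply: hasd_ext (hasd_eq h _) => [x|]; by rewrite mulN1r.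
Qed.

Lemma hasdB f g z d e : D f z d -> D g z e -> D (fun x => f x - g x) z (d - e).
Proof. by move=> hf /hasdN; exact: hasdD. Qed.

Lemma hasd_sum (I : Type) (r : seq I) (P : pred I) (F : I -> T -> C) z (d : I -> C) :
  (forall i, P i -> D (F i) z (d i)) ->
  D (fun x => \sum_(i <- r | P i) F i x) z (\sum_(i <- r | P i) d i).
Proof.
move=> h; elim: r => [|i r IH].
  rewrite big_nil; apply: hasd_ext (hasd_cst 0 z) => x; by rewrite big_nil.
rewrite big_cons; apply: (@hasd_ext (fun x => if P i then F i x + \sum_(j <- r | P j) F j x
   else \sum_(j <- r | P j) F j x)).
  by move=> x; rewrite big_cons.
by case: ifP => // hi; apply: hasdD => //; exact: h.
Qed.

Lemma hasdX f z d n : D f z d -> D (fun x => f x ^+ n) z (n%:R * f z ^+ n.-1 * d).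
Proof.
move=> hf; elim: n => [|n IH].
  by apply: hasd_eq (hasd_cst 1 z) _; rewrite !mul0r.
apply: hasd_ext (hasd_eq (hasdM hf IH) _) => [x|]; first by rewrite exprS.
case: n {IH} => [|n] /=; first by rewrite expr0; ring.
by rewrite exprS -[n.+2%:R]natr1; ring.
Qed.

Lemma hasd_comp f (F : C -> C) z d e : isd F (f z) e -> D f z d ->
  D (fun x => F (f x)) z (e * d).
Proof.
move=> hF hf a a0.
set K : R := cmod d + cmod e + 1.
have K0 : 0 < K by rewrite /K ltr_wpDl ?addr_ge0 ?cmod_ge0.
have b0 : 0 < a / K by rewrite divr_gt0.
have [r r0 h1] := hF _ b0; have [s s0 h2] := hf _ b0.
have r20 : 0 < r / 2 by rewrite divr_gt0.
have [t t0 h3] := hasd_cont hf r20; have [q q0 h4] := hasd_lip hf.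
exists (Num.min (Num.min s t) q); first by rewrite !lt_min s0 t0.
move=> w; rewrite !lt_min => /andP[/andP[/h2 {}h2 /h3 {}h3] /h4 {}h4].
have {}h1 := h1 (f w) (le_lt_trans h3 _).
rewrite [X in cmod X](_ : _ = (F (f w) - F (f z) - e * (f w - f z)) +
   e * (f w - f z - d * (io w - io z))); last by ring.
apply: le_trans (cmodD _ _) _; rewrite cmodM.
have {}h1 : cmod (F (f w) - F (f z) - e * (f w - f z)) <= a / K * cmod (f w - f z).
  by apply: h1; rewrite ltr_pdivrMr// mulr_natr mulr2n ltrDl.
have e2 : cmod e * cmod (f w - f z - d * (io w - io z)) <=
    cmod e * (a / K * cmod (io w - io z)) by apply: ler_wpM2l => //; exact: cmod_ge0.
have e1 : a / K * cmod (f w - f z) <= a / K * ((cmod d + 1) * cmod (io w - io z)).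
  by apply: ler_wpM2l => //; exact: ltW.
apply: le_trans (lerD (le_trans h1 e1) e2) _.
have -> : a = a / K * K by rewrite divfK// gt_eqF.
by rewrite le_eqVlt; apply/orP; left; apply/eqP; rewrite mulfK ?gt_eqF// /K; ring.
Qed.

Lemma hasd_unique f z d e : (forall r : R, 0 < r -> exists w, 0 < cmod (io w - io z) < r) ->
  D f z d -> D f z e -> d = e.
Proof.
move=> hz hd he; apply/eqP; rewrite -subr_eq0 -cmod_eq0 eq_le cmod_ge0 andbT.
apply/ler_addgt0Pr => a a0; rewrite add0r.
have [r r0 h0] := hasdB hd he a0.
have [w /andP[w0 wr]] := hz _ r0.
have := h0 w wr; rewrite [X in cmod X](_ : _ = - ((d - e) * (io w - io z))); last by ring.
by rewrite cmodN cmodM ler_pM2r.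
Qed.

End Calculus.

Lemma isdV (z : C) : z != 0 -> isd (fun x => x^-1) z (- z^-1 ^+ 2).
Proof.
move=> z0 e e0; have cz : 0 < cmod z by rewrite cmod_gt0.
exists (Num.min (cmod z / 2) (e * cmod z ^+ 3 / 2)).
  by rewrite lt_min !divr_gt0 ?mulr_gt0 ?exprn_gt0.
move=> w; rewrite lt_min => /andP[h1 h2].
have w2 : cmod z / 2 <= cmod w.
  have := cmod_subl z w; rewrite cmodC; lra.
have w0 : w != 0 by rewrite -cmod_gt0; apply: lt_le_trans w2; rewrite divr_gt0.
(* The remainder of the first-order expansion is exactly (w - z)^2 / (z^2 w), and [w2] keeps its
   denominator away from 0. *)
rewrite [X in cmod X](_ : _ = (w - z) * ((w - z) / (z ^+ 2 * w))); last by field; rewrite z0 w0.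
rewrite cmodM mulrC; apply: ler_wpM2r; first exact: cmod_ge0.
rewrite cmodf cmodM cmodX ler_pdivrMr ?mulr_gt0 ?exprn_gt0 ?cmod_gt0//.
apply: le_trans (ltW h2) _; rewrite -mulrA ler_pM2l//.
have : 0 < cmod z ^+ 2 by rewrite exprn_gt0.
rewrite exprS; nra.
Qed.

Lemma hasdV (T : Type) (io f : T -> C) z d : f z != 0 -> hasd io f z d ->
  hasd io (fun x => (f x)^-1) z (- (f z)^-1 ^+ 2 * d).
Proof. by move=> h hf; exact: hasd_comp (isdV h) hf. Qed.

Lemma isd_unique (f : C -> C) z d e : isd f z d -> isd f z e -> d = e.
Proof.
apply: hasd_unique => r r0; exists (z + (r / 2)%:C).
rewrite addrAC subrr add0r cmod_real ger0_norm; last by rewrite divr_ge0// ltW.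
by rewrite divr_gt0//= ltr_pdivrMr// mulr_natr mulr2n ltrDl.
Qed.

Lemma isd_derivable (f : C -> C) z d : isd f z d -> derivable f z 1 /\ derive1 f z = d.
Proof.
move=> h.
have H : h^-1 *: (f (h + z) - f z) @[h --> (0 : C)^'] --> d.
  apply/cvgrPdist_le => e e0.
  (* Positivity in R[i] includes being real, so the complex tolerance [e] can be replaced by its
     real part. *)
  have er : e = (complex.Re e)%:C.
    by have := gtr0_real e0 => /RRe_real.
  have e1 : 0 < complex.Re e by move: e0; rewrite er ltcR.
  have [dl dl0 hd] := h _ e1.
  near=> k.
  have k0 : k != 0 by near: k; exact: nbhs_dnbhs_neq.
  have : `|k| < (dl%:C : C).
    near: k; apply: dnbhs0_lt; by rewrite ltcR.
  rewrite cmodE ltcR => kd.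
  rewrite cmodE er lecR.
  have := hd (k + z); rewrite addrK => /(_ kd) h1.
  rewrite cmodC [X in cmod X](_ : _ = (f (k + z) - f z - d * k) / k); last first.
    by rewrite /GRing.scale /=; field.
  by rewrite cmodf ler_pdivrMr ?cmod_gt0.
split; first by rewrite /derivable; under eq_fun do rewrite /= [_ *: 1]mulr1; apply/cvg_ex; exists d.
by apply: cvg_lim H; exact: norm_hausdorff.
Unshelve. all: by end_near. Qed.

Lemma derivable_isd (f : C -> C) z : derivable f z 1 -> isd f z (derive1 f z).
Proof.
move=> h.
have H : h^-1 *: (f (h + z) - f z) @[h --> (0 : C)^'] --> derive1 f z.
  by move: h; rewrite /derivable; under eq_fun do rewrite /= [_ *: 1]mulr1.
move=> e e0.
have /cvgrPdist_le /(_ (e%:C)) := H; rewrite ltcR => /(_ e0).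
rewrite near_withinE => /nbhs_ballP [dl dl0 hd].
have dr : dl = (complex.Re dl)%:C by have := gtr0_real dl0 => /RRe_real.
exists (complex.Re dl); first by move: dl0; rewrite /= dr ltcR.
move=> w hw; have [->|wz] := eqVneq w z.
  by rewrite !subrr mulr0 subrr cmod0 mulr0.
have := hd (w - z); rewrite /ball /= sub0r normrN cmodE dr ltcR => /(_ hw).
rewrite subr_eq0 => /(_ wz); rewrite subrK cmodE lecR => h1.
rewrite [X in cmod X](_ : _ = - (derive1 f z - (w - z)^-1 *: (f w - f z)) * (w - z)); last first.
  by rewrite /GRing.scale /=; field; rewrite subr_eq0.
by rewrite cmodM cmodN ler_wpM2r ?cmod_ge0.
Qed.

Lemma derive1_isd (f : C -> C) z d : isd f z d -> derive1 f z = d.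
Proof. by case/isd_derivable. Qed.

End ComplexDerivative.

(** * Goursat's theorem and primitives *)

Section Primitive.
Context {R : realType}.
Local Notation C := (cplx R).
Local Notation leb := (@lebesgue_measure R).
Implicit Types (f h : C -> C) (u U : R -> C) (a b c z w : C).

Lemma is_deriveP (v : R -> R) (t d : R) : is_derive t 1 v d <->
  forall e : R, 0 < e -> exists2 dl : R, 0 < dl & forall s,
    `|s - t| < dl -> `|v s - v t - d * (s - t)| <= e * `|s - t|.
Proof.
split=> [hv e e0|hd].
  have H : h^-1 *: (v (h + t) - v t) @[h --> (0 : R)^'] --> d.
    have := @ex_derive _ _ _ _ _ _ _ hv; have := @derive_val _ _ _ _ _ _ _ hv.
    by rewrite /derive /derivable => <-; under eq_fun do rewrite /= [_ *: 1]mulr1.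
  have /cvgrPdist_le /(_ _ e0) := H.
  rewrite near_withinE => /nbhs_ballP [dl /= dl0 hd].
  exists dl => // s hs; have [->|st] := eqVneq s t.
    by rewrite !subrr mulr0 subrr normr0 mulr0.
  have := hd (s - t); rewrite /ball /= sub0r normrN => /(_ hs).
  rewrite subr_eq0 => /(_ st); rewrite subrK => h1.
  rewrite [X in `|X|](_ : _ = - (d - (s - t)^-1 *: (v s - v t)) * (s - t)); last first.
    by rewrite /GRing.scale /=; field; rewrite subr_eq0.
  by rewrite normrM normrN ler_wpM2r.
have H : h^-1 *: (v (h + t) - v t) @[h --> (0 : R)^'] --> d.
  apply/cvgrPdist_le => e /hd [dl dl0 h1].
  near=> k.
  have k0 : k != 0 by near: k; exact: nbhs_dnbhs_neq.
  have kd : `|k| < dl by near: k; exact: dnbhs0_lt.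
  have := h1 (k + t); rewrite addrK => /(_ kd) h2.
  rewrite distrC [X in `|X|](_ : _ = (v (k + t) - v t - d * k) / k); last first.
    by rewrite /GRing.scale /=; field.
  by rewrite normrM normfV ler_pdivrMr ?normr_gt0.
have H' : h^-1 *: ((v \o shift t) (h *: 1) - v t) @[h --> (0 : R)^'] --> d.
  by under eq_fun do rewrite /= [_ *: 1]mulr1.
by apply: DeriveDef; [apply/cvg_ex; exists d|apply: cvg_lim H'].
Unshelve. all: by end_near. Qed.

Lemma isrd_Re u t d : isrd u t d -> is_derive t 1 (fun s => complex.Re (u s)) (complex.Re d).
Proof.
move=> h; apply/is_deriveP => e /h [dl dl0 hd]; exists dl => // s.
have := hd s; rewrite -rmorphB cmod_real => h1 /h1; apply: le_trans.
apply: le_trans (Re_le_cmod _).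
by case: (u s) (u t) d {h1 h hd} => [? ?] [? ?] [? ?] /=; rewrite mulr0 subr0.
Qed.

Lemma isrd_affine u t (p q : R) d : isrd u (p * t + q) d ->
  isrd (fun s => u (p * s + q)) t (p%:C * d).
Proof.
move=> h e e0; set K := `|p| + 1.
have K0 : 0 < K by rewrite /K ltr_wpDl.
have [dl dl0 hd] := h _ (divr_gt0 e0 K0).
exists (dl / K); first by rewrite divr_gt0.
move=> s hs.
have E : (p * s + q)%:C - (p * t + q)%:C = p%:C * (s%:C - t%:C) :> C.
  by rewrite -!rmorphB -rmorphM; congr (_%:C); ring.
have := hd (p * s + q); rewrite E cmodM cmod_real => h1.
rewrite (_ : p%:C * d * _ = d * (p%:C * (s%:C - t%:C))); last by ring.
apply: le_trans (h1 _) _.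
  apply: le_lt_trans (_ : _ <= K * cmod (s%:C - t%:C)) _.
    by rewrite ler_wpM2r ?cmod_ge0// /K lerDl.
  by rewrite mulrC -ltr_pdivlMr.
rewrite mulrA ler_wpM2r ?cmod_ge0// mulrAC ler_pdivrMr// ler_pM2l//.
by rewrite /K lerDl.
Qed.

Lemma isrd_segment a b t : isrd (fun s => a + s%:C * (b - a)) t (b - a).
Proof.
by apply: hasd_eq (hasdD (hasd_cst _ a t) (hasdMr (b - a) (hasd_io _ t))) _; rewrite mul1r add0r.
Qed.

(** The real mean value theorem is applied to the component of the path along its own increment,
    [Re (c * u s)] with [c] the conjugate of [u 1 - u 0]; this recovers the full modulus of the
    increment. *)
Lemma mean_value_path u (d : R -> C) (M : R) :
  (forall t, 0 <= t <= 1 -> isrd u t (d t)) ->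
  (forall t, 0 < t < 1 -> cmod (d t) <= M) -> cmod (u 1 - u 0) <= M.
Proof.
move=> hu hM; set c := conjc (u 1 - u 0) : C.
have hc (t : R) : 0 <= t <= 1 -> is_derive t 1 (fun s => complex.Re (c * u s)) (complex.Re (c * d t)).
  by move=> ht; apply: isrd_Re; exact: hasdMl (hu _ ht).
have [||t /andP[]] := @MVT R (fun s => complex.Re (c * u s)) (fun t => complex.Re (c * d t)) 0 1 ltr01.
- by move=> x; rewrite in_itv /= => /andP[x0 x1]; apply: hc; rewrite !ltW.
- apply: derivable_within_continuous => x; rewrite in_itv /= => /hc hx; exact: (@ex_derive _ _ _ _ _ _ _ hx).
rewrite !bnd_simp => t0 t1; rewrite subr0 mulr1 => E.
have {}hM : cmod (d t) <= M by apply: hM; rewrite t0.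
have : cmod (u 1 - u 0) ^+ 2 <= cmod (u 1 - u 0) * M.
  have -> : cmod (u 1 - u 0) ^+ 2 = complex.Re (c * d t).
    rewrite -E -ReB -mulrBr mulrC mulcJ //.
  apply: le_trans (ler_norm _) _; apply: le_trans (Re_le_cmod _) _.
  by rewrite cmodM cmodJ ler_wpM2l ?cmod_ge0.
have := cmod_ge0 (u 1 - u 0); rewrite expr2 le_eqVlt => /orP[/eqP <- _|h0]; last by rewrite ler_pM2l.
exact: le_trans (cmod_ge0 _) hM.
Qed.

Lemma mean_value_disk f (f' : C -> C) (r M : R) :
  (forall z, cmod z <= r -> isd f z (f' z)) -> (forall z, cmod z <= r -> cmod (f' z) <= M) ->
  forall a b, cmod a <= r -> cmod b <= r -> cmod (f b - f a) <= M * cmod (b - a).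
Proof.
move=> hf hM a b ha hb.
have := @mean_value_path (fun s => f (a + s%:C * (b - a))) (fun t => f' (a + t%:C * (b - a)) * (b - a))
  (M * cmod (b - a)).
rewrite mul1r mul0r addr0 subrKC; apply.
  move=> t /andP[t0 t1]; apply: hasd_comp (isrd_segment a b t).
  by apply: hf; exact: cmod_convex.
by move=> t /andP[t0 t1]; rewrite cmodM ler_wpM2r ?cmod_ge0//; apply: hM; apply: cmod_convex => //; exact: ltW.
Qed.

Lemma real_antiderivative (v : R -> R) : continuous v -> exists V : R -> R,
  (forall t : R, 0 <= t <= 1 -> is_derive t 1 V (v t)) /\
  \int[leb]_(t in `[0%R, 1%R]) v t = V 1 - V 0.
Proof.
(* Integrating from -1 makes 0 an interior point, so that the fundamental theorem gives a two-sided
   derivative at both ends of [0, 1]. *)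
move=> cv; set V := fun x => \int[leb]_(t in [set` Interval (BLeft (-1)) (BRight x)]) v t.
have hV (t : R) : 0 <= t <= 1 -> is_derive t 1 V (v t).
  move=> /andP[t0 t1].
  have [] := @continuous_FTC1 R v (BLeft (-1)) t 2.
  - by apply: le_lt_trans t1 _; rewrite ltr1n.
  - apply: continuous_compact_integrable; first exact: segment_compact.
    exact: continuous_subspaceT.
  - by rewrite lte_fin; apply: lt_le_trans t0; rewrite ltrN10.
  - exact: cv.
  by move=> dV <-; rewrite derive1E; apply: derivableP.
exists V; split => //.
rewrite /Rintegral (@continuous_FTC2 _ v V 0 1 ltr01); first by [].
- exact: continuous_subspaceT.
- have cV t : 0 <= t <= 1 -> {for t, continuous V}.
    move=> /hV ht; apply: differentiable_continuous; apply/derivable1_diffP.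
    exact: ex_derive.
  split.
  + by move=> x; rewrite in_itv /= => /andP[x0 x1]; apply: (@ex_derive _ _ _ _ _ _ (v x)); apply: hV; rewrite !ltW.
  + by apply: cvg_at_right_filter; apply: cV; rewrite lexx ler01.
  + by apply: cvg_at_left_filter; apply: cV; rewrite lexx ler01.
- move=> x; rewrite in_itv /= => /andP[x0 x1]; rewrite derive1E.
  by apply: derive_val; apply: hV; rewrite !ltW.
Qed.

Definition cintegral u : C :=
  (\int[leb]_(t in `[0%R, 1%R]) complex.Re (u t)) +i*
  (\int[leb]_(t in `[0%R, 1%R]) complex.Im (u t)).

Lemma path_antiderivative u :
  (forall (t e : R), 0 < e -> exists2 dl : R, 0 < dl & forall s,
     `|s - t| < dl -> cmod (u s - u t) <= e) ->
  exists U, (forall t, 0 <= t <= 1 -> isrd U t (u t)) /\ cintegral u = U 1 - U 0.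
Proof.
move=> cu.
have cp (p : C -> R) : (forall z w, p (z - w) = p z - p w) ->
    (forall z, `|p z| <= cmod z) -> continuous (fun t => p (u t)).
  move=> hp hle t; apply/cvgrPdist_le => e /(cu t) [dl dl0 hd].
  apply/nbhs_ballP; exists dl => //= s; rewrite /ball /= distrC => /hd hs.
  by rewrite distrC -hp; apply: le_trans hs.
have [V [hV EV]] := real_antiderivative (cp _ (@ReB _) (@Re_le_cmod _)).
have [W [hW EW]] := real_antiderivative (cp _ (@ImB _) (@Im_le_cmod _)).
exists (fun t => V t +i* W t : C); split; last by rewrite /cintegral EV EW.
move=> t ht e e0; have e2 : 0 < e / 2 by rewrite divr_gt0.
have /is_deriveP /(_ _ e2) [r r0 h1] := hV _ ht.
have /is_deriveP /(_ _ e2) [s s0 h2] := hW _ ht.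
exists (Num.min r s); first by rewrite lt_min r0.
move=> x; rewrite -rmorphB cmod_real lt_min => /andP[/h1 {}h1 /h2 {}h2].
apply: le_trans (cmod_le_ReIm _) _.
case: (u t) h1 h2 => p q /= h1 h2; rewrite !mulr0 subr0 add0r.
lra.
Qed.

(** Retraction of R onto [0, 1]: composed with it, a path given on [0, 1] becomes continuous on all
    of R, as [path_antiderivative] requires. *)
Definition clamp (t : R) : R := Num.max 0 (Num.min 1 t).

Lemma clamp01 t : 0 <= clamp t <= 1.
Proof. by rewrite /clamp le_max lexx ge_max ler01 ge_min lexx. Qed.

Lemma clampE t : 0 <= t <= 1 -> clamp t = t.
Proof. by move=> /andP[h0 h1]; rewrite /clamp (min_idPr h1) (max_idPr h0). Qed.

Lemma clamp_lip s t : `|clamp s - clamp t| <= `|s - t|.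
Proof.
rewrite /clamp /Num.max /Num.min; have := ler_norm (s - t); have := ler_norm (t - s).
rewrite distrC => h1 h2; rewrite ler_norml.
by case: (ltP 1 s) => s1; case: (ltP 1 t) => t1; rewrite ?ltr01; case: ltP => a0; case: ltP => b0; lra.
Qed.

Definition holomorphic f := forall z, disk z -> exists d, isd f z d.

Definition segint h a b : C := (b - a) * cintegral (fun t => h (a + t%:C * (b - a))).

Lemma disk_segment a b t : disk a -> disk b -> 0 <= t <= 1 -> disk (a + t%:C * (b - a)).
Proof.
move=> ha hb /andP[t0 t1].
apply: (@le_lt_trans _ _ (Num.max (cmod a) (cmod b))); last by rewrite gt_max; apply/andP.
by apply: cmod_convex => //; rewrite le_max lexx ?orbT.
Qed.

Lemma segint_antiderivative h a b : holomorphic h -> disk a -> disk b ->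
  exists U, (forall t, 0 <= t <= 1 -> isrd U t ((b - a) * h (a + t%:C * (b - a)))) /\
    segint h a b = U 1 - U 0.
Proof.
move=> hh ha hb.
have [|U [hU EU]] := @path_antiderivative (fun t => h (a + (clamp t)%:C * (b - a))).
  move=> t e e0; have [d hd] := hh _ (disk_segment ha hb (clamp01 t)).
  have [dl dl0 h1] := hasd_cont hd e0.
  have K0 : 0 < cmod (b - a) + 1 by rewrite ltr_wpDl ?cmod_ge0.
  exists (dl / (cmod (b - a) + 1)); first by rewrite divr_gt0.
  move=> s hs; apply: h1.
  rewrite [X in cmod X](_ : _ = (clamp s - clamp t)%:C * (b - a)); last first.
    by rewrite rmorphB; ring.
  rewrite cmodM cmod_real; apply: le_lt_trans (_ : _ <= `|s - t| * (cmod (b - a) + 1)) _.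
    by rewrite ler_pM ?cmod_ge0 ?clamp_lip ?lerDl.
  by rewrite -ltr_pdivlMr.
exists (fun t => (b - a) * U t); split.
  by move=> t ht; apply: hasdMl; have := hU _ ht; rewrite clampE.
rewrite -mulrBr -EU /segint /cintegral; congr (_ * (_ +i* _)).
  by apply: eq_Rintegral => t; rewrite inE /= in_itv /= => ht; rewrite clampE.
by apply: eq_Rintegral => t; rewrite inE /= in_itv /= => ht; rewrite clampE.
Qed.

Lemma segint_near h a b V (v : R -> C) (e : R) : holomorphic h -> disk a -> disk b ->
  (forall t, 0 <= t <= 1 -> isrd V t (v t)) ->
  (forall t, 0 < t < 1 -> cmod (v t - (b - a) * h (a + t%:C * (b - a))) <= e) ->
  cmod (V 1 - V 0 - segint h a b) <= e.
Proof.
move=> hh ha hb hV hv; have [U [hU ->]] := segint_antiderivative hh ha hb.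
rewrite [X in cmod X](_ : _ = (V 1 - U 1) - (V 0 - U 0)); last by ring.
apply: mean_value_path (fun t ht => hasdB (hV t ht) (hU t ht)) _ => t ht.
exact: hv.
Qed.

Lemma segint_unique h a b V : holomorphic h -> disk a -> disk b ->
  (forall t, 0 <= t <= 1 -> isrd V t ((b - a) * h (a + t%:C * (b - a)))) ->
  segint h a b = V 1 - V 0.
Proof.
move=> hh ha hb hV; apply/eqP; rewrite eq_sym -subr_eq0 -cmod_eq0 eq_le cmod_ge0 andbT.
by apply: segint_near hV _ => // t _; rewrite subrr cmod0.
Qed.

Lemma segint_opp h a b : holomorphic h -> disk a -> disk b -> segint h b a = - segint h a b.
Proof.
move=> hh ha hb; have [U [hU ->]] := segint_antiderivative hh ha hb.
rewrite (@segint_unique _ _ _ (fun t => U (-1 * t + 1)))//.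
  by rewrite mulr1 mulr0 add0r addNr opprB.
move=> t /andP[t0 t1].
have /(@isrd_affine _ t (-1) 1) h1 : isrd U (-1 * t + 1) ((b - a) * h (a + (-1 * t + 1)%:C * (b - a))).
  by apply: hU; apply/andP; split; lra.
have E1 : (-1)%:C = -1 :> C by rewrite rmorphN rmorph1.
have E2 : (-1 * t + 1)%:C = 1 - t%:C :> C by rewrite mulN1r rmorphD rmorphN rmorph1 addrC.
apply: hasd_eq h1 _; rewrite E1 E2.
rewrite (_ : a + _ * _ = b + t%:C * (a - b)); last by ring.
by ring.
Qed.

Definition midpoint a b : C := (2^-1 : R)%:C * (a + b).

Lemma half_half : (2^-1 : R)%:C + (2^-1 : R)%:C = 1 :> C.
Proof. by rewrite -rmorphD -[RHS](rmorph1 (real_complex R)); congr (_%:C); field. Qed.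

Lemma midpoint_sub a b x : midpoint a b - x = (2^-1 : R)%:C * (a - x + (b - x)).
Proof. by rewrite /midpoint -{1}[x]mul1r -half_half; ring. Qed.

Lemma midpointE a b : midpoint a b = a + (2^-1 : R)%:C * (b - a).
Proof. by rewrite /midpoint -{2}[a]mul1r -half_half; ring. Qed.

Lemma disk_midpoint a b : disk a -> disk b -> disk (midpoint a b).
Proof. by move=> ha hb; rewrite midpointE; apply: disk_segment => //; apply/andP; split; lra. Qed.

Lemma segint_midpoint h a b : holomorphic h -> disk a -> disk b ->
  segint h a b = segint h a (midpoint a b) + segint h (midpoint a b) b.
Proof.
move=> hh ha hb; have [U [hU ->]] := segint_antiderivative hh ha hb.
have hm := disk_midpoint ha hb.
have E1 : midpoint a b - a = (2^-1 : R)%:C * (b - a) by rewrite midpointE; ring.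
have E2 : b - midpoint a b = (2^-1 : R)%:C * (b - a).
  by rewrite -opprB midpoint_sub; ring.
rewrite (@segint_unique _ _ _ (fun t => U (2^-1 * t + 0)))//; last first.
  move=> t /andP[t0 t1].
  have /isrd_affine h1 : isrd U (2^-1 * t + 0) ((b - a) * h (a + (2^-1 * t + 0)%:C * (b - a))).
    by apply: hU; apply/andP; split; lra.
  apply: hasd_eq h1 _; rewrite E1 addr0 rmorphM.
  rewrite (_ : a + _ * (_ * (b - a)) = a + (2^-1)%:C * t%:C * (b - a)); last by ring.
  by ring.
rewrite (@segint_unique _ _ _ (fun t => U (2^-1 * t + 2^-1)))//; last first.
  move=> t /andP[t0 t1].
  have /isrd_affine h1 : isrd U (2^-1 * t + 2^-1) ((b - a) * h (a + (2^-1 * t + 2^-1)%:C * (b - a))).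
    by apply: hU; apply/andP; split; lra.
  apply: hasd_eq h1 _; rewrite E2 rmorphD rmorphM midpointE.
  rewrite (_ : a + (2^-1)%:C * (b - a) + _ = a + ((2^-1)%:C * t%:C + (2^-1)%:C) * (b - a)); last by ring.
  by ring.
rewrite !mulr1 !mulr0 !addr0 !add0r (_ : 2^-1 + 2^-1 = 1 :> R); last by field.
by ring.
Qed.

(** An affine integrand has the antiderivative [al * z + be / 2 * (z - z0)^2], so its integral
    depends only on the end points; the three such terms cancel around a triangle in [goursat]. *)
Lemma segint_affine h a b z0 (al be : C) (e : R) : holomorphic h -> disk a -> disk b ->
  (forall t, 0 < t < 1 -> cmod (h (a + t%:C * (b - a)) - al - be * (a + t%:C * (b - a) - z0)) <= e) ->
  cmod ((al * b + be * (2^-1 : R)%:C * (b - z0) ^+ 2) - (al * a + be * (2^-1 : R)%:C * (a - z0) ^+ 2)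
     - segint h a b) <= e * cmod (b - a).
Proof.
move=> hh ha hb he.
pose V t : C := al * (a + t%:C * (b - a)) + be * (2^-1 : R)%:C * (a + t%:C * (b - a) - z0) ^+ 2.
have h1 t : isrd (fun s => a + s%:C * (b - a) - z0) t (b - a).
  by apply: hasd_eq (hasdB (isrd_segment a b t) (hasd_cst _ z0 t)) _; rewrite subr0.
have hV t : 0 <= t <= 1 -> isrd V t ((b - a) * (al + be * (a + t%:C * (b - a) - z0))).
  move=> _; apply: hasd_eq (hasdD (hasdMl al (isrd_segment a b t))
    (hasdMl (be * (2^-1 : R)%:C) (hasdX 2 (h1 t)))) _.
  rewrite /= expr1 [RHS]mulrDr [(b - a) * al]mulrC; congr (_ + _).
  have E : (2^-1 : R)%:C * 2%:R = 1 :> C by rewrite mulr_natr mulr2n half_half.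
  rewrite (_ : be * _ * _ = be * ((2^-1)%:C * 2%:R) * (a + t%:C * (b - a) - z0) * (b - a)); last by ring.
  by rewrite E; ring.
have := segint_near hh ha hb hV; rewrite /V mul1r mul0r addr0 subrKC; apply=> t /he ht.
rewrite -mulrBr cmodM mulrC ler_wpM2r ?cmod_ge0// cmodC.
by rewrite opprD addrA.
Qed.

Lemma segint_const h a b (al : C) (e : R) : holomorphic h -> disk a -> disk b ->
  (forall t, 0 < t < 1 -> cmod (h (a + t%:C * (b - a)) - al) <= e) ->
  cmod (segint h a b - al * (b - a)) <= e * cmod (b - a).
Proof.
move=> hh ha hb he; rewrite cmodC.
have := @segint_affine h a b 0 al 0 e hh ha hb; rewrite !mul0r !addr0 -mulrBr; apply=> t /he.
by rewrite mul0r subr0.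
Qed.

Definition triint h (T : C * C * C) : C :=
  let: (a, b, c) := T in segint h a b + segint h b c + segint h c a.
Definition perim (T : C * C * C) : R :=
  let: (a, b, c) := T in cmod (b - a) + cmod (c - b) + cmod (a - c).
Definition vertex (T : C * C * C) : C := T.1.1.
Definition in_disk (r : R) (T : C * C * C) : Prop :=
  [/\ cmod T.1.1 <= r, cmod T.1.2 <= r & cmod T.2 <= r].

Lemma cmod_midpoint a b (r : R) : cmod a <= r -> cmod b <= r -> cmod (midpoint a b) <= r.
Proof. by move=> ha hb; rewrite midpointE; apply: cmod_convex => //; lra. Qed.

Lemma cmod_half z : cmod ((2^-1 : R)%:C * z) = 2^-1 * cmod z.
Proof. by rewrite cmodM cmod_real ger0_norm// invr_ge0. Qed.

(** Joining the midpoints of the sides gives four triangles whose integrals add up to the original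
    one, because inner sides are traversed in both directions; one of the four carries at least a
    quarter of the modulus. *)
Lemma goursat_step h (r : R) T : holomorphic h -> r < 1 -> in_disk r T ->
  exists T', [/\ in_disk r T', perim T' = perim T / 2,
    cmod (vertex T' - vertex T) <= perim T & cmod (triint h T) / 4 <= cmod (triint h T')].
Proof.
case: T => [[a b] c] hh r1 [/= ha hb hc].
have dk z : cmod z <= r -> disk z by move=> hz; exact: le_lt_trans hz r1.
have [[da db] dc] := (dk _ ha, dk _ hb, dk _ hc).
have [[mab mbc] mca] := (cmod_midpoint ha hb, cmod_midpoint hb hc, cmod_midpoint hc ha).
have [[dab dbc] dca] := (dk _ mab, dk _ mbc, dk _ mca).
set m1 := midpoint a b in mab dab *; set m2 := midpoint b c in mbc dbc *.
set m3 := midpoint c a in mca dca *.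
have E : triint h (a, b, c) = triint h (a, m1, m3) + triint h (m1, b, m2) +
    triint h (m3, m2, c) + triint h (m1, m2, m3).
  rewrite /= (segint_midpoint hh da db) (segint_midpoint hh db dc) (segint_midpoint hh dc da).
  rewrite -/m1 -/m2 -/m3 (segint_opp hh dab dca) (segint_opp hh dbc dab) (segint_opp hh dbc dca).
  by rewrite (segint_opp hh dca dbc) ; ring.
have dist (x y : C) : 0 <= cmod (x - y) by exact: cmod_ge0.
have p0 : 0 <= perim (a, b, c) by rewrite /= !addr_ge0.
have ca : cmod (m1 - a) = 2^-1 * cmod (b - a) by rewrite -cmod_half midpoint_sub subrr add0r.
have cb : cmod (m1 - b) = 2^-1 * cmod (b - a) by rewrite cmodC -cmod_half -cmodN opprB midpoint_sub subrr addr0 -cmodN -mulrN opprB.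
have cc : cmod (m2 - b) = 2^-1 * cmod (c - b) by rewrite -cmod_half midpoint_sub subrr add0r.
have cd : cmod (m2 - c) = 2^-1 * cmod (c - b) by rewrite midpoint_sub subrr addr0 cmod_half cmodC.
have ce : cmod (m3 - c) = 2^-1 * cmod (a - c) by rewrite -cmod_half midpoint_sub subrr add0r.
have cf : cmod (m3 - a) = 2^-1 * cmod (a - c) by rewrite midpoint_sub subrr addr0 cmod_half cmodC.
have c12 : cmod (m2 - m1) = 2^-1 * cmod (a - c).
  by rewrite -cmod_half -cmodN; congr cmod; rewrite /m1 /m2 /midpoint; ring.
have c23 : cmod (m3 - m2) = 2^-1 * cmod (b - a).
  by rewrite -cmod_half -cmodN; congr cmod; rewrite /m3 /m2 /midpoint; ring.
have c31 : cmod (m1 - m3) = 2^-1 * cmod (c - b).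
  by rewrite -cmod_half -cmodN; congr cmod; rewrite /m3 /m1 /midpoint; ring.
have [h1|h1] := lerP (cmod (triint h (a, b, c)) / 4) (cmod (triint h (a, m1, m3))).
  exists (a, m1, m3); split=> //; last by rewrite /vertex /= subrr cmod0.
  by rewrite /perim ca (cmodC m3) c31 (cmodC a) cf; field.
have [h2|h2] := lerP (cmod (triint h (a, b, c)) / 4) (cmod (triint h (m1, b, m2))).
  exists (m1, b, m2); split=> //.
    by rewrite /perim (cmodC b m1) cb cc (cmodC m1 m2) c12; field.
  rewrite /vertex /= ca; move: (dist b a) (dist c b) (dist a c); lra.
have [h3|h3] := lerP (cmod (triint h (a, b, c)) / 4) (cmod (triint h (m3, m2, c))).
  exists (m3, m2, c); split=> //.
    by rewrite /perim (cmodC m2 m3) c23 (cmodC c m2) cd ce; field.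
  rewrite /vertex /= cf; move: (dist b a) (dist c b) (dist a c); lra.
exists (m1, m2, m3); split=> //.
- by rewrite /perim c12 c23 c31; field.
- rewrite /vertex /= ca; move: (dist b a) (dist c b) (dist a c); lra.
have := cmodD (triint h (a, m1, m3) + triint h (m1, b, m2) + triint h (m3, m2, c)) (triint h (m1, m2, m3)).
have := cmodD (triint h (a, m1, m3) + triint h (m1, b, m2)) (triint h (m3, m2, c)).
have := cmodD (triint h (a, m1, m3)) (triint h (m1, b, m2)).
rewrite -E -[segint h a b + _ + _]/(triint h (a, b, c)); move: (triint h (a, b, c)) (triint h (a, m1, m3)) (triint h (m1, b, m2))
   (triint h (m3, m2, c)) (triint h (m1, m2, m3)) h1 h2 h3 => x0 x1 x2 x3 x4; lra.
Qed.

Lemma perim_ge0 T : 0 <= perim T.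
Proof. by case: T => [[a b] c]; rewrite /= !addr_ge0 ?cmod_ge0. Qed.

Lemma cvg_half_pow (a : R) : (a / 2 ^+ n) @[n --> \oo] --> (0 : R).
Proof.
under eq_fun do rewrite -exprVn.
by apply: (@cvg_geometric R a 2^-1); rewrite ger0_norm ?invr_ge0// invf_lt1// ltr1n.
Qed.

Lemma geometric_cauchy (x : nat -> C) (K : R) : 0 <= K ->
  (forall n, cmod (x n.+1 - x n) <= K / 2 ^+ n) ->
  exists l, forall n, cmod (x n - l) <= 2 * K / 2 ^+ n.
Proof.
move=> K0 hx.
have p2 n : 0 < (2 : R) ^+ n by rewrite exprn_gt0.
have hd n k : cmod (x (n + k)%N - x n) <= 2 * K / 2 ^+ n - 2 * K / 2 ^+ (n + k).
  elim: k => [|k IH]; first by rewrite addn0 !subrr cmod0.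
  apply: le_trans (cmodB3 (x (n + k)%N) _ _) _; rewrite addnS.
  apply: le_trans (lerD (hx _) IH) _.
  have -> : 2 * K / 2 ^+ (n + k).+1 = K / 2 ^+ (n + k).
    by rewrite exprS invfM mulrACA divff// mul1r.
  rewrite (_ : 2 * K / 2 ^+ (n + k) = K / 2 ^+ (n + k) + K / 2 ^+ (n + k)); last first.
    by ring.
  lra.
have hd' n k : cmod (x (n + k)%N - x n) <= 2 * K / 2 ^+ n.
  by apply: le_trans (hd n k) _; rewrite gerBl divr_ge0 ?mulr_ge0// ltW.
have [l hl] : exists l, clim x l.
  apply: clim_cauchy => e e0.
  have [N hN] : exists N, 4 * K / 2 ^+ N <= e.
    have := cvg_half_pow (4 * K).
    by move=> /cvgrPdist_le /(_ _ e0) [N _ /(_ N (leqnn _))] /=; rewrite sub0r normrN => h; exists N; apply: le_trans (ler_norm _) h.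
  exists N => n k hn hk; apply: le_trans (cmodB3 (x N) _ _) _.
  rewrite [X in _ + X]cmodC -(subnKC hn) -(subnKC hk).
  apply: le_trans (lerD (hd' _ _) (hd' _ _)) _; apply: le_trans hN.
  by rewrite le_eqVlt; apply/orP; left; apply/eqP; ring.
exists l => n; rewrite cmodC.
have : clim (fun k => x (k + n)%N - x n) (l - x n).
  by apply: climB (clim_cst _); exact: clim_shift.
by move=> /clim_cmod_le; apply=> k; rewrite addnC.
Qed.

(** Nested triangles shrink to a point [z0]. At depth n the integral is at least its initial modulus
    over 4^n, while differentiability at [z0] bounds it by a small multiple of the squared
    perimeter, which also scales as 4^-n. *)
Lemma goursat h a b c : holomorphic h -> disk a -> disk b -> disk c ->
  segint h a b + segint h b c + segint h c a = 0.
Proof.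
move=> hh ha hb hc; rewrite -[LHS]/(triint h (a, b, c)).
set r := Num.max (cmod a) (Num.max (cmod b) (cmod c)).
have r1 : r < 1 by rewrite /r !gt_max; apply/and3P.
have hT : in_disk r (a, b, c) by split; rewrite /= /r !le_max lexx ?orbT.
move: r1 hT; move: r (a, b, c) => {a b c ha hb hc} r T0 r1 hT.
have [nxt nxtP] : exists nxt, forall T, in_disk r T ->
    [/\ in_disk r (nxt T), perim (nxt T) = perim T / 2,
     cmod (vertex (nxt T) - vertex T) <= perim T & cmod (triint h T) / 4 <= cmod (triint h (nxt T))].
  (* [goursat_step] becomes a function by choice; the iteration stays in [in_disk r] and never meets
     the default [T]. *)
  exists (fun T => if pselect (in_disk r T) is left hT then projT1 (cid (goursat_step hh r1 hT)) else T).
  by move=> T hT'; case: pselect => // ?; case: cid.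
pose Tn n := iter n nxt T0.
have p2 n : 0 < (2 : R) ^+ n by rewrite exprn_gt0.
have inT n : in_disk r (Tn n) by elim: n => // n /nxtP [].
have peT n : perim (Tn n) = perim T0 / 2 ^+ n.
  elim: n => [|n IH]; first by rewrite expr0 divr1.
  by have [_ -> _ _] := nxtP _ (inT n); rewrite -/(Tn n) IH exprSr invfM mulrA.
have trT n : cmod (triint h T0) / 4 ^+ n <= cmod (triint h (Tn n)).
  elim: n => [|n IH]; first by rewrite expr0 divr1.
  have [_ _ _] := nxtP _ (inT n); apply: le_trans; rewrite -/(Tn n) exprSr invfM mulrA.
  by rewrite ler_pM2r.
have [|z0 hz0] := @geometric_cauchy (fun n => vertex (Tn n)) (perim T0) (perim_ge0 _).
  by move=> n; have [_ _ + _] := nxtP _ (inT n); rewrite -/(Tn n) peT.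
have hcv := cvg_half_pow (3 * perim T0).
have dz0 : disk z0.
  apply: le_lt_trans (_ : r < 1) => //; apply/ler_addgt0Pr => e e0.
  have /cvgrPdist_lt /(_ _ e0) [N _ /(_ N (leqnn _))] := hcv.
  rewrite /= sub0r normrN => /(le_lt_trans (ler_norm _)) hN.
  rewrite -(subrK (vertex (Tn N)) z0); apply: le_trans (cmodD _ _) _.
  rewrite addrC lerD//; first by have [] := inT N; rewrite /vertex.
  rewrite cmodC; apply: le_trans (hz0 N) _; apply: le_trans _ (ltW hN).
  by rewrite ler_pM2r ?invr_gt0// ler_wpM2r ?perim_ge0// ler_nat.
have [d hd] := hh _ dz0.
apply/eqP; rewrite -cmod_eq0 eq_le cmod_ge0 andbT.
apply/ler_addgt0Pr => e e0; rewrite add0r.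
have [e' e'0 he'] : exists2 e' : R, 0 < e' & 3 * e' * perim T0 ^+ 2 <= e.
  have K0 : 0 < 3 * (perim T0 ^+ 2 + 1) by rewrite mulr_gt0// ltr_wpDl ?sqr_ge0.
  exists (e / (3 * (perim T0 ^+ 2 + 1))); first by rewrite divr_gt0.
  have Q1 : 0 < perim T0 ^+ 2 + 1 by rewrite ltr_wpDl ?sqr_ge0.
  rewrite (_ : 3 * _ * _ = e * perim T0 ^+ 2 / (perim T0 ^+ 2 + 1)).
    by rewrite ler_pdivrMr// ler_pM2l// lerDl.
  by field; rewrite gt_eqF.
have [dl dl0 hdl] := hd _ e'0.
have /cvgrPdist_lt /(_ _ dl0) [n _ /(_ n (leqnn _))] := hcv.
rewrite /= sub0r normrN => /(le_lt_trans (ler_norm _)) hn.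
have p4 : (4 : R) ^+ n = 2 ^+ n * 2 ^+ n by rewrite -exprMn; congr (_ ^+ n); rewrite -natrM.
have := le_trans (trT n) (_ : _ <= 3 * e' * (perim T0 / 2 ^+ n) ^+ 2).
have -> : 3 * e' * (perim T0 / 2 ^+ n) ^+ 2 = 3 * e' * perim T0 ^+ 2 / 4 ^+ n.
  by rewrite p4; field; rewrite gt_eqF.
rewrite ler_pM2r ?invr_gt0 ?exprn_gt0// => h3.
apply: le_trans (h3 _) he'.
have -> : 3 * e' * perim T0 ^+ 2 / 4 ^+ n = 3 * e' * (perim T0 / 2 ^+ n) ^+ 2.
  by rewrite p4; field; rewrite gt_eqF.
have -> : 3 * e' * (perim T0 / 2 ^+ n) ^+ 2 = (e' * (3 * (perim T0 / 2 ^+ n))) * (perim T0 / 2 ^+ n) by ring.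
move: hn; rewrite -mulrA -peT => hn.
have := hz0 n; rewrite -mulrA -peT; move: (inT n) hn (h3) => {h3}.
case: (Tn n) => [[a b] c] /= [/= ra rb rc].
set p := cmod (b - a) + cmod (c - b) + cmod (a - c) => hp _ haz.
rewrite {1}/vertex /= in haz.
have dk z : cmod z <= r -> disk z by move=> hz; exact: le_lt_trans hz r1.
have p0 : 0 <= p by rewrite /p !addr_ge0 ?cmod_ge0.
have side x y : cmod x <= r -> cmod y <= r -> cmod (x - a) <= p -> cmod (y - a) <= p ->
   cmod ((h z0 * y + d * (2^-1 : R)%:C * (y - z0) ^+ 2) - (h z0 * x + d * (2^-1 : R)%:C * (x - z0) ^+ 2)
     - segint h x y) <= e' * (3 * p) * cmod (y - x).
  move=> hx hy hxa hya; apply: segint_affine; [by []|exact: dk|exact: dk|].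
  move=> t /andP[t0 t1].
  (* A point of the triangle is within [p] of its vertex [a], and [a] is within [2 * p] of [z0], the
     sum of this perimeter and all later ones. *)
  have hw : cmod (x + t%:C * (y - x) - z0) <= 3 * p.
    rewrite [X in cmod X](_ : _ = ((x - a) + t%:C * ((y - a) - (x - a))) + (a - z0)); last by ring.
    apply: le_trans (cmodD _ _) _.
    have := cmod_convex (ltW t0) (ltW t1) hxa hya; lra.
  apply: le_trans (hdl _ _) _; first by apply: le_lt_trans hw _.
  by rewrite ler_pM2l.
have := side a b ra rb; rewrite subrr cmod0 => /(_ p0) h1.
have := side b c rb rc => h2.
have := side c a rc ra; rewrite subrr cmod0 => h3.
have pba : cmod (b - a) <= p by rewrite /p -addrA lerDl addr_ge0 ?cmod_ge0.
have pca : cmod (c - a) <= p by rewrite cmodC /p lerDr addr_ge0 ?cmod_ge0.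
move: (h1 pba) (h2 pba pca) (h3 pca p0) => {h1 h2 h3}.
set qa := h z0 * a + _; set qb := h z0 * b + _; set qc := h z0 * c + _.
move=> h1 h2 h3; rewrite -cmodN.
rewrite [X in cmod X](_ : _ = (qb - qa - segint h a b) + (qc - qb - segint h b c) +
  (qa - qc - segint h c a)); last by ring.
apply: le_trans (cmodD _ _) _; apply: le_trans (lerD (cmodD _ _) (lexx _)) _.
apply: le_trans (lerD (lerD h1 h2) h3) _.
by rewrite -!mulrDr.
Qed.

(** Goursat on the triangle 0, z, w makes the increment of the primitive equal to the integral over
    the short segment from z to w, where continuity of [h] at z concludes. *)
Lemma isd_segint h z : holomorphic h -> disk z -> isd (segint h 0) z (h z).
Proof.
move=> hh hz e e0; have [d hd] := hh _ hz; have [dl dl0 h1] := hasd_cont hd e0.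
have z1 : 0 < 1 - cmod z by rewrite subr_gt0.
exists (Num.min dl (1 - cmod z)); first by rewrite lt_min dl0.
move=> w; rewrite lt_min => /andP[h2 h3].
have hw : disk w.
  by move: h3; rewrite ltrBrDl => /(le_lt_trans _); apply; rewrite -{1}(subrK z w) addrC cmodD.
have := goursat hh disk0 hz hw; rewrite (segint_opp hh disk0 hw) => E.
rewrite (_ : segint h 0 w - segint h 0 z = segint h z w); last first.
  by apply/eqP; rewrite eq_sym -subr_eq0; apply/eqP; rewrite -[RHS]E; ring.
apply: segint_const => // t /andP[t0 t1]; apply: h1.
rewrite addrAC subrr add0r cmodM cmod_real ger0_norm ?ltW//.
by apply: le_lt_trans h2; rewrite -[leRHS]mul1r ler_wpM2r ?cmod_ge0 ?ltW.
Qed.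

Lemma primitive0E h : primitive0 h = segint h 0.
Proof.
apply/funext => z; rewrite /primitive0 /segint subr0; congr (_ * (_ +i* _)).
  by apply: eq_Rintegral => t _; rewrite add0r.
by apply: eq_Rintegral => t _; rewrite add0r.
Qed.

Lemma isd_primitive0 h z : holomorphic h -> disk z -> isd (primitive0 h) z (h z).
Proof. by rewrite primitive0E; exact: isd_segint. Qed.

Lemma primitive0_0 h : primitive0 h 0 = 0.
Proof. by rewrite /primitive0 mul0r. Qed.

End Primitive.

(** * Cauchy's formula through means over roots of unity *)

Section CircleMeans.
Context {R : realType}.
Local Notation C := (cplx R).
Implicit Types (f h P Q : C -> C) (a b c z w : C).

Lemma continuous_plane (G : R * R -> R) (p : R * R) :
  (forall e : R, 0 < e -> exists2 dl : R, 0 < dl & forall q,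
     cmod ((q.1 +i* q.2 : C) - (p.1 +i* p.2)) < dl -> `|G q - G p| <= e) ->
  {for p, continuous G}.
Proof.
move=> h; apply/cvgrPdist_le => e /h [dl dl0 hd].
change (nbhs p (fun t => `|G p - G t| <= e)); rewrite -nbhs_ballE; exists (dl / 2); first by rewrite /= divr_gt0.
move=> q [/= h1 h2]; rewrite distrC; apply: hd.
apply: le_lt_trans (cmod_le_ReIm _) _; rewrite /= [ltRHS](splitr dl).
by rewrite ltrD// distrC.
Qed.

(** Compactness is taken in [R * R]: the closed disk is a closed subset of a product of two
    segments, and the modulus of [f] is continuous on it. *)
Lemma holomorphic_bounded f (r : R) : holomorphic f -> r < 1 ->
  exists2 M : R, 0 <= M & forall z, cmod z <= r -> cmod (f z) <= M.
Proof.
move=> hf r1; pose c2 (p : R * R) : C := p.1 +i* p.2.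
pose A : set (R * R) := [set p | cmod (c2 p) <= r].
have cA : compact A.
  apply: (@subclosed_compact _ A (`[- r, r]%classic `*` `[- r, r]%classic)).
  - have -> : A = (fun p => cmod (c2 p)) @^-1` [set x : R | x <= r] by [].
    apply: closed_comp; last exact: closed_le.
    move=> p _; apply: continuous_plane => e e0; exists e => // q /ltW hq.
    rewrite ler_norml.
    have := cmod_subl (c2 q) (c2 p); have := cmod_subl (c2 p) (c2 q).
    rewrite cmodC => h1 h2; move: (le_trans h1 hq) (le_trans h2 hq); rewrite /c2; lra.
  - by apply: compact_setX; exact: segment_compact.
  - move=> p /= hp; rewrite !in_itv /= -!ler_norml; split.
      exact: le_trans (Re_le_cmod (c2 p)) hp.
    exact: le_trans (Im_le_cmod (c2 p)) hp.
have : compact [set cmod (f (c2 p)) | p in A].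
  apply: continuous_compact cA; apply: continuous_in_subspaceT => p.
  rewrite inE => hp; have [d hd0] := hf (c2 p) (le_lt_trans hp r1); have hd := hasd_cont hd0.
  apply: continuous_plane => e /hd [dl dl0 h1]; exists dl => // q /h1.
  move=> h2; have := cmod_subl (f (c2 q)) (f (c2 p)); have := cmod_subl (f (c2 p)) (f (c2 q)).
  rewrite cmodC => h3 h4; rewrite ler_norml.
  by move: (le_trans h3 h2) (le_trans h4 h2); lra.
move=> /compact_bounded [M [_ hM]]; exists (`|M| + 1); first by rewrite addr_ge0.
move=> z hz; apply: le_trans (ler_norm _) _; apply: (hM (`|M| + 1)).
  by apply: le_lt_trans (ler_norm _) _; rewrite ltrDl.
by exists (complex.Re z, complex.Im z); rewrite /A /c2 /=; case: z hz.
Qed.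

Definition expi (x : R) : C := cos x +i* sin x.

Lemma expi0 : expi 0 = 1.
Proof. by rewrite /expi cos0 sin0. Qed.

Lemma expiD x y : expi (x + y) = expi x * expi y.
Proof.
rewrite /expi cosD sinD; apply/eqP; rewrite eq_complex /=; apply/andP; split=> //.
by apply/eqP; ring.
Qed.

Lemma expiMn x n : expi (x *+ n) = expi x ^+ n.
Proof. by elim: n => [|n IH]; rewrite ?mulr0n ?expi0// mulrS expiD IH exprS. Qed.

Lemma cmod_expi x : cmod (expi x) = 1.
Proof. by rewrite cmod_def /= cos2Dsin2 sqrtr1. Qed.

Lemma expi2pi : expi (pi *+ 2) = 1.
Proof. by rewrite /expi cos2pi sin2pi. Qed.

Lemma isrd_expi t : isrd expi t ((- sin t) +i* cos t).
Proof.
move=> e e0; have e2 : 0 < e / 2 by rewrite divr_gt0.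
have /is_deriveP /(_ _ e2) [r r0 h1] := is_derive_cos t.
have /is_deriveP /(_ _ e2) [s s0 h2] := is_derive_sin t.
exists (Num.min r s); first by rewrite lt_min r0.
move=> x; rewrite -rmorphB cmod_real lt_min => /andP[/h1 {}h1 /h2 {}h2].
apply: le_trans (cmod_le_ReIm _) _.
rewrite /= !mulr0 subr0 add0r; lra.
Qed.

Lemma expi_lip (x y : R) : cmod (expi x - expi y) <= `|x - y|.
Proof.
have := @mean_value_path R (fun s => expi ((x - y) * s + y))
  (fun t => (x - y)%:C * ((- sin ((x - y) * t + y)) +i* cos ((x - y) * t + y))) `|x - y|.
rewrite mulr1 mulr0 add0r subrK; apply=> t _.
  by apply: isrd_affine; exact: isrd_expi.
rewrite cmodM cmod_real [X in _ * X](_ : _ = 1) ?mulr1//.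
by rewrite cmod_def /= sqrrN addrC cos2Dsin2 sqrtr1.
Qed.

Lemma expi_surj z : cmod z = 1 -> exists2 x : R, `|x| <= pi & z = expi x.
Proof.
move=> z1; have := sqr_cmod z; rewrite z1 expr1n; case: z z1 => a b /= _ ab1.
have b2 : b ^+ 2 = 1 - a ^+ 2 by rewrite ab1 addrAC subrr add0r.
have a1 : -1 <= a <= 1.
  by move: (sqr_ge0 b) => b0; apply/andP; split; nra.
have s : Num.sqrt (1 - a ^+ 2) = `|b| by rewrite -b2 sqrtr_sqr.
have p0 : 0 <= acos a <= pi by rewrite acos_ge0// acos_lepi.
have [b0|b0] := lerP 0 b.
  exists (acos a); first by rewrite ger0_norm; case/andP: p0.
  by rewrite /expi acosK// sin_acos// s ger0_norm.
exists (- acos a); first by rewrite normrN ger0_norm; case/andP: p0.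
by rewrite /expi cosN sinN acosK// sin_acos// s ltr0_norm// opprK.
Qed.

Lemma pi_lt4 : pi < 4 :> R.
Proof. by have /andP[_] := @pihalf_02 R; rewrite ltr_pdivrMr// -natrM. Qed.

Definition rt (p : nat) : C := expi (pi *+ 2 / 2 ^+ p).

Lemma cmod_rtX p j : cmod (rt p ^+ j) = 1.
Proof. by rewrite cmodX cmod_expi expr1n. Qed.

Lemma rt0 : rt 0 = 1.
Proof. by rewrite /rt expr0 divr1 expi2pi. Qed.

Lemma rtS p : rt p.+1 ^+ 2 = rt p.
Proof.
by rewrite /rt -expiMn; congr expi; rewrite exprS -mulr_natr; field; rewrite expf_neq0.
Qed.

Lemma rt_exp p q j : rt (p + q) ^+ (2 ^ q * j) = rt p ^+ j.
Proof.
elim: q j => [|q IH] j; first by rewrite expn0 mul1n addn0.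
by rewrite addnS expnS -mulnA exprM rtS IH.
Qed.

Lemma rt_order p : rt p ^+ (2 ^ p) = 1.
Proof. by rewrite -[p in rt p]add0n -[(2 ^ p)%N]muln1 rt_exp rt0 expr1n. Qed.

Lemma rt_mod p j : rt p ^+ (j %% 2 ^ p) = rt p ^+ j.
Proof. by rewrite {2}(divn_eq j (2 ^ p)) exprD mulnC exprM rt_order expr1n mul1r. Qed.

Lemma rt1 : rt 1 = -1.
Proof. rewrite /rt expr1 (_ : pi *+ 2 / 2 = pi); last by rewrite -[pi *+ 2]mulr_natr mulfK.
by rewrite /expi cospi sinpi; apply/eqP; rewrite eq_complex /= oppr0 !eqxx. Qed.

(* The bound follows from |1 - z^2| <= 2 |1 - z|, starting from the root -1. *)
Lemma rt_sep p j : ~~ (2 ^ p %| j)%N -> 4 / 2 ^+ p <= cmod (1 - rt p ^+ j).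
Proof.
elim: p j => [|p IH] j; first by rewrite expn0 dvd1n.
have [jo|je] := boolP (odd j); last first.
  have -> : j = (j./2 * 2)%N by rewrite muln2 even_halfK.
  rewrite expnSr dvdn_pmul2r// => /IH h.
  rewrite mulnC exprM rtS; apply: le_trans _ h; rewrite ler_wpM2l//.
  by rewrite lef_pV2 ?posrE ?exprn_gt0// exprS ler_peMl ?exprn_ge0// ler1n.
move=> _; case: p IH => [|p] IH.
  have E : (-1 : C) ^+ j = -1 by rewrite -signr_odd jo.
  by rewrite rt1 E opprK -[1 + 1](natrD _ 1 1) cmod_nat expr1; lra.
have h2 : 4 / 2 ^+ p.+1 <= cmod (1 - rt p.+1 ^+ j).
  by apply: IH; apply/negP => /(dvdn_trans (dvdn_exp2l 2 (ltn0Sn p))); rewrite dvdn2 jo.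
rewrite -rtS -exprM mulnC exprM in h2.
have : cmod (1 - (rt p.+2 ^+ j) ^+ 2) <= cmod (1 - rt p.+2 ^+ j) * 2.
  rewrite (_ : 1 - _ = (1 - rt p.+2 ^+ j) * (1 + rt p.+2 ^+ j)); last by ring.
  rewrite cmodM ler_wpM2l ?cmod_ge0//; apply: le_trans (cmodD _ _) _.
  by rewrite cmod1 cmod_rtX; lra.
move/(le_trans h2); rewrite -ler_pdivrMr//; apply: le_trans.
by rewrite [2 ^+ p.+2]exprSr invfM mulrA.
Qed.

Lemma rt_neq1 p : rt p.+1 != 1.
Proof.
rewrite eq_sym -subr_eq0 -cmod_gt0 -[rt _]expr1; apply: lt_le_trans (rt_sep _).
  by rewrite divr_gt0// exprn_gt0.
by rewrite gtnNdvd// -{1}(expn0 2) ltn_exp2l.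
Qed.

(** Neighbouring roots differ in angle by 2 pi / 2^p, below 8 / 2^p since pi < 4; the root just
    below the argument of z is taken. *)
Lemma rt_near p z : cmod z = 1 -> exists2 j, (j < 2 ^ p)%N & cmod (z - rt p ^+ j) <= 8 / 2 ^+ p.
Proof.
move=> /expi_surj [x _ ->].
set d : R := pi *+ 2 / 2 ^+ p.
have d0 : 0 < d by rewrite /d divr_gt0 ?exprn_gt0// mulrn_wgt0// pi_gt0.
have d8 : d <= 8 / 2 ^+ p.
  by rewrite /d ler_pM2r ?invr_gt0 ?exprn_gt0//; have := pi_lt4; lra.
set k := Num.floor (x / d).
have k1 : k%:~R * d <= x by rewrite -ler_pdivlMr// Num.Theory.floor_le_tmp.
have k2 : x < (k%:~R + 1) * d by rewrite -ltr_pdivrMr// -[1]/(1%:~R) -rmorphD /= floorD1_gt.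
have hx : cmod (expi x - expi (k%:~R * d)) <= 8 / 2 ^+ p.
  by apply: le_trans (expi_lip _ _) _; apply: le_trans _ d8; rewrite ger0_norm; lra.
suff [j hj] : exists j : nat, expi (k%:~R * d) = rt p ^+ j.
  exists (j %% 2 ^ p)%N; first by rewrite ltn_mod expn_gt0.
  by rewrite rt_mod -hj.
case: (k) => n; first by exists n; rewrite /rt -expiMn -/d -[d *+ n]mulr_natl.
(* The power -(n + 1) of [rt p] is rewritten with a natural exponent, which is possible since the
   power 2^p of [rt p] is 1. *)
exists (n.+1 * (2 ^ p).-1)%N.
have e1 : expi ((Negz n)%:~R * d) * rt p ^+ n.+1 = 1.
  by rewrite /rt -expiMn -expiD NegzE -/d mulrNz -[d *+ _]mulr_natl mulNr addNr expi0.
have e2 : rt p ^+ (n.+1 * (2 ^ p).-1) * rt p ^+ n.+1 = 1.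
  by rewrite -exprD -mulnSr prednK ?expn_gt0// mulnC exprM rt_order expr1n.
by apply: (mulIf _ (etrans e1 (esym e2))); rewrite -cmod_gt0 cmod_rtX.
Qed.

Lemma rt_cvg : (cmod (rt p - 1) @[p --> \oo]) --> (0 : R).
Proof.
apply: squeeze_cvgr (cvg_cst 0) (cvg_half_pow 8).
apply: nearW => p; rewrite cmod_ge0 -expi0; apply: le_trans (expi_lip _ _) _.
rewrite subr0 ger0_norm; last by rewrite divr_ge0 ?exprn_ge0// mulrn_wge0// pi_ge0.
by rewrite ler_pM2r ?invr_gt0 ?exprn_gt0//; have := pi_lt4; lra.
Qed.

Lemma sum_rtX p k : \sum_(j < 2 ^ p) (rt p ^+ k) ^+ j = if (2 ^ p %| k)%N then (2 ^+ p : C) else 0.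
Proof.
case: ifP => [/dvdnP [q ->]|/negbT /rt_sep h].
  under eq_bigr do rewrite mulnC exprM rt_order !expr1n.
  by rewrite sumr_const card_ord natrX.
have h1 : 1 - rt p ^+ k != 0.
  by rewrite -cmod_gt0; apply: lt_le_trans h; rewrite divr_gt0 ?exprn_gt0.
apply: (mulfI h1); rewrite mulr0 -[LHS]opprK -mulNr opprB -subrX1.
by rewrite -exprM mulnC exprM rt_order expr1n subrr oppr0.
Qed.

(** Discrete substitute for the circle average; being a finite sum of point values, it later
    supplies the functionals of the nuclear representation. *)
Definition mean (p : nat) (F : C -> C) : C := (2 ^- p : R)%:C * \sum_(j < 2 ^ p) F (rt p ^+ j).

Lemma cmod_half_pow p : cmod ((2 ^- p : R)%:C : C) = 2 ^- p.
Proof. by rewrite cmod_real ger0_norm// invr_ge0 exprn_ge0. Qed.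

Lemma cmod_mean p (F : C -> C) (M : R) : (forall z, cmod z = 1 -> cmod (F z) <= M) ->
  cmod (mean p F) <= M.
Proof.
move=> hF; rewrite /mean cmodM cmod_half_pow mulrC ler_pdivrMr ?exprn_gt0//.
apply: le_trans (cmod_sum _ _ _) _; apply: (@le_trans _ _ (\sum_(j < 2 ^ p) M)).
  by apply: ler_sum => j _; apply: hF; rewrite cmod_rtX.
by rewrite sumr_const card_ord -[M *+ _]mulr_natr natrX.
Qed.

Lemma eq_mean p (F G : C -> C) : (forall z, cmod z = 1 -> F z = G z) -> mean p F = mean p G.
Proof. by move=> h; congr (_ * _); apply: eq_bigr => j _; rewrite h// cmod_rtX. Qed.

Lemma meanB p (F G : C -> C) : mean p (fun z => F z - G z) = mean p F - mean p G.
Proof. by rewrite /mean sumrB mulrBr. Qed.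

Lemma meanMl p c (F : C -> C) : mean p (fun z => c * F z) = c * mean p F.
Proof. by rewrite /mean -mulr_sumr mulrCA. Qed.

Lemma mean_cst p c : mean p (fun=> c) = c.
Proof.
rewrite /mean sumr_const card_ord -[c *+ _]mulr_natr mulrCA [X in _ * X](_ : _ = 1) ?mulr1//.
rewrite -(rmorph_nat (real_complex R)) -rmorphM natrX mulVf ?rmorph1// expf_neq0.
Qed.

Lemma hasd_mean (T : Type) (io : T -> C) p (F : T -> C -> C) (d : C -> C) t :
  (forall z, cmod z = 1 -> hasd io (fun s => F s z) t (d z)) ->
  hasd io (fun s => mean p (F s)) t (mean p d).
Proof. by move=> h; apply: hasdMl; apply: hasd_sum => j _; apply: h; rewrite cmod_rtX. Qed.

(** A second-order Taylor bound, [P] playing the role of the derivative of [Q]. It involves only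
    values of the two functions, so it survives pointwise limits, as in [clim_derive]. *)
Definition quad_bound Q P (K r : R) := forall a b, cmod a <= r -> cmod b <= r ->
  cmod (Q b - Q a - P a * (b - a)) <= K * cmod (b - a) ^+ 2.

Lemma quad_boundP Q P h (K r : R) : (forall z, cmod z <= r -> isd Q z (P z)) ->
  (forall z, cmod z <= r -> isd P z (h z)) -> (forall z, cmod z <= r -> cmod (h z) <= K) ->
  quad_bound Q P K r.
Proof.
move=> hQ hP hK a b ha hb.
have K0 : 0 <= K by apply: le_trans (hK _ ha); exact: cmod_ge0.
have := @mean_value_path R (fun s => Q (a + s%:C * (b - a)) - P a * (s%:C * (b - a)))
  (fun t => P (a + t%:C * (b - a)) * (b - a) - P a * (1 * (b - a))) (K * cmod (b - a) ^+ 2).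
rewrite [1%:C * _]mul1r !mul0r addr0 subrKC mulr0 subr0 addrAC; apply.
  move=> t /andP[t0 t1]; apply: hasdB.
    by apply: hasd_comp (isrd_segment a b t); apply: hQ; exact: cmod_convex.
  apply: hasdMl; exact: hasd_eq (hasdMr (b - a) (hasd_io (fun x : R => x%:C : C) t)) (mul1r _).
move=> t /andP[t0 t1]; rewrite -mulrBl cmodM expr2 mulrA ler_wpM2r ?cmod_ge0//.
apply: le_trans (mean_value_disk hP hK ha (cmod_convex (ltW t0) (ltW t1) ha hb)) _.
rewrite ler_wpM2l// addrAC subrr add0r cmodM cmod_real ger0_norm; last exact: ltW.
by rewrite ler_piMl ?cmod_ge0// ltW.
Qed.

(* The increments of Q around the circle add up to 0. *)
Lemma mean_tangent Q P (K r s : R) c p : quad_bound Q P K r -> 0 < s ->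
  (forall z, cmod z = 1 -> cmod (c + s%:C * z) <= r) ->
  cmod (mean p.+1 (fun z => P (c + s%:C * z) * z)) <= K * s * cmod (rt p.+1 - 1).
Proof.
move=> hq s0 hr; set om := rt p.+1; set x := fun j => c + s%:C * om ^+ j.
have om0 : 0 < cmod (om - 1) by rewrite cmod_gt0 subr_eq0 rt_neq1.
set N := (2 ^ p.+1)%N.
have hx j : cmod (x j) <= r by apply: hr; rewrite cmod_rtX.
have dx j : x j.+1 - x j = s%:C * (om - 1) * om ^+ j by rewrite /x exprS; ring.
have E : \sum_(j < N) (Q (x j.+1) - Q (x j)) = 0.
  rewrite -(big_mkord xpredT (fun j => Q (x j.+1) - Q (x j))) telescope_sumr//.
  by rewrite /x /N rt_order expr0 subrr.
have h1 : cmod (\sum_(j < N) P (x j) * (x j.+1 - x j)) <= N%:R * (K * (s * cmod (om - 1)) ^+ 2).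
  rewrite (_ : \sum_(j < N) _ = - \sum_(j < N) (Q (x j.+1) - Q (x j) - P (x j) * (x j.+1 - x j))); last first.
    by rewrite sumrB E sub0r opprK.
  rewrite cmodN; apply: le_trans (cmod_sum _ _ _) _.
  rewrite -[X in X%:R]card_ord mulr_natl -sumr_const; apply: ler_sum => j _.
  apply: le_trans (hq _ _ (hx _) (hx _)) _.
  by rewrite dx !cmodM cmod_rtX mulr1 cmod_real ger0_norm// ltW.
have E2 : \sum_(j < N) P (x j) * (x j.+1 - x j) =
    s%:C * (om - 1) * \sum_(j < N) P (x j) * om ^+ j.
  by rewrite mulr_sumr; apply: eq_bigr => j _; rewrite dx; ring.
rewrite /mean cmodM cmod_half_pow mulrC ler_pdivrMr ?exprn_gt0//.
have cs : cmod (s%:C : C) = s by rewrite cmod_real ger0_norm// ltW.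
have s1 : 0 < s * cmod (om - 1) by rewrite mulr_gt0.
rewrite -(ler_pM2l s1); move: h1; rewrite E2 !cmodM cs => /le_trans; apply.
by rewrite /N natrX le_eqVlt; apply/orP; left; apply/eqP; ring.
Qed.

(** Each summand is the finite geometric sum of (u / z)^k, k < 2^p, over the common denominator 1 -
    u^(2^p); averaging over the roots kills every power except k = 0. *)
Lemma mean_inv p (u : C) : cmod u < 1 -> mean p (fun z => (1 - u / z)^-1) = (1 - u ^+ (2 ^ p))^-1.
Proof.
move=> u1; have ne1 (v : C) : cmod v < 1 -> 1 - v != 0.
  by move=> v1; rewrite subr_eq0; apply: contraTneq v1 => <-; rewrite cmod1 ltxx.
have hz (z : C) : cmod z = 1 -> cmod (u / z) < 1 by move=> z1; rewrite cmodf z1 divr1.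
set N := (2 ^ p)%N; have uN : cmod (u ^+ N) < 1.
  by rewrite cmodX exprn_ilt1 ?cmod_ge0// expn_eq0.
have E j : (1 - u / rt p ^+ j)^-1 = (1 - u ^+ N)^-1 * \sum_(k < N) (u / rt p ^+ j) ^+ k.
  have v1 := hz _ (cmod_rtX p j); set v := u / rt p ^+ j in v1 *.
  have -> : u ^+ N = v ^+ N.
    by rewrite /v exprMn exprVn -exprM mulnC exprM rt_order expr1n invr1 mulr1.
  have e : (1 - v) * \sum_(k < N) v ^+ k = 1 - v ^+ N.
    by rewrite -[LHS]opprK -mulNr opprB -subrX1 opprB.
  have vN : 1 - v ^+ N != 0 by apply: ne1; rewrite cmodX exprn_ilt1 ?cmod_ge0// expn_eq0.
  by apply: (mulfI (ne1 _ v1)); rewrite mulfV ?ne1// mulrCA e mulVf.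
rewrite /mean (eq_bigr _ (fun (j : 'I_N) _ => E j)) -mulr_sumr mulrCA -[RHS]mulr1; congr (_ * _).
rewrite exchange_big /=.
have N0 : (0 < N)%N by rewrite expn_gt0.
rewrite (bigD1 (Ordinal N0)) //= [X in _ + X]big1 => [|k kN]; last first.
  rewrite (eq_bigr (fun j : 'I_N => u ^+ k * (rt p ^+ (N - k)) ^+ j)); last first.
    move=> j _; rewrite exprMn exprVn; congr (_ * _).
    have h0 : rt p ^+ j ^+ k != 0 by rewrite -cmod_gt0 cmodX cmod_rtX expr1n.
    apply: (mulIf h0); rewrite mulVf// -!exprM [(j * k)%N]mulnC -exprD -mulnDl subnK ?(ltnW (ltn_ord k))//.
    by rewrite exprM rt_order expr1n.
  rewrite -mulr_sumr sum_rtX gtnNdvd ?mulr0// ?subn_gt0 ?ltn_ord// ltn_subrL N0 andbT.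
  by rewrite lt0n; apply: contraNneq kN => h; apply/eqP/val_inj.
rewrite addr0 (eq_bigr (fun=> 1)) => [|j _]; last by rewrite expr0.
by have := mean_cst p 1.
Qed.

Lemma climS u (l : C) : clim (fun n => u n.+1) l -> clim u l.
Proof. by rewrite /clim (cvg_shiftS (fun n => cmod (u n - l))). Qed.

(** The circle |z| = r is contracted linearly onto w. The derivative of the weighted mean along this
    homotopy is a mean of [P] in the tangential direction, hence small by [mean_tangent]; at the
    collapsed end only [Q w] times the mean of the kernel is left. Two derivatives of [Q] are
    assumed because regularity of holomorphic functions is to be deduced from this formula. *)
Lemma cauchy_formula_C2 Q P h (r : R) w : (forall z, disk z -> isd Q z (P z)) ->
  (forall z, disk z -> isd P z (h z)) -> holomorphic h -> r < 1 -> cmod w < r ->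
  clim (fun p => mean p (fun z => Q (r%:C * z) / (1 - w / (r%:C * z)))) (Q w).
Proof.
move=> hQ hP hh r1 wr.
have r0 : 0 < r by apply: le_lt_trans wr; exact: cmod_ge0.
have rC : r%:C != 0 :> C by rewrite -cmod_gt0 cmod_real normr_gt0 gt_eqF.
have cr : cmod (r%:C : C) = r by rewrite cmod_real ger0_norm// ltW.
have dk z : cmod z <= r -> disk z by move=> hz; exact: le_lt_trans hz r1.
have [K K0 hK] := holomorphic_bounded hh r1.
have hq := quad_boundP (fun z hz => hQ z (dk z hz)) (fun z hz => hP z (dk z hz)) hK.
have z0 z : cmod z = 1 -> z != 0 by move=> z1; rewrite -cmod_gt0 z1.
have rz z : cmod z = 1 -> cmod (r%:C * z) = r by move=> z1; rewrite cmodM z1 mulr1.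
have nz z : cmod z = 1 -> r%:C * z - w != 0.
  by move=> z1; rewrite subr_eq0; apply/eqP => E; move: wr; rewrite -E rz// ltxx.
pose B z : C := (1 - w / (r%:C * z))^-1.
have BE z : cmod z = 1 -> (r%:C * z - w) * B z = r%:C * z.
  by move=> z1; rewrite /B; field; rewrite rC z0// nz.
pose G p (s : R) := mean p (fun z => Q (w + s%:C * (r%:C * z - w)) * B z).
have hG p : cmod (G p.+1 1 - G p.+1 0) <= K * cmod (rt p.+1 - 1).
  apply: (@mean_value_path R (G p.+1) (fun t => mean p.+1 (fun z =>
     P (w + t%:C * (r%:C * z - w)) * (r%:C * z - w) * B z))).
    move=> t /andP[t0 t1]; apply: hasd_mean => z z1; apply: hasdMr.
    apply: hasd_comp (isrd_segment _ _ t); apply: hQ; apply: dk.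
    by apply: cmod_convex; rewrite ?rz// ltW.
  move=> t /andP[t0 t1].
  (* By [BE] the inner derivative r z - w cancels the denominator of the kernel, which leaves [P] on
     the circle of centre (1 - t) w and radius t r, multiplied by z. *)
  rewrite (@eq_mean _ _ (fun z => r%:C * (P ((1 - t)%:C * w + (t * r)%:C * z) * z))); last first.
    move=> z z1; rewrite -mulrA BE// rmorphB rmorph1 rmorphM.
    rewrite (_ : w + t%:C * (r%:C * z - w) = (1 - t%:C) * w + t%:C * r%:C * z); last by ring.
    by ring.
  rewrite meanMl cmodM cr.
  have tr0 : 0 < t * r by rewrite mulr_gt0.
  have := @mean_tangent Q P K r (t * r) ((1 - t)%:C * w) p hq tr0.
  have h1 z : cmod z = 1 -> cmod ((1 - t)%:C * w + (t * r)%:C * z) <= r.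
    move=> z1; rewrite (_ : _ + _ = w + t%:C * (r%:C * z - w)); last first.
      by rewrite rmorphB rmorph1 rmorphM; ring.
    by apply: cmod_convex; rewrite ?rz// ltW.
  move=> /(_ h1) h2; apply: le_trans (ler_wpM2l (ltW r0) h2) _.
  rewrite mulrA ler_wpM2r ?cmod_ge0// mulrCA ler_piMr//.
  by rewrite mulrCA -expr2 mulr_ile1 ?ltW ?exprn_gt0// expr2 mulr_ilte1// ltW.
apply: climS; apply: (@clim_le _ _ _ (fun p => K * cmod (rt p.+1 - 1) +
    cmod (Q w) * cmod ((1 - (w / r%:C) ^+ (2 ^ p.+1))^-1 - 1))).
  move=> p; have E1 : G p.+1 1 = mean p.+1 (fun z => Q (r%:C * z) / (1 - w / (r%:C * z))).
    by apply: eq_mean => z z1; rewrite mul1r subrKC.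
  have E0 : G p.+1 0 = Q w * (1 - (w / r%:C) ^+ (2 ^ p.+1))^-1.
    rewrite /G -mean_inv; last by rewrite cmodf cr ltr_pdivrMr// mul1r.
    rewrite -meanMl; apply: eq_mean => z z1; rewrite mul0r addr0 /B.
    by congr (_ * (1 - _)^-1); rewrite invfM mulrA.
  rewrite -E1 -(subrK (G p.+1 0) (G p.+1 1)) -addrA; apply: le_trans (cmodD _ _) _.
  apply: lerD; first exact: hG.
  by rewrite E0 -{2}[Q w]mulr1 -mulrBr cmodM.
rewrite -[0 in X in _ --> X](addr0 0); apply: cvgD.
  rewrite -(mulr0 K); apply: cvgMl_tmp.
  by rewrite (cvg_shiftS (fun p => cmod (rt p - 1))); exact: rt_cvg.
rewrite -(mulr0 (cmod (Q w))); apply: cvgMl_tmp.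
set u := w / r%:C; have u1 : cmod u < 1 by rewrite /u cmodf cr ltr_pdivrMr// mul1r.
have hN n : cmod (u ^+ (2 ^ n.+1)) <= cmod u ^+ n.
  rewrite cmodX ler_wiXn2l ?cmod_ge0 ?ltW//.
  exact: leq_trans (leqnSn _) (ltnW (ltn_expl _ _)).
have d0 : 0 < 1 - cmod u by rewrite subr_gt0.
apply: (@squeeze_cvgr _ _ _ _ (fun=> 0) (fun n => (1 - cmod u)^-1 * cmod u ^+ n)).
- apply: nearW => n; rewrite cmod_ge0 /=; set v := u ^+ _.
  have v1 : cmod v <= cmod u.
    by rewrite /v cmodX -[leRHS]expr1 ler_wiXn2l ?cmod_ge0 ?ltW// expn_gt0.
  have c1 : 1 - cmod u <= cmod (1 - v).
    by have := cmod_subl 1 v; rewrite cmod1; lra.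
  have v0 : 1 - v != 0 by rewrite -cmod_gt0; exact: lt_le_trans c1.
  rewrite (_ : _ - 1 = (1 - v)^-1 * v); last by field.
  rewrite cmodM cmodV ler_pM ?invr_ge0 ?cmod_ge0// ?hN//.
  by rewrite lef_pV2 ?posrE// (lt_le_trans d0).
- exact: cvg_cst.
- rewrite -(mulr0 (1 - cmod u)^-1); apply: cvgMl_tmp.
  by apply: cvg_expr; rewrite ger0_norm ?cmod_ge0.
Qed.

End CircleMeans.

(** * Taylor coefficients as limits of means, and differentiability of the derivative *)

Section CauchyFormula.
Context {R : realType}.
Local Notation C := (cplx R).
Implicit Types (f h P Q : C -> C) (a b c z w : C).

(** Difference quotients with a fixed step [eta] are within [K1 * eta] of the derivatives, uniformly
    in p, and they converge; so the derivatives form a Cauchy sequence. The quadratic bound then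
    passes to the limit and shows that their limit is the derivative of [B]. *)
Lemma clim_derive (A A' : nat -> C -> C) (B : C -> C) (K r : R) w :
  (forall p, quad_bound (A p) (A' p) K r) ->
  (forall z, cmod z <= r -> clim (A ^~ z) (B z)) -> cmod w < r ->
  exists2 d, clim (A' ^~ w) d & isd B w d.
Proof.
move=> hq hA wr; pose K1 := Num.max K 1.
have K0 : 0 < K1 by rewrite /K1 lt_max ltr01 orbT.
have {}hq p a b : cmod a <= r -> cmod b <= r ->
    cmod (A p b - A p a - A' p a * (b - a)) <= K1 * cmod (b - a) ^+ 2.
  by move=> ha hb; apply: le_trans (hq p a b ha hb) _; rewrite ler_wpM2r ?sqr_ge0// /K1 le_max lexx.
have [d hd] : exists d, clim (A' ^~ w) d.
  apply: clim_cauchy => e e0.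
  set eta := Num.min (r - cmod w) (e / (4 * K1)).
  have eta0 : 0 < eta by rewrite /eta lt_min subr_gt0 wr divr_gt0// mulr_gt0.
  have etae : 4 * K1 * eta <= e by rewrite mulrC -ler_pdivlMr ?mulr_gt0// /eta ge_min lexx orbT.
  set k : C := eta%:C; have ck : cmod k = eta by rewrite cmod_real ger0_norm ?ltW.
  have wk : cmod (w + k) <= r.
    apply: le_trans (cmodD _ _) _; rewrite ck -lerBrDl /eta ge_min lexx //.
  (* Two quadratic remainders, and four values each within [K1 * eta^2 / 2] of its limit, add up to
     [4 * K1 * eta^2 <= e * eta]. *)
  have b0 : 0 < K1 * eta ^+ 2 / 2 by rewrite divr_gt0// mulr_gt0// exprn_gt0.
  have [N1 h1] := (climP _ _).1 (hA _ (ltW wr)) _ b0.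
  have [N2 h2] := (climP _ _).1 (hA _ wk) _ b0.
  exists (maxn N1 N2) => n m; rewrite !geq_max => /andP[n1 n2] /andP[m1 m2].
  have := hq n w (w + k) (ltW wr) wk; have := hq m w (w + k) (ltW wr) wk.
  have -> : w + k - w = k by rewrite addrAC subrr add0r.
  rewrite ck => e1 e2.
  move: (h1 _ n1) (h1 _ m1) (h2 _ n2) (h2 _ m2) => a1 a2 a3 a4.
  rewrite -(ler_pM2r eta0); rewrite -{1}ck -cmodM.
  rewrite (_ : _ * k = (A m (w + k) - A m w - A' m w * k) - (A n (w + k) - A n w - A' n w * k)
     + (A n (w + k) - B (w + k)) - (A m (w + k) - B (w + k)) - (A n w - B w) + (A m w - B w)); last by ring.
  have t1 := cmodD ((A m (w + k) - A m w - A' m w * k) - (A n (w + k) - A n w - A' n w * k)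
     + (A n (w + k) - B (w + k)) - (A m (w + k) - B (w + k)) - (A n w - B w)) (A m w - B w).
  have t2 := cmodB ((A m (w + k) - A m w - A' m w * k) - (A n (w + k) - A n w - A' n w * k)
     + (A n (w + k) - B (w + k)) - (A m (w + k) - B (w + k))) (A n w - B w).
  have t3 := cmodB ((A m (w + k) - A m w - A' m w * k) - (A n (w + k) - A n w - A' n w * k)
     + (A n (w + k) - B (w + k))) (A m (w + k) - B (w + k)).
  have t4 := cmodD ((A m (w + k) - A m w - A' m w * k) - (A n (w + k) - A n w - A' n w * k))
     (A n (w + k) - B (w + k)).
  have t5 := cmodB (A m (w + k) - A m w - A' m w * k) (A n (w + k) - A n w - A' n w * k).
  have : 4 * K1 * eta * eta <= e * eta by rewrite ler_pM2r.
  rewrite expr2 in e1 e2 a1 a2 a3 a4.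
  lra.
exists d => // e e0.
exists (Num.min (r - cmod w) (e / K1)); first by rewrite lt_min subr_gt0 wr divr_gt0.
move=> z; rewrite lt_min => /andP[z1 z2].
have zr : cmod z <= r.
  rewrite -(subrK w z); apply: le_trans (cmodD _ _) _; rewrite -lerBrDr; exact: ltW.
have : clim (fun p => A p z - A p w - A' p w * (z - w)) (B z - B w - d * (z - w)).
  apply: climB; first by apply: climB; apply: hA => //; exact: ltW.
  by under eq_fun do rewrite mulrC; rewrite mulrC; exact: climMl.
move=> /clim_cmod_le /(_ (fun p => hq p w z (ltW wr) zr)) h; apply: le_trans h _.
rewrite expr2 mulrA ler_wpM2r ?cmod_ge0// mulrC -ler_pdivlMr//; exact: ltW.
Qed.

(** Cauchy's integral for the l-th Taylor coefficient at w over |x| = r: with x = r z, the form f(x)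
    (x - w)^-(l+1) dx / (2 pi i) is f(x) x^-l (1 - w/x)^-(l+1) times the normalised angle. *)
Definition cauchy_mean f (r : R) (l p : nat) w : C :=
  mean p (fun z => f (r%:C * z) * (r%:C * z)^-1 ^+ l * (1 - w / (r%:C * z))^-1 ^+ l.+1).

(** This is f^(l) / l!, with the factorial distributed over the recursion. *)
Fixpoint taylor f (l : nat) : C -> C :=
  if l is l'.+1 then fun z => l'.+1%:R^-1 * derive1 (taylor f l') z else f.

Section CauchyMean.
Variables (r : R) (w : C).
Hypotheses (wr : cmod w < r).

Let r0 : 0 < r. Proof. by apply: le_lt_trans wr; exact: cmod_ge0. Qed.

Lemma cmod_circle z : cmod z = 1 -> cmod (r%:C * z) = r.
Proof. by move=> z1; rewrite cmodM z1 mulr1 cmod_real ger0_norm// ltW. Qed.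

Lemma cmod_kernel z : cmod z = 1 -> 1 - cmod w / r <= cmod (1 - w / (r%:C * z)).
Proof.
by move=> z1; have := cmod_subl 1 (w / (r%:C * z)); rewrite cmod1 cmodf cmod_circle.
Qed.

Lemma ratio_lt1 : 0 < 1 - cmod w / r.
Proof. by rewrite subr_gt0 ltr_pdivrMr// mul1r. Qed.

Lemma kernel_neq0 z : cmod z = 1 -> 1 - w / (r%:C * z) != 0.
Proof. by move=> /cmod_kernel h; rewrite -cmod_gt0; apply: lt_le_trans h; exact: ratio_lt1. Qed.

Lemma isd_cauchy_mean f l p :
  isd (cauchy_mean f r l p) w (l.+1%:R * cauchy_mean f r l.+1 p w).
Proof.
have H z : cmod z = 1 -> isd (fun s => f (r%:C * z) * (r%:C * z)^-1 ^+ l *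
    (1 - s / (r%:C * z))^-1 ^+ l.+1) w (l.+1%:R * (f (r%:C * z) * (r%:C * z)^-1 ^+ l.+1 *
    (1 - w / (r%:C * z))^-1 ^+ l.+2)).
  move=> z1; set x := r%:C * z.
  have h1 : isd (fun s => 1 - s / x) w (0 - 1 * x^-1).
    exact: hasdB (hasd_cst (fun x : C => x) 1 w) (hasdMr x^-1 (hasd_io (fun x : C => x) w)).
  have h2 := hasdX l.+1 (hasdV (f := fun s : C => 1 - s / x) (kernel_neq0 z1) h1).
  apply: hasd_eq (hasdMl (f x * x^-1 ^+ l) h2) _.
  by rewrite /= sub0r mul1r -/x [x^-1 ^+ l.+1]exprS [(1 - w / x)^-1 ^+ l.+2]exprS
    [(1 - w / x)^-1 ^+ l.+1]exprS; ring.
exact: hasd_eq (hasd_mean p H) (meanMl _ _ _).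
Qed.

Lemma cmod_cauchy_mean f l p (M s : R) : 0 <= M -> cmod w <= s -> s < r ->
  (forall z, cmod z = r -> cmod (f z) <= M) ->
  cmod (cauchy_mean f r l p w) <= M * r^-1 ^+ l * (1 - s / r)^-1 ^+ l.+1.
Proof.
move=> M0 ws sr hM; apply: cmod_mean => z z1.
rewrite !cmodM !cmodX !cmodV cmod_circle//.
have k1 : (cmod (1 - w / (r%:C * z)))^-1 <= (1 - s / r)^-1.
  have s1 : 0 < 1 - s / r by rewrite subr_gt0 ltr_pdivrMr// mul1r.
  have : 1 - s / r <= cmod (1 - w / (r%:C * z)).
    by apply: le_trans (cmod_kernel z1); rewrite lerB// ler_pM2r ?invr_gt0.
  by move=> h; rewrite lef_pV2 ?posrE//; exact: lt_le_trans h.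
apply: ler_pM; rewrite ?mulr_ge0 ?exprn_ge0 ?invr_ge0 ?cmod_ge0 ?(ltW r0)//.
  by rewrite ler_wpM2r ?exprn_ge0 ?invr_ge0 ?(ltW r0)// hM// cmod_circle.
apply: lerXn2r => //; rewrite nnegrE ?invr_ge0 ?cmod_ge0//.
by rewrite -invr_ge0; apply: le_trans k1; rewrite invr_ge0 cmod_ge0.
Qed.

End CauchyMean.

(** A [cauchy_mean] of order l differentiates exactly to l + 1 times the one of order l + 1, and the
    order l + 2 is bounded uniformly in p on smaller disks; so [clim_derive] climbs from l to l +
    1. *)
Lemma taylor_limits f (r M : R) : 0 <= M -> (forall z, cmod z = r -> cmod (f z) <= M) ->
  (forall w, cmod w < r -> clim (fun p => cauchy_mean f r 0 p w) (f w)) ->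
  forall l w, cmod w < r -> clim (fun p => cauchy_mean f r l p w) (taylor f l w) /\
    isd (taylor f l) w (l.+1%:R * taylor f l.+1 w).
Proof.
move=> M0 hM hf.
have key l w : (forall z, cmod z < r -> clim (fun p => cauchy_mean f r l p z) (taylor f l z)) ->
    cmod w < r -> exists2 d, clim (fun p => l.+1%:R * cauchy_mean f r l.+1 p w) d & isd (taylor f l) w d.
  move=> hl wr; set s := (cmod w + r) / 2.
  have ws : cmod w < s by rewrite /s; lra.
  have sr : s < r by rewrite /s; lra.
  have ltr z : cmod z <= s -> cmod z < r by move=> h; exact: le_lt_trans sr.
  pose K := l.+1%:R * (l.+2%:R * (M * r^-1 ^+ l.+2 * (1 - s / r)^-1 ^+ l.+3)).
  apply: (@clim_derive (cauchy_mean f r l) (fun p z => l.+1%:R * cauchy_mean f r l.+1 p z) _ K s w) => //; last first.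
    by move=> z /ltr /hl.
  move=> p; apply: (@quad_boundP R _ _ (fun z => l.+1%:R * (l.+2%:R * cauchy_mean f r l.+2 p z))).
  - by move=> z /ltr hz; exact: (isd_cauchy_mean hz f l p).
  - by move=> z /ltr hz; apply: hasdMl; exact: (isd_cauchy_mean hz f l.+1 p).
  - move=> z hz; rewrite /K cmodM cmod_nat ler_wpM2l// cmodM cmod_nat ler_wpM2l//.
    by apply: cmod_cauchy_mean => //; exact: ltr.
have nz l : l.+1%:R != 0 :> C by rewrite pnatr_eq0.
have step l w : (forall z, cmod z < r -> clim (fun p => cauchy_mean f r l p z) (taylor f l z)) ->
    cmod w < r -> clim (fun p => cauchy_mean f r l.+1 p w) (taylor f l.+1 w) /\
      isd (taylor f l) w (l.+1%:R * taylor f l.+1 w).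
  move=> hl wr; have [d h1 h2] := key l w hl wr.
  have E : d = l.+1%:R * taylor f l.+1 w by rewrite /= (derive1_isd h2) mulVKf.
  split; last by rewrite -E.
  have := climMl l.+1%:R^-1 h1; rewrite E mulKf//.
  by under eq_fun do rewrite mulKf//.
have all l : forall z, cmod z < r -> clim (fun p => cauchy_mean f r l p z) (taylor f l z).
  by elim: l => [|l IH] z hz; [exact: hf|case: (step l z IH hz)].
by move=> l w wr; split; [exact: all|case: (step l w (all l) wr)].
Qed.

Lemma disk_near z : disk z -> exists2 r : R, 0 < r & forall w, cmod (w - z) < r -> disk w.
Proof.
move=> hz; exists (1 - cmod z); first by rewrite subr_gt0.
move=> w h; rewrite /disk /= -(subrK z w); apply: le_lt_trans (cmodD _ _) _.
by rewrite -ltrBrDr.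
Qed.

Lemma between_disk w : disk w -> exists2 r : R, cmod w < r & r < 1.
Proof.
rewrite /disk /= => h; have h1 : cmod w < 1 by [].
by exists ((cmod w + 1) / 2); lra.
Qed.

Lemma taylor_limits_C2 Q P h (r : R) l w : (forall z, disk z -> isd Q z (P z)) ->
  (forall z, disk z -> isd P z (h z)) -> holomorphic h -> r < 1 -> cmod w < r ->
  clim (fun p => cauchy_mean Q r l p w) (taylor Q l w) /\
  isd (taylor Q l) w (l.+1%:R * taylor Q l.+1 w).
Proof.
move=> hQ hP hh r1 wr.
have [M M0 hM] := @holomorphic_bounded R Q r (fun z hz => ex_intro _ _ (hQ z hz)) r1.
apply: (taylor_limits M0) => // [z zr|z zr]; first by apply: hM; rewrite zr.
have := cauchy_formula_C2 hQ hP hh r1 zr; congr (clim _ _).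
by apply/funext => p; apply: eq_mean => x x1; rewrite expr0 mulr1 expr1.
Qed.

(** The C^2 formula is applied to a second primitive [Q] of [h]: every [taylor Q l] is
    differentiable, and [h] and its derivative are constant multiples of those of order 2 and 3. *)
Lemma holomorphic_derive1 h : holomorphic h -> holomorphic (derive1 h).
Proof.
move=> hh; set P := primitive0 h.
have hP z : disk z -> isd P z (h z) by exact: isd_primitive0.
have hP' : holomorphic P by move=> z hz; exists (h z); exact: hP.
set Q := primitive0 P; have hQ z : disk z -> isd Q z (P z) by exact: isd_primitive0.
have hT l z : disk z -> isd (taylor Q l) z (l.+1%:R * taylor Q l.+1 z).
  by move=> /between_disk [r zr r1]; case: (taylor_limits_C2 l hQ hP hh r1 zr).
have E1 z : disk z -> taylor Q 1 z = P z.
  by move=> hz; rewrite /= (derive1_isd (hQ _ hz)) invr1 mul1r.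
have E2 z : disk z -> 2%:R * taylor Q 2 z = h z.
  move=> hz; have [r r0 hr] := disk_near hz.
  apply: isd_unique (hP z hz); apply: hasd_near r0 _ (hT 1%N z hz) => w /hr; exact: E1.
have E3 z : disk z -> isd h z (2%:R * (3%:R * taylor Q 3 z)).
  move=> hz; have [r r0 hr] := disk_near hz.
  apply: hasd_near r0 _ (hasdMl 2%:R (hT 2%N z hz)) => w /hr; exact: E2.
move=> z hz; have [r r0 hr] := disk_near hz.
exists (2%:R * (3%:R * (4%:R * taylor Q 4 z))).
apply: hasd_near r0 _ (hasdMl 2%:R (hasdMl 3%:R (hT 3%N z hz))) => w /hr /E3 hw.
by rewrite (derive1_isd hw).
Qed.

Lemma isd_derive1 f z : holomorphic f -> disk z -> isd f z (derive1 f z).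
Proof. by move=> hf /hf [d hd]; rewrite (derive1_isd hd). Qed.

Lemma cauchy_taylor f (r : R) l w : holomorphic f -> r < 1 -> cmod w < r ->
  clim (fun p => cauchy_mean f r l p w) (taylor f l w).
Proof.
move=> hf r1 wr; have hf' := holomorphic_derive1 hf; have hf'' := holomorphic_derive1 hf'.
by case: (taylor_limits_C2 l (fun z => isd_derive1 hf) (fun z => isd_derive1 hf') hf'' r1 wr).
Qed.

Lemma isd_taylor f l z : holomorphic f -> disk z ->
  isd (taylor f l) z (l.+1%:R * taylor f l.+1 z).
Proof.
move=> hf /between_disk [r zr r1].
have hf' := holomorphic_derive1 hf; have hf'' := holomorphic_derive1 hf'.
by case: (taylor_limits_C2 l (fun z => isd_derive1 hf) (fun z => isd_derive1 hf') hf'' r1 zr).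
Qed.

Lemma cauchy_estimate f w (dl M : R) : holomorphic f -> 0 < dl -> cmod w + dl <= 1 ->
  (forall z, cmod (z - w) < dl -> cmod (f z) <= M) -> cmod (derive1 f w) <= 2 * M / dl.
Proof.
move=> hf dl0 wd hM.
have dC : cmod (dl%:C : C) = dl by rewrite cmod_real ger0_norm// ltW.
pose F z := f (w + dl%:C * z).
have dsk z : disk z -> disk (w + dl%:C * z).
  move=> hz; apply: lt_le_trans wd; apply: le_lt_trans (cmodD _ _) _.
  by rewrite cmodM dC ltrD2l gtr_pMr.
have hF z : disk z -> isd F z (derive1 f (w + dl%:C * z) * dl%:C).
  move=> hz; apply: (hasd_comp (f := fun z => w + dl%:C * z) (isd_derive1 hf (dsk z hz))).
  by apply: hasd_eq (hasdD (hasd_cst _ w z) (hasdMl dl%:C (hasd_io _ z))) _; rewrite add0r mulr1.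
have hF' : holomorphic F by move=> z hz; eexists; exact: hF.
have M0 : 0 <= M by apply: le_trans (hM w _); rewrite ?cmod_ge0// subrr cmod0.
(* Radius 1/2 in the rescaled variable keeps the circle inside the open disk; this is the origin of
   the factor 2. *)
have h12 : (2^-1 : R) < 1 by rewrite invf_lt1// ltr1n.
have c0 : cmod (0 : C) < 2^-1 by rewrite cmod0 invr_gt0.
have /clim_cmod_le := cauchy_taylor 1 hF' h12 c0.
rewrite /= invr1 mul1r (derive1_isd (hF 0 disk0)) mulr0 addr0 cmodM dC.
rewrite ler_pdivlMr//; apply => p.
have c0' : cmod (0 : C) <= 0 by rewrite cmod0.
have := @cmod_cauchy_mean _ _ c0 F 1 p M 0 M0 c0' _.
rewrite invr_gt0 mul0r subr0 invr1 expr1n mulr1 expr1 invrK mulrC; apply=> // z z1.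
by apply: hM; rewrite addrAC subrr add0r cmodM dC z1 ltr_pdivrMr// ltr_pMr// ltr1n.
Qed.

End CauchyFormula.

(** * Reproducing kernels *)

Section Kernels.
Context {R : realType}.
Local Notation C := (cplx R).
Implicit Types (f F : C -> C) (a b u w z : C).

Definition rn (n : nat) : R := 1 - 2 ^- n.

Lemma half_pow_gt0 n : 0 < 2 ^- n :> R.
Proof. by rewrite invr_gt0 exprn_gt0. Qed.

Lemma half_pow_ge0 n : 0 <= 2 ^- n :> R.
Proof. exact/ltW/half_pow_gt0. Qed.

Lemma half_pow_le1 n : 2 ^- n <= 1 :> R.
Proof. by rewrite invf_le1 ?exprn_gt0// exprn_ege1// ler1n. Qed.

Lemma half_powS n : 2 ^- n.+1 = 2 ^- n / 2 :> R.
Proof. by rewrite exprS invfM mulrC. Qed.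

Lemma half_pow_homo m n : (m <= n)%N -> 2 ^- n <= 2 ^- m :> R.
Proof. by move=> h; rewrite lef_pV2 ?posrE ?exprn_gt0// ler_eXn2l// ltr1n. Qed.

Lemma rn0 : rn 0 = 0.
Proof. by rewrite /rn expr0 invr1 subrr. Qed.

Lemma rn_ge0 n : 0 <= rn n.
Proof. by rewrite subr_ge0 half_pow_le1. Qed.

Lemma rn_lt1 n : rn n < 1.
Proof. by rewrite gtrBl half_pow_gt0. Qed.

Lemma rn_homo m n : (m <= n)%N -> rn m <= rn n.
Proof. by move=> /half_pow_homo h; rewrite lerB. Qed.

Lemma rn_step n : rn n.+1 - rn n = 2 ^- n.+1.
Proof. by rewrite /rn half_powS; field; rewrite expf_neq0. Qed.

Lemma rn_geV2 n : 2^-1 <= rn n.+1.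
Proof. by have := half_pow_homo (ltn0Sn n); rewrite expr1 /rn; lra. Qed.

Lemma cmod_rn n : cmod ((rn n)%:C : C) = rn n.
Proof. by rewrite cmod_real ger0_norm// rn_ge0. Qed.

Lemma conjcM z w : conjc (z * w) = conjc z * conjc w :> C.
Proof. exact: (rmorphM (@conjc R)). Qed.

Lemma conjcB z w : conjc (z - w) = conjc z - conjc w :> C.
Proof. exact: (rmorphB (@conjc R)). Qed.

Lemma conjc_realC (t : R) : conjc (t%:C : C) = t%:C :> C.
Proof. by rewrite /= oppr0. Qed.

(** Moving a to b changes the denominator by at most |a - b|, hence by at most c (1 - |a|), and 1 -
    |a| is a lower bound of |1 - conj(a) w|. *)
Lemma comparable_denominators a b w (c : R) : 0 <= c -> cmod (a - b) <= c * (1 - cmod a) ->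
  cmod w <= 1 -> cmod (1 - conjc b * w) <= (1 + c) * cmod (1 - conjc a * w).
Proof.
move=> c0 hab w1.
have h1 : 1 - cmod a <= cmod (1 - conjc a * w).
  have := cmod_subl 1 (conjc a * w); rewrite cmod1 cmodM cmodJ.
  have : cmod a * cmod w <= cmod a by rewrite ler_piMr ?cmod_ge0.
  lra.
rewrite (_ : 1 - conjc b * w = (1 - conjc a * w) + conjc (a - b) * w); last first.
  by rewrite conjcB; ring.
apply: le_trans (cmodD _ _) _; rewrite mulrDl mul1r lerD2l cmodM cmodJ.
apply: le_trans (ler_wpM2l (cmod_ge0 _) w1) _; rewrite mulr1; apply: le_trans hab _.
by rewrite ler_wpM2l.
Qed.

(** A Lipschitz bound relative to the size bound [a]. In this form products multiply the sizes and
    add the relative increments, so the factors of a kernel can be treated one at a time. *)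
Definition rel_lip (X X' : C) (a lam : R) : Prop :=
  [/\ cmod X <= a, cmod X' <= a & cmod (X' - X) <= a * lam].

Lemma rel_lipM X X' Y Y' (a b lam kap : R) : rel_lip X X' a lam -> rel_lip Y Y' b kap ->
  rel_lip (X * Y) (X' * Y') (a * b) (lam + kap).
Proof.
move=> [x1 x2 x3] [y1 y2 y3]; rewrite /rel_lip !cmodM.
split; try by apply: ler_pM => //; exact: cmod_ge0.
rewrite (_ : X' * Y' - X * Y = (X' - X) * Y' + X * (Y' - Y)); last by ring.
apply: le_trans (cmodD _ _) _; rewrite !cmodM mulrDr.
apply: lerD; first by rewrite mulrAC; apply: ler_pM => //; exact: cmod_ge0.
by rewrite -mulrA; apply: ler_pM => //; exact: cmod_ge0.
Qed.

Lemma rel_lip_cst X (a : R) : cmod X <= a -> rel_lip X X a 0.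
Proof. by move=> h; split=> //; rewrite subrr cmod0 mulr0. Qed.

Lemma rel_lipX X X' (a lam : R) k : rel_lip X X' a lam -> rel_lip (X ^+ k) (X' ^+ k) (a ^+ k) (k%:R * lam).
Proof.
move=> h; elim: k => [|k IH].
  by rewrite mul0r; apply: rel_lip_cst; rewrite cmod1.
by rewrite !exprS -[k.+1%:R]nat1r mulrDl mul1r; exact: rel_lipM.
Qed.

Lemma rel_lip_le X X' (a a' lam lam' : R) : a <= a' -> lam <= lam' -> 0 <= lam -> 
  rel_lip X X' a lam -> rel_lip X X' a' lam'.
Proof.
move=> ha hl l0 [h1 h2 h3]; split; [exact: le_trans ha|exact: le_trans ha|].
have a0 : 0 <= a by apply: le_trans h1; exact: cmod_ge0.
by apply: le_trans h3 _; exact: ler_pM.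
Qed.

Lemma rel_lip_sum n (X X' : 'I_n -> C) (a lam : R) : (forall i, rel_lip (X i) (X' i) a lam) ->
  rel_lip (\sum_i X i) (\sum_i X' i) (n%:R * a) lam.
Proof.
move=> h; split.
- apply: le_trans (cmod_sum _ _ _) _; rewrite -[X in X%:R]card_ord mulr_natl -sumr_const.
  by apply: ler_sum => i _; case: (h i).
- apply: le_trans (cmod_sum _ _ _) _; rewrite -[X in X%:R]card_ord mulr_natl -sumr_const.
  by apply: ler_sum => i _; case: (h i).
rewrite -sumrB; apply: le_trans (cmod_sum _ _ _) _.
rewrite -mulrA -[X in X%:R]card_ord mulr_natl -sumr_const.
by apply: ler_sum => i _; case: (h i).
Qed.

Section Fixed.
Variable N : nat.

(* Equals (1 - (u (1 - r) / (1 - r u))^N) / (1 - u), without the pole at u = 1. *)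
Definition Phi (r : R) u : C := \sum_(l < N) (u * (1 - r)%:C) ^+ l * (1 - r%:C * u)^-1 ^+ l.+1.

Definition kern (n : nat) u : C := if n is n'.+1 then Phi (rn n) u - Phi (rn n') u else Phi (rn 0) u.

(** With q(t) = u (1 - t) / (1 - t u) one has (1 - u) Phi(t) = 1 - q(t)^N. Factoring q(s)^N - q(r)^N
    releases s - r, cancels 1 - u, and leaves N small factors in all, s - r included; this is the
    source of the decay of order N. *)
Lemma Phi_sub (r s : R) u : 1 - r%:C * u != 0 -> 1 - s%:C * u != 0 -> r < 1 -> s < 1 ->
  Phi s u - Phi r u = (s - r)%:C * \sum_(l < N) u ^+ N * (1 - r)%:C ^+ l * (1 - s)%:C ^+ (N.-1 - l) *
    ((1 - r%:C * u)^-1 ^+ l.+1 * (1 - s%:C * u)^-1 ^+ (N - l)).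
Proof.
move=> hr hs r1 s1.
pose X (t : R) : C := (1 - t%:C * u)^-1; pose q (t : R) := u * (1 - t)%:C * X t.
have PE (t : R) : Phi t u = X t * \sum_(l < N) q t ^+ l.
  by rewrite /Phi mulr_sumr; apply: eq_bigr => l _; rewrite /q -/(X t) exprS !exprMn; ring.
have main : Phi s u - Phi r u = (s - r)%:C * (u * X r * X s * \sum_(l < N) q s ^+ (N.-1 - l) * q r ^+ l).
  (* At u = 1 multiplying by 1 - u loses everything; there every q(t) is 1 and the identity is
     checked directly. *)
  have [u1|u1] := eqVneq u 1.
    have q1 (t : R) : t < 1 -> q t = 1.
      move=> t1; rewrite /q /X u1 mul1r mulr1 rmorphB rmorph1 mulfV//.
      by rewrite subr_eq0 eq_sym -subr_eq0 -(rmorph1 (real_complex R)) -rmorphB -cmod_gt0 cmod_real normr_gt0 subr_eq0 lt_eqF.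
    rewrite !PE !q1//; under eq_bigr do rewrite expr1n.
    under [in RHS]eq_bigr do rewrite !expr1n mulr1.
    rewrite rmorphB /X; move: hr hs; rewrite u1 !mulr1 mul1r => hr hs.
    by field; rewrite hr hs.
  have u1' : 1 - u != 0 by rewrite subr_eq0 eq_sym.
  have qE (t : R) : 1 - t%:C * u != 0 -> (1 - u) * X t = 1 - q t.
    by move=> ht; rewrite /q /X rmorphB rmorph1; field.
  have geo (t : R) : 1 - t%:C * u != 0 -> (1 - u) * Phi t u = 1 - q t ^+ N.
    by move=> ht; rewrite PE mulrA qE// -[LHS]opprK -mulNr opprB -subrX1 opprB.
  apply: (mulfI u1'); rewrite mulrBr !geo//.
  rewrite (_ : 1 - q s ^+ N - (1 - q r ^+ N) = - (q s ^+ N - q r ^+ N)); last by ring.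
  rewrite subrXX -mulNr opprB mulrCA !mulrA; congr (_ * _).
  by rewrite /q /X !rmorphB rmorph1; field; rewrite hr hs.
rewrite main; congr (_ * _); rewrite mulr_sumr; apply: eq_bigr => l _.
have lN := ltn_ord l; rewrite /q -/(X r) -/(X s) !exprMn.
have -> : (N - l = (N.-1 - l).+1)%N by lia.
have -> : u ^+ N = u * u ^+ (N.-1 - l) * u ^+ l by rewrite -exprS -exprD; congr (_ ^+ _); lia.
by rewrite !exprS; ring.
Qed.

(** Each term of [Phi] is the kernel of a [cauchy_mean] at the point r w, so the limit is a Taylor
    polynomial of F at r w with increment w (1 - r). The inequality [r * cmod w < s] places r w
    inside the circle of nodes. *)
Lemma mean_Phi F (r s : R) w : holomorphic F -> 0 <= r -> r * cmod w < s -> s < 1 ->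
  clim (fun p => mean p (fun z => F (s%:C * z) * Phi r (w / (s%:C * z))))
    (\sum_(l < N) (w * (1 - r)%:C) ^+ l * taylor F l (r%:C * w)).
Proof.
move=> hF r0 hs s1.
have hrw : cmod (r%:C * w) < s by rewrite cmodM cmod_real ger0_norm.
have := @clim_sum R _ (index_enum 'I_N) xpredT
  (fun l p => (w * (1 - r)%:C) ^+ l * cauchy_mean F s l p (r%:C * w)) _
  (fun l _ => climMl ((w * (1 - r)%:C) ^+ l) (cauchy_taylor l hF s1 hrw)).
congr (clim _ _); apply/funext => p.
rewrite /cauchy_mean; under eq_bigr do rewrite -meanMl.
rewrite /mean -mulr_sumr exchange_big /=; congr (_ * _); apply: eq_bigr => j _.
rewrite /Phi mulr_sumr; apply: eq_bigr => l _.
set x := s%:C * _; rewrite (_ : r%:C * (w / x) = r%:C * w / x); last by rewrite mulrA.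
by rewrite !exprMn; ring.
Qed.

Definition partial_rep F (w : C) (n : nat) : C :=
  \sum_(l < N) (w * (1 - rn n)%:C) ^+ l * taylor F l ((rn n)%:C * w).

Definition level_rep F (w : C) (n : nat) : C :=
  if n is n'.+1 then partial_rep F w n - partial_rep F w n' else partial_rep F w 0.

Lemma sum_level_rep F w n : \sum_(m < n.+1) level_rep F w m = partial_rep F w n.
Proof.
elim: n => [|n IH]; first by rewrite big_ord1.
by rewrite big_ord_recr /= IH subrKC.
Qed.

(** The Taylor centres of levels n - 1 and n both lie inside the circle of radius [rn n.+1], so one
    set of nodes serves both polynomials of the difference. *)
Lemma level_rep_lim F w n : holomorphic F -> disk w ->
  clim (fun p => mean p (fun z => F ((rn n.+1)%:C * z) * kern n (w / ((rn n.+1)%:C * z))))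
    (level_rep F w n).
Proof.
move=> hF hw.
have hs m : (m <= n)%N -> rn m * cmod w < rn n.+1.
  move=> mn; apply: (@le_lt_trans _ _ (rn m)).
    by rewrite ler_piMr ?rn_ge0//; exact: ltW.
  by apply: le_lt_trans (rn_homo mn) _; rewrite -subr_gt0 rn_step half_pow_gt0.
case: n hs => [|n] hs.
  exact: mean_Phi (rn_ge0 _) (hs 0%N _) (rn_lt1 _).
have h1 := mean_Phi hF (rn_ge0 _) (hs n.+1 (leqnn _)) (rn_lt1 n.+2).
have h2 := mean_Phi hF (rn_ge0 _) (hs n (leqnSn _)) (rn_lt1 n.+2).
have := climB h1 h2; congr (clim _ _); apply/funext => p; rewrite -meanB.
by apply: eq_mean => z _; rewrite -mulrBr.
Qed.

Hypothesis N0 : (0 < N)%N.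

Lemma partial_rep_lim F w : holomorphic F -> disk w -> clim (partial_rep F w) (F w).
Proof.
move=> hF hw; rewrite /partial_rep.
(* [F w] is written as a sum supported on l = 0 so that the limit is taken term by term; for l > 0
   the factor (1 - rn n)^l tends to 0. *)
rewrite [F w](_ : _ = \sum_(l < N) if l == 0%N :> nat then F w else 0); last first.
  by rewrite (bigD1 (Ordinal N0)) //= big1 ?addr0// => i /negbTE; rewrite -val_eqE /= => ->.
apply: clim_sum => l _; have rE n : (1 - rn n)%:C = (2 ^- n)%:C :> C by rewrite /rn subKr.
have dw n : cmod ((rn n)%:C * w) <= cmod w.
  by rewrite cmodM cmod_rn ler_piMl ?cmod_ge0// ltW// rn_lt1.
case: eqP => [->|/eqP l0].
  have [d hd] := hF _ hw; apply/climP => e e0.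
  have e2 : 0 < e / 2 by rewrite divr_gt0.
  have [dl dl0 h1] := hasd_cont hd e2.
  have /cvgrPdist_lt /(_ _ dl0) [M _ hM] := @cvg_half_pow R 1.
  exists M => n /hM; rewrite /= sub0r normrN mul1r ger0_norm ?ltW ?half_pow_gt0// => hn.
  rewrite expr0 mul1r; apply: le_lt_trans (h1 _ _) _; last by rewrite ltr_pdivrMr// ltr_pMr// ltr1n.
  apply: le_lt_trans hn; rewrite -{2}[w]mul1r -mulrBl cmodM.
  rewrite (_ : (rn n)%:C - 1 = - (2 ^- n)%:C) ?cmodN ?cmod_half_pow; last first.
    by rewrite /rn rmorphB rmorph1 addrAC subrr add0r.
  by rewrite ler_piMr ?ltW ?half_pow_gt0.
have hT : holomorphic (taylor F l) by move=> z hz; eexists; exact: isd_taylor.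
have [M M0 hM] := holomorphic_bounded hT hw.
apply: (@clim_le _ _ _ (fun n => M / 2 ^+ n)); last exact: cvg_half_pow.
move=> n; rewrite subr0 cmodM cmodX cmodM rE cmod_half_pow mulrC.
apply: ler_pM; rewrite ?cmod_ge0 ?exprn_ge0 ?mulr_ge0 ?cmod_ge0 ?half_pow_ge0//.
  exact: hM.
have h0 : cmod w * 2 ^- n <= 2 ^- n by rewrite ler_piMl ?half_pow_ge0//; exact: ltW.
have h00 : 0 <= cmod w * 2 ^- n by rewrite mulr_ge0 ?cmod_ge0 ?half_pow_ge0.
rewrite -lt0n in l0; rewrite -(prednK l0) exprS.
apply: le_trans (ler_wpM2l h00 (_ : _ <= 1)) _; last by rewrite mulr1.
by rewrite exprn_ile1// (le_trans h0)// half_pow_le1.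
Qed.

End Fixed.

Definition lat (n j : nat) : C := (rn n)%:C * rt n ^+ j.

Lemma cmod_lat n j : cmod (lat n j) = rn n.
Proof. by rewrite cmodM cmod_rn cmod_rtX mulr1. Qed.

Section KernelBound.
Variables (n j : nat) (c0 : R) (w : C).
Hypotheses (c00 : 0 <= c0) (hw : disk w).

Let D := cmod (1 - conjc (lat n j) * w).

Lemma unit_inv z : cmod z = 1 -> z^-1 = conjc z.
Proof.
move=> z1; have z0 : z != 0 by rewrite -cmod_gt0 z1.
by apply: (mulfI z0); rewrite mulfV// mulcJ z1 expr1n.
Qed.

Lemma lat_den_gt0 : 0 < D.
Proof.
apply: (@lt_le_trans _ _ (1 - rn n)); first by rewrite subr_gt0 rn_lt1.
have := cmod_subl 1 (conjc (lat n j) * w); rewrite cmod1 cmodM cmodJ cmod_lat => h.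
apply: le_trans h; rewrite lerB// ler_piMr ?rn_ge0// ltW//.
Qed.

(** With rho = [rn n.+1], the quantity r w / (rho z) equals conj(a) w for the point a = (r / rho) z
    of the disk. This a lies within 2 (1 + c0) (1 - |a|) of the lattice point, so
    [comparable_denominators] applies with constant 1 + 2 (1 + c0). *)
Lemma kernel_factor (r : R) z : r <= rn n -> rn n - 2 ^- n <= r -> 0 <= r -> cmod z = 1 ->
  cmod (z - rt n ^+ j) <= c0 * 2 ^- n ->
  let X := (1 - r%:C * (w / ((rn n.+1)%:C * z)))^-1 in
  [/\ 1 - r%:C * (w / ((rn n.+1)%:C * z)) != 0, cmod X <= (3 + 2 * c0) / D & cmod X <= 2 ^+ n.+1].
Proof.
move=> r1 r2 r0 z1 hz /=; set rho := rn n.+1.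
have rho0 : 0 < rho by apply: lt_le_trans (rn_geV2 n); rewrite invr_gt0.
have rho1 : rho < 1 := rn_lt1 _.
have rhoC : rho%:C != 0 :> C by rewrite -cmod_gt0 cmod_real normr_gt0 gt_eqF.
have z0 : z != 0 by rewrite -cmod_gt0 z1.
set a : C := (r / rho)%:C * z.
have ca : cmod a = r / rho by rewrite cmodM z1 mulr1 cmod_real ger0_norm// divr_ge0// ltW.
have rle : r / rho <= 1 - 2 ^- n.+1.
  rewrite ler_pdivrMr//; have := rn_step n; rewrite -/rho.
  have := half_pow_gt0 n.+1; move: (2 ^- n.+1) => t; nra.
have rge : r <= r / rho by rewrite ler_pdivlMr// ler_piMr// ltW.
have E : r%:C * (w / (rho%:C * z)) = conjc a * w.
  by rewrite /a conjcM conjc_realC -(unit_inv z1) rmorphM fmorphV; field; rewrite rhoC z0.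
have hab : cmod (a - lat n j) <= (2 * (1 + c0)) * (1 - cmod a).
  rewrite ca; apply: (@le_trans _ _ ((1 + c0) * 2 ^- n)); last first.
    rewrite (_ : (1 + c0) / 2 ^+ n = 2 * (1 + c0) * 2 ^- n.+1); last by rewrite half_powS; field; rewrite expf_neq0.
    by rewrite ler_wpM2l ?mulr_ge0 ?addr_ge0//; move: rle; lra.
  rewrite /a /lat (_ : _ - _ = (r / rho - rn n)%:C * z + (rn n)%:C * (z - rt n ^+ j)); last first.
    by rewrite (rmorphB (real_complex R) (r / rho) (rn n)) mulrBl mulrBr addrA subrK.
  apply: le_trans (cmodD _ _) _; rewrite !cmodM z1 mulr1 cmod_rn cmod_real [leRHS]mulrDl mul1r.
  apply: lerD; last first.
    by apply: le_trans hz; rewrite ler_piMl ?cmod_ge0// ltW// rn_lt1.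
  have := half_powS n; have := half_pow_gt0 n; rewrite ler_norml; move: rle rge r1 r2; rewrite /rn.
  move: (2 ^- n) (2 ^- n.+1) (r / rho) => t s x; lra.
have h1 := @comparable_denominators a (lat n j) w _ _ hab (ltW hw).
have {}h1 : D <= (3 + 2 * c0) * cmod (1 - conjc a * w).
  rewrite (_ : 3 + 2 * c0 = 1 + 2 * (1 + c0)); last by ring.
  by apply: h1; rewrite mulr_ge0// addr_ge0.
have D0 := lat_den_gt0.
have k0 : 0 < 3 + 2 * c0 by rewrite ltr_pwDl// mulr_ge0.
have x0 : 0 < cmod (1 - conjc a * w).
  by move: (lt_le_trans D0 h1); rewrite pmulr_rgt0.
have x1 : 2 ^- n.+1 <= cmod (1 - conjc a * w).
  have := cmod_subl 1 (conjc a * w); rewrite cmod1 cmodM cmodJ ca.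
  have : r / rho * cmod w <= r / rho by rewrite ler_piMr ?divr_ge0 ?(ltW rho0)// ltW.
  move: rle; lra.
rewrite E cmodV; split; first by rewrite -cmod_gt0.
  by rewrite -(ler_pM2r x0) mulVf ?gt_eqF// mulrAC ler_pdivlMr// mul1r.
by rewrite -[leRHS]invrK lef_pV2 ?posrE ?half_pow_gt0.
Qed.

Variable N : nat.
Hypothesis N0 : (0 < N)%N.
Variables z z' : C.
Hypotheses (z1 : cmod z = 1) (z1' : cmod z' = 1).
Hypotheses (hz : cmod (z - rt n ^+ j) <= c0 * 2 ^- n) (hz' : cmod (z' - rt n ^+ j) <= c0 * 2 ^- n).

Let lam := 2 ^+ n.+2 * cmod (z' - z).
Let X (r : R) (x : C) : C := (1 - r%:C * (w / ((rn n.+1)%:C * x)))^-1.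

Lemma rel_lip_point : rel_lip (w / ((rn n.+1)%:C * z)) (w / ((rn n.+1)%:C * z')) 2 lam.
Proof.
have rho2 := rn_geV2 n; set rho := rn n.+1 in rho2 *.
have rho0 : 0 < rho by apply: lt_le_trans rho2; rewrite invr_gt0.
have rhoC : rho%:C != 0 :> C by rewrite -cmod_gt0 cmod_real normr_gt0 gt_eqF.
have b x : cmod x = 1 -> cmod (w / (rho%:C * x)) <= 2.
  move=> x1; rewrite cmodf cmodM x1 mulr1 cmod_real ger0_norm ?(ltW rho0)//.
  by rewrite ler_pdivrMr//; have := hw; rewrite /disk /=; lra.
split; [exact: b|exact: b|].
have z0 : z != 0 by rewrite -cmod_gt0 z1.
have z0' : z' != 0 by rewrite -cmod_gt0 z1'.
rewrite (_ : _ - _ = (w / (rho%:C * z)) * ((z - z') / z')); last by field; rewrite rhoC z0 z0'.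
rewrite cmodM cmodf z1' divr1 cmodC.
apply: ler_pM; rewrite ?cmod_ge0// ?b// /lam ler_peMl ?cmod_ge0//.
by rewrite exprn_ege1// ler1n.
Qed.

(** The difference of the two values is X(z) X(z') r (u' - u): one X provides the size, the other is
    at most 2^(n+1), and |u' - u| <= 2 |z' - z|; the product of the last two bounds is [lam]. *)
Lemma rel_lip_factor (r : R) : r <= rn n -> rn n - 2 ^- n <= r -> 0 <= r ->
  rel_lip (X r z) (X r z') ((3 + 2 * c0) / D) lam.
Proof.
move=> r1 r2 r0; have [n1 a1 b1] := kernel_factor r1 r2 r0 z1 hz.
have [n2 a2 b2] := kernel_factor r1 r2 r0 z1' hz'.
split=> //; have z0 : z != 0 by rewrite -cmod_gt0 z1.
have z0' : z' != 0 by rewrite -cmod_gt0 z1'.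
have rho2 := rn_geV2 n; have rho0 : 0 < rn n.+1 by apply: lt_le_trans rho2; rewrite invr_gt0.
have rhoC : (rn n.+1)%:C != 0 :> C by rewrite -cmod_gt0 cmod_real normr_gt0 gt_eqF.
have [u1 u2 _] := rel_lip_point.
rewrite (_ : X r z' - X r z = X r z * (X r z' * (r%:C * ((w / ((rn n.+1)%:C * z)) * ((z - z') / z'))))); last first.
  rewrite /X; set u := w / (_ * z) in n1 *; set u' := w / (_ * z') in n2 *.
  have -> : u * ((z - z') / z') = u' - u by rewrite /u /u'; field; rewrite rhoC z0 z0'.
  by field; rewrite n1 n2.
rewrite cmodM; apply: ler_pM; rewrite ?cmod_ge0//.
rewrite (cmodM (X r z')) (cmodM r%:C) (cmodM (w / _)) (cmodf (z - z')) z1' divr1 (cmodC z) /lam exprSr -mulrA.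
apply: ler_pM; rewrite ?cmod_ge0 ?mulr_ge0 ?cmod_ge0//.
rewrite mulrA; apply: ler_wpM2r; first exact: cmod_ge0.
rewrite cmod_real ger0_norm// -[leRHS]mul1r; apply: ler_pM; rewrite ?cmod_ge0//.
by apply: le_trans r1 _; exact: ltW (rn_lt1 n).
Qed.

(** N counts the summands of [Phi_sub], 4^N is 2^N from u^N times 2^N from 1 - r_(n-1) = 2 * 2^-n,
    and each of the N + 1 denominators costs 3 + 2 c0. *)
Definition kern_const : R := (2 * N%:R) * 4 ^+ N * (3 + 2 * c0) ^+ N.+1.

Lemma rel_lip_kern :
  rel_lip (kern N n (w / ((rn n.+1)%:C * z))) (kern N n (w / ((rn n.+1)%:C * z')))
    (kern_const * (2 ^- n) ^+ N / D ^+ N.+1) (3 * N.+1%:R * lam).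
Proof.
have D0 := lat_den_gt0.
have l0 : 0 <= lam by rewrite /lam mulr_ge0 ?cmod_ge0 ?exprn_ge0.
have N1 : 1 <= N%:R :> R by rewrite ler1n.
have c1 : 1 <= 3 + 2 * c0 by rewrite ler_wpDr ?mulr_ge0// ler1n.
have hu : rel_lip (w / ((rn n.+1)%:C * z)) (w / ((rn n.+1)%:C * z')) 2 lam := rel_lip_point.
set u := w / (_ * z) in hu *; set u' := w / (_ * z') in hu *.
have lamle (k : nat) : (k <= 3 * N.+1)%N -> k%:R * lam <= 3 * N.+1%:R * lam.
  by move=> h; rewrite ler_wpM2r// -natrM ler_nat.
have p2 k : 0 <= (2 : R) ^+ k by rewrite exprn_ge0.
(* At level 0 the lattice point is 0, the denominator is 1 and [kern] is a plain geometric sum, with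
   no previous level to subtract. *)
have [n0|n0] := eqVneq n 0%N.
  have DE : D = 1.
    by rewrite /D /lat n0 rn0 mul0r /= oppr0 mul0r subr0 cmod1.
  have PE v : kern N n v = \sum_(l < N) v ^+ l.
    rewrite n0 /= /Phi rn0; apply: eq_bigr => l _.
    by rewrite subr0 mul0r subr0 invr1 expr1n !mulr1.
  rewrite !PE; have := @rel_lip_sum N (fun l => u ^+ l) (fun l => u' ^+ l) (2 ^+ N) (N%:R * lam).
  have h l : rel_lip (u ^+ l) (u' ^+ l) (2 ^+ l) (l%:R * lam) by exact: rel_lipX.
  move=> hs; apply: rel_lip_le (hs _); rewrite ?(mulr_ge0 (ler0n _ _) l0)//.
  - rewrite DE expr1n divr1 n0 expr0 invr1 expr1n mulr1 /kern_const.
    rewrite -[leLHS]mulr1; apply: ler_pM; rewrite ?mulr_ge0//; last by rewrite exprn_ege1.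
    apply: ler_pM; rewrite ?p2//; first by rewrite ler_peMl// ler1n.
    by apply: lerXn2r; rewrite ?nnegrE// ler_nat.
  - by apply: lamle; clear; lia.
  move=> l; apply: rel_lip_le (h l); rewrite ?(mulr_ge0 (ler0n _ _) l0)//.
    by rewrite ler_weXn2l ?ler1n// ltnW.
  by rewrite ler_wpM2r// ler_nat ltnW.
have E : n = n.-1.+1 by rewrite prednK// lt0n.
set m := n.-1 in E; have hrm : rn n - rn m = 2 ^- n by rewrite E rn_step.
have hm0 : rn n - 2 ^- n <= rn m by rewrite -hrm subKr.
have hm1 : rn m <= rn n by rewrite -subr_ge0 hrm half_pow_ge0.
have hn0 : rn n - 2 ^- n <= rn n by rewrite gerBl half_pow_ge0.
have [m1 _ _] := kernel_factor hm1 hm0 (rn_ge0 m) z1 hz.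
have [m2 _ _] := kernel_factor hm1 hm0 (rn_ge0 m) z1' hz'.
have [m3 _ _] := kernel_factor (lexx _) hn0 (rn_ge0 n) z1 hz.
have [m4 _ _] := kernel_factor (lexx _) hn0 (rn_ge0 n) z1' hz'.
have PE v : kern N n v = Phi N (rn n) v - Phi N (rn m) v by rewrite {1}E /= -E.
rewrite !PE (Phi_sub _ m1 m3) ?rn_lt1// (Phi_sub _ m2 m4) ?rn_lt1//.
have F1 := rel_lip_factor hm1 hm0 (rn_ge0 m).
have F2 := rel_lip_factor (lexx _) hn0 (rn_ge0 n).
rewrite -/u -/u' in F1 F2 *.
set K := (3 + 2 * c0) / D in F1 F2.
have K0 : 0 <= K by rewrite /K divr_ge0 ?(le_trans ler01 c1)// ltW.
have c2 : cmod ((rn n - rn m)%:C : C) <= 2 ^- n by rewrite hrm cmod_half_pow.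
have hsum l : (l < N)%N -> rel_lip (u ^+ N * (1 - rn m)%:C ^+ l * (1 - rn n)%:C ^+ (N.-1 - l) *
     (X (rn m) z ^+ l.+1 * X (rn n) z ^+ (N - l)))
   (u' ^+ N * (1 - rn m)%:C ^+ l * (1 - rn n)%:C ^+ (N.-1 - l) *
     (X (rn m) z' ^+ l.+1 * X (rn n) z' ^+ (N - l)))
   (2 ^+ N * (2 ^+ N * (2 ^- n) ^+ N.-1) * K ^+ N.+1) (3 * N.+1%:R * lam).
  move=> lN; rewrite -[u ^+ N * _ * _]mulrA -[u' ^+ N * _ * _]mulrA.
  have hc : rel_lip ((1 - rn m)%:C ^+ l * (1 - rn n)%:C ^+ (N.-1 - l))
      ((1 - rn m)%:C ^+ l * (1 - rn n)%:C ^+ (N.-1 - l)) (2 ^+ N * (2 ^- n) ^+ N.-1) 0.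
    apply: rel_lip_cst; rewrite cmodM !cmodX !cmod_real.
    rewrite (_ : 1 - rn m = 2 * 2 ^- n); last by rewrite E /rn half_powS subKr; field; rewrite expf_neq0.
    rewrite (_ : 1 - rn n = 2 ^- n); last by rewrite /rn subKr.
    rewrite !ger0_norm ?mulr_ge0 ?half_pow_ge0// exprMn -mulrA -exprD.
    have -> : (l + (N.-1 - l) = N.-1)%N by clear -lN; lia.
    by rewrite ler_wpM2r ?exprn_ge0 ?half_pow_ge0// ler_weXn2l ?ler1n// ltnW.
  have := rel_lipM (rel_lipM (rel_lipX N hu) hc) (rel_lipM (rel_lipX l.+1 F1) (rel_lipX (N - l) F2)).
  apply: rel_lip_le.
  - rewrite -exprD; have -> : (l.+1 + (N - l) = N.+1)%N by clear -lN; lia.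
    by rewrite lexx.
  (* N factors u and N + 1 denominators give 2 N + 1 relative increments, at most 3 (N + 1). *)
  - rewrite addr0 -mulrDl -mulrDl -!natrD; apply: lamle; clear -lN; lia.
  - by rewrite addr0 -mulrDl -mulrDl -!natrD (mulr_ge0 (ler0n _ _) l0).
have := rel_lipM (rel_lip_cst c2) (rel_lip_sum (fun l : 'I_N => hsum l (ltn_ord l))).
have lN0 : 0 <= 3 * N.+1%:R * lam by apply: (mulr_ge0 _ l0); rewrite mulr_ge0.
apply: rel_lip_le; rewrite ?add0r ?lexx ?lN0//.
have -> : (2 ^- n : R) ^+ N = 2 ^- n * (2 ^- n) ^+ N.-1 by rewrite -exprS prednK.
have -> : K ^+ N.+1 = (3 + 2 * c0) ^+ N.+1 / D ^+ N.+1 by rewrite /K exprMn exprVn.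
rewrite /kern_const (_ : (4 : R) ^+ N = 2 ^+ N * 2 ^+ N); last by rewrite -exprMn -natrM.
set t := 2 ^- n; set a := 2 ^+ N; set b := t ^+ _; set c := (3 + 2 * c0) ^+ _; set d := (D ^+ _)^-1.
rewrite (_ : 2 * N%:R * (a * a) * c * (t * b) * d = 2 * (t * (N%:R * (a * (a * b) * (c * d))))); last by ring.
have t0 : 0 <= t by exact: half_pow_ge0.
have b0 : 0 <= b by exact: exprn_ge0.
have c0' : 0 <= c by apply: exprn_ge0; exact: le_trans ler01 c1.
have d0 : 0 <= d by rewrite /d invr_ge0 exprn_ge0// ltW.
by rewrite ler_peMl ?ler1n// !mulr_ge0// p2.
Qed.

End KernelBound.

End Kernels.

(** * Sums over the lattice *)

Section PowerSums.
Context {R : realType}.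

Lemma powR_half_pow (n : nat) (b : R) : (2 ^- n) `^ b = (2 `^ b) ^- n.
Proof.
have h : (2 ^+ n : R) `^ b = (2 `^ b) ^+ n.
  elim: n => [|n IH]; first by rewrite !expr0 powR1.
  by rewrite !exprS powRM ?exprn_ge0// IH.
by rewrite -h -powRN -{1}[2 ^+ n]invrK powRN -powR_inv1 ?invr_ge0 ?exprn_ge0// -powRrM mulN1r powRN invrK.
Qed.

Lemma powR2_gt1 (b : R) : 0 < b -> 1 < 2 `^ b.
Proof.
move=> b0; rewrite -[X in X < _](_ : 1 `^ b = 1); last by rewrite powR1.
by apply: gt0_ltr_powR; rewrite ?nnegrE ?ler0n ?ler01 ?ltr1n.
Qed.

Lemma powR_anti (x y s : R) : 0 < x -> x <= y -> 0 <= s -> (y `^ s)^-1 <= (x `^ s)^-1.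
Proof.
move=> x0 xy s0; have y0 := lt_le_trans x0 xy.
by rewrite lef_pV2 ?posrE ?powR_gt0//; apply: ge0_ler_powR; rewrite ?nnegrE// ltW.
Qed.

Lemma geometric_sum_le (th : R) n : 0 <= th -> th < 1 -> \sum_(i < n) th ^+ i <= (1 - th)^-1.
Proof.
move=> t0 t1; have h : 0 < 1 - th by rewrite subr_gt0.
rewrite -(ler_pM2l h) mulfV ?gt_eqF// -[leLHS]opprK -mulNr opprB -subrX1 opprB.
by rewrite gerBl exprn_ge0.
Qed.

(** With truncated subtraction, [(m - n) + (n - m)] is |n - m|; each side of m is a geometric
    sum. *)
Lemma sum_two_sided (th : R) m P : 0 <= th -> th < 1 ->
  \sum_(n < P) th ^+ ((m - n) + (n - m)) <= 2 / (1 - th).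
Proof.
move=> t0 t1; have h n k : 0 <= th ^+ ((m - n) + (n - m)) by rewrite exprn_ge0.
apply: (@le_trans _ _ (\sum_(n < m.+1 + P) th ^+ ((m - n) + (n - m)))).
  rewrite addnC big_split_ord /= lerDl; apply: sumr_ge0 => i _; exact: exprn_ge0.
rewrite big_split_ord /= mulr_natl mulr2n; apply: lerD.
  rewrite (reindex_inj rev_ord_inj) /=; apply: le_trans _ (geometric_sum_le m.+1 t0 t1).
  apply: ler_sum => i _; rewrite subSS subKn ?leq_ord//.
  by rewrite (_ : (m - i - m)%N = 0%N) ?addn0//; have := ltn_ord i; lia.
apply: le_trans _ (geometric_sum_le P t0 t1); apply: ler_sum => i _.
rewrite (_ : (m - (m.+1 + i) + (m.+1 + i - m))%N = i.+1); last by lia.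
by rewrite exprS ler_piMl ?exprn_ge0// ltW.
Qed.

End PowerSums.

Section CircleSum.
Context {R : realType}.
Local Notation C := (cplx R).

Lemma conjc_exp (z : C) n : conjc (z ^+ n) = (conjc z) ^+ n :> C.
Proof. exact: (rmorphXn (@conjc R)). Qed.

Lemma unit_cj (z : C) : cmod z = 1 -> conjc z * z = 1.
Proof. by move=> z1; rewrite mulrC mulcJ z1 expr1n. Qed.

(** Discrete Parseval: after expanding the square, the sum over j of the (l - k)-th powers of the
    roots vanishes unless l = k, as both indices are below 2^p. *)
Lemma parseval_geometric p (x : C) :
  \sum_(j < 2 ^ p) cmod (\sum_(k < 2 ^ p) (conjc (rt p ^+ j) * x) ^+ k) ^+ 2 =
  2 ^+ p * \sum_(k < 2 ^ p) (cmod x ^+ 2) ^+ k.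
Proof.
set M := (2 ^ p)%N; apply: (@complexI R); rewrite rmorph_sum rmorphM rmorph_sum /=.
have E (j : 'I_M) : (cmod (\sum_(k < M) (conjc (rt p ^+ j) * x) ^+ k) ^+ 2)%:C =
    \sum_(k < M) \sum_(l < M) x ^+ k * conjc x ^+ l * (rt p ^+ (l + (M - k))) ^+ j :> C.
  rewrite -mulcJ (_ : conjc (\sum_(k < M) (conjc (rt p ^+ j) * x) ^+ k) = \sum_(l < M) (rt p ^+ j * conjc x) ^+ l :> C); last first.
    rewrite (rmorph_sum (@conjc R)); apply: eq_bigr => l _.
    by apply: etrans (conjc_exp _ _) _; rewrite conjcM conjcK.
  rewrite mulr_suml; apply: eq_bigr => k _; rewrite mulr_sumr; apply: eq_bigr => l _.
  (* The exponent -jk is replaced by (M - k) j in order to stay among natural powers. *)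
  have key : (conjc (rt p ^+ j)) ^+ k = rt p ^+ ((M - k) * j) :> C.
    have h : cmod (rt p ^+ (j * k)%N : C) = 1 by exact: cmod_rtX.
    have h0 : rt p ^+ (j * k)%N != 0 :> C by rewrite -cmod_gt0 h.
    apply: (mulIf h0); rewrite -conjc_exp -exprM unit_cj//.
    rewrite -exprD [(j * k)%N]mulnC -mulnDl subnK; last exact: ltnW.
    by rewrite exprM rt_order expr1n.
  have -> : rt p ^+ (l + (M - k)) ^+ j = rt p ^+ j ^+ l * rt p ^+ ((M - k) * j) :> C.
    by rewrite -!exprM -exprD mulnDl [(j * l)%N]mulnC.
  rewrite [(conjc _ * x) ^+ k]exprMn [(_ * conjc x) ^+ l]exprMn key; ring.
rewrite (eq_bigr _ (fun j _ => E j)) exchange_big /= mulr_sumr; apply: eq_bigr => k _.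
rewrite exchange_big /= (bigD1 k) //= [X in _ + X]big1 ?addr0 => [|l lk].
  rewrite -mulr_sumr subnKC; last exact: ltnW.
  rewrite sum_rtX dvdnn mulrC -exprMn mulcJ; congr (_ * _).
    by rewrite rmorphXn /= rmorph_nat.
  exact: esym (rmorphXn (real_complex R) k _).
rewrite -mulr_sumr sum_rtX; case: ifP => [|_]; last by rewrite mulr0.
move=> /dvdnP [q hq]; exfalso; move/eqP: lk; apply; apply/val_inj => /=.
move: (ltn_ord l) (ltn_ord k) hq; rewrite -/M => h1 h2; case: q => [|[|q]]; nia.
Qed.

(** With t = 2^-p and M = 2^p, Bernoulli gives (1 + t)^M >= 2, while ((1 - t) (1 + t))^M <= 1. *)
Lemma half_pow_exp_le p : rn p ^+ (2 ^ p) <= 2^-1 :> R.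
Proof.
have M0 : 0 < (2 : R) ^+ p by rewrite exprn_gt0.
have hb n (y : R) : 0 <= y -> 1 + n%:R * y <= (1 + y) ^+ n.
  move=> y0; elim: n => [|n IH]; first by rewrite mul0r addr0 expr0.
  rewrite exprS -nat1r; have : 0 <= (n%:R : R) by []. 
  have h1 : 1 <= (1 + y) ^+ n by rewrite exprn_ege1// lerDl.
  nra.
have h2 : 2 <= (1 + 2 ^- p) ^+ (2 ^ p) :> R.
  have := hb (2 ^ p)%N (2 ^- p) (half_pow_ge0 p).
  by rewrite natrX mulfV ?gt_eqF// (_ : 1 + 1 = 2)//.
have h3 : rn p ^+ (2 ^ p) * (1 + 2 ^- p) ^+ (2 ^ p) <= 1 :> R.
  rewrite -exprMn exprn_ile1// ?mulr_ge0 ?rn_ge0 ?addr_ge0 ?half_pow_ge0//.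
  rewrite /rn; have := half_pow_ge0 (R := R) p; nra.
have : rn p ^+ (2 ^ p) * 2 <= 1 :> R.
  by apply: le_trans h3; rewrite ler_wpM2l// exprn_ge0// rn_ge0.
lra.
Qed.

(** All v = conj(rt^j) x share the power v^M = x^M, so 1 / (1 - v) is a geometric sum divided by 1 -
    x^M, whose modulus is at least 1/2; Parseval then sums the squares. *)
Lemma circle_sum_sqr p (x : C) : cmod x <= rn p ->
  \sum_(j < 2 ^ p) (cmod (1 - conjc (rt p ^+ j) * x) ^+ 2)^-1 <= 4 * 2 ^+ p / (1 - cmod x).
Proof.
move=> hx; set M := (2 ^ p)%N.
have x1 : cmod x < 1 by apply: le_lt_trans hx _; exact: rn_lt1.
have xM : 2^-1 <= cmod (1 - x ^+ M).
  have := cmod_subl 1 (x ^+ M); rewrite cmod1 cmodX.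
  have : cmod x ^+ M <= 2^-1.
    by apply: le_trans (half_pow_exp_le p); apply: lerXn2r; rewrite ?nnegrE ?cmod_ge0 ?rn_ge0.
  lra.
have E (j : 'I_M) : (cmod (1 - conjc (rt p ^+ j) * x) ^+ 2)^-1 <=
    4 * cmod (\sum_(k < M) (conjc (rt p ^+ j) * x) ^+ k) ^+ 2.
  set v := conjc _ * x; have vM : v ^+ M = x ^+ M.
    by rewrite /v exprMn -conjc_exp -exprM mulnC exprM rt_order expr1n /= oppr0 mul1r.
  have cv : cmod v = cmod x by rewrite cmodM cmodJ cmod_rtX mul1r.
  have v0 : 0 < cmod (1 - v).
    by have := cmod_subl 1 v; rewrite cmod1 cv; apply: lt_le_trans; rewrite subr_gt0.
  have e : (1 - v) * \sum_(k < M) v ^+ k = 1 - x ^+ M.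
    by rewrite -vM -[LHS]opprK -mulNr opprB -subrX1 opprB.
  have h : 2^-1 <= cmod (1 - v) * cmod (\sum_(k < M) v ^+ k) by rewrite -cmodM e.
  rewrite -[leLHS]mul1r ler_pdivrMr ?exprn_gt0//.
  have := cmod_ge0 (\sum_(k < M) v ^+ k); move: h v0.
  move: (cmod (1 - v)) (cmod (\sum_(k < M) v ^+ k)) => a b h1 h2 h3.
  have : 0 <= (a * b - 2^-1) * (a * b + 2^-1) by rewrite mulr_ge0 ?subr_ge0 ?addr_ge0 ?mulr_ge0// ltW.
  by rewrite !expr2; nra.
apply: le_trans (ler_sum _ (fun j _ => E j)) _; rewrite -mulr_sumr parseval_geometric.
rewrite -!mulrA ler_wpM2l// ler_wpM2l ?exprn_ge0//.
apply: le_trans (geometric_sum_le _ _ _) _; rewrite ?exprn_ge0 ?cmod_ge0 ?exprn_ilt1 ?cmod_ge0//.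
rewrite lef_pV2 ?posrE ?subr_gt0 ?exprn_ilt1 ?cmod_ge0// lerB// expr2.
by rewrite ler_piMl ?cmod_ge0// ltW.
Qed.

(** Parseval handles the exponent 2; the remaining s - 2 powers are bounded pointwise through |1 -
    conj(rt^j) x| >= 1 - |x|, which is why 2 <= s. *)
Lemma circle_sum n (z : C) (s : R) : disk z -> 2 <= s ->
  \sum_(j < 2 ^ n) (cmod (1 - conjc (lat n j) * z) `^ s)^-1 <=
  4 * 2 ^+ n * ((1 - rn n * cmod z) `^ (s - 1))^-1.
Proof.
move=> hz s2; set x : C := (rn n)%:C * z.
have cx : cmod x = rn n * cmod z by rewrite cmodM cmod_rn.
have xr : cmod x <= rn n by rewrite cx ler_piMr ?rn_ge0// ltW.
have x1 : 0 < 1 - cmod x by rewrite subr_gt0 (le_lt_trans xr)// rn_lt1.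
rewrite -cx; have E (j : 'I_(2 ^ n)) : conjc (lat n j) * z = conjc (rt n ^+ j) * x.
  by rewrite /lat conjcM conjc_realC /x; ring.
under eq_bigr do rewrite E.
have d1 (j : 'I_(2 ^ n)) : 1 - cmod x <= cmod (1 - conjc (rt n ^+ j) * x).
  by have := cmod_subl 1 (conjc (rt n ^+ j) * x); rewrite cmod1 cmodM cmodJ cmod_rtX mul1r.
have split_pow (a t : R) : 0 < a -> a `^ s = a `^ (s - t) * a `^ t.
  by move=> a0; rewrite -powRD ?subrK// (gt_eqF a0) implybT.
have h (j : 'I_(2 ^ n)) : (cmod (1 - conjc (rt n ^+ j) * x) `^ s)^-1 <=
   ((1 - cmod x) `^ (s - 2))^-1 * (cmod (1 - conjc (rt n ^+ j) * x) ^+ 2)^-1.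
  have a0 := lt_le_trans x1 (d1 j).
  rewrite (split_pow _ 2 a0) powR_mulrn ?(ltW a0)// invfM ler_wpM2r ?invr_ge0 ?exprn_ge0 ?(ltW a0)//.
  by apply: powR_anti => //; rewrite subr_ge0.
apply: le_trans (ler_sum _ (fun j _ => h j)) _; rewrite -mulr_sumr.
apply: le_trans (ler_wpM2l _ (circle_sum_sqr xr)) _; first by rewrite invr_ge0 powR_ge0.
have -> : s - 1 = (s - 2) + 1 by ring.
rewrite [_ `^ (s - 2 + 1)]powRD; last by rewrite (gt_eqF x1) implybT.
rewrite powRr1 ?(ltW x1)// invfM le_eqVlt; apply/orP; left; apply/eqP; ring.
Qed.

End CircleSum.

(** * Normal weights on dyadic levels and the discrete Forelli-Rudin estimate *)

Section NormalWeight.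
Context {R : realType}.
Local Notation C := (cplx R).
Variable nu : C -> R.
Local Notation nuv n := (nu (rn n)%:C).

Lemma disk_rn n : disk ((rn n)%:C : C).
Proof. by change (cmod ((rn n)%:C : C) < 1); rewrite cmod_rn rn_lt1. Qed.

Lemma rn_level (z : C) : disk z -> exists2 m, rn m <= cmod z & cmod z < rn m.+1.
Proof.
move=> hz; have h0 : 0 < 1 - cmod z by rewrite subr_gt0.
have [n0 hn0] : exists n, cmod z < rn n.
  have /cvgrPdist_lt /(_ _ h0) [n _ /(_ n (leqnn _))] := @cvg_half_pow R 1.
  rewrite /= sub0r normrN mul1r ger0_norm ?half_pow_ge0// => h; exists n; rewrite /rn; lra.
have ex : exists n, cmod z < rn n by exists n0.
case: (ex_minnP ex) => -[|m] hm hmin; first by move: hm; rewrite rn0 ltNge cmod_ge0.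
exists m => //; rewrite leNgt; apply/negP => /hmin; by rewrite ltnn.
Qed.

Hypothesis hrad : radial_weight nu.

Lemma weight_gt0 z : disk z -> 0 < nu z.
Proof. by case: hrad => -[_ h _] _; exact: h. Qed.

Lemma weight_anti z w : disk w -> cmod z <= cmod w -> nu w <= nu z.
Proof. by case: hrad => _ h hw zw; apply: h => //; exact: le_lt_trans hw. Qed.

Lemma nuv_gt0 n : 0 < nuv n.
Proof. exact/weight_gt0/disk_rn. Qed.

Lemma one_sub_sqr (n : nat) : 2 ^- n <= 1 - rn n ^+ 2 :> R /\ 1 - rn n ^+ 2 <= 2 * 2 ^- n :> R.
Proof.
have := half_pow_ge0 (R := R) n; have := half_pow_le1 (R := R) n; rewrite /rn expr2.
by move: (2 ^- n) => t; split; nra.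
Qed.

Lemma one_sub_sqr_powR (n : nat) (b : R) : 0 < b ->
  (2 `^ b) ^- n <= (1 - rn n ^+ 2) `^ b /\ (1 - rn n ^+ 2) `^ b <= 2 `^ b * (2 `^ b) ^- n.
Proof.
move=> b0; have [h1 h2] := one_sub_sqr n.
have h3 := half_pow_ge0 (R := R) n.
rewrite -powR_half_pow -powRM//; split; apply: ge0_ler_powR; rewrite ?nnegrE ?mulr_ge0 ?(ltW b0)//; exact: le_trans h1.
Qed.

(** On level n the quantity 1 - r^2 lies between 2^-n and twice that, so the growth condition
    becomes a geometric comparison of levels, an extra factor 2^b absorbing the gap. *)
Lemma incr_exponent_levels b : incr_exponent nu b -> exists2 K : R, 0 < K &
  forall n m, (n <= m)%N -> nuv n <= K * (2 `^ b) ^+ (m - n) * nuv m.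
Proof.
move=> [b0 [K K0 hK]]; have B0 : 0 < 2 `^ b :> R by rewrite powR_gt0.
exists (K * 2 `^ b); first by rewrite mulr_gt0.
move=> n m nm; have := hK (rn n) (rn m) (rn_ge0 _) (rn_homo nm) (rn_lt1 _).
have [n1 n2] := one_sub_sqr_powR n b0; have [m1 m2] := one_sub_sqr_powR m b0.
have pn : 0 < (1 - rn n ^+ 2) `^ b by apply: lt_le_trans n1; rewrite invr_gt0 exprn_gt0.
have pm : 0 < (1 - rn m ^+ 2) `^ b by apply: lt_le_trans m1; rewrite invr_gt0 exprn_gt0.
rewrite ler_pdivrMr// => /le_trans; apply.
have nm0 := nuv_gt0 m.
apply: (@le_trans _ _ (K * (nuv m / (2 `^ b) ^- m) * (2 `^ b * (2 `^ b) ^- n))).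
  apply: ler_pM; rewrite ?powR_ge0//; first by rewrite mulr_ge0 ?divr_ge0// ?(ltW K0) ?(ltW nm0) ?(ltW pm).
  rewrite ler_wpM2l ?(ltW K0)// ler_wpM2l ?(ltW nm0)// lef_pV2 ?posrE// invr_gt0 exprn_gt0//.
rewrite invrK (_ : (2 `^ b) ^+ m = (2 `^ b) ^+ (m - n) * (2 `^ b) ^+ n); last by rewrite -exprD subnK.
rewrite le_eqVlt; apply/orP; left; apply/eqP.
by field; rewrite expf_neq0// gt_eqF.
Qed.

Lemma decr_exponent_levels c : decr_exponent nu c -> exists2 K : R, 0 < K &
  forall n m, (n <= m)%N -> nuv m <= K * (2 `^ c)^-1 ^+ (m - n) * nuv n.
Proof.
move=> [c0 [K K0 hK]]; have B0 : 0 < 2 `^ c :> R by rewrite powR_gt0.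
exists (K * 2 `^ c); first by rewrite mulr_gt0.
move=> n m nm; have := hK (rn n) (rn m) (rn_ge0 _) (rn_homo nm) (rn_lt1 _).
have [n1 n2] := one_sub_sqr_powR n c0; have [m1 m2] := one_sub_sqr_powR m c0.
have pn : 0 < (1 - rn n ^+ 2) `^ c by apply: lt_le_trans n1; rewrite invr_gt0 exprn_gt0.
have pm : 0 < (1 - rn m ^+ 2) `^ c by apply: lt_le_trans m1; rewrite invr_gt0 exprn_gt0.
rewrite ler_pdivrMr// => /le_trans; apply.
have nn0 := nuv_gt0 n.
apply: (@le_trans _ _ (K * (nuv n / (2 `^ c) ^- n) * (2 `^ c * (2 `^ c) ^- m))).
  apply: ler_pM; rewrite ?powR_ge0//; first by rewrite mulr_ge0 ?divr_ge0// ?(ltW K0) ?(ltW nn0) ?(ltW pn).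
  rewrite ler_wpM2l ?(ltW K0)// ler_wpM2l ?(ltW nn0)// lef_pV2 ?posrE// invr_gt0 exprn_gt0//.
rewrite invrK (_ : (2 `^ c) ^+ m = (2 `^ c) ^+ (m - n) * (2 `^ c) ^+ n); last by rewrite -exprD subnK.
rewrite exprVn le_eqVlt; apply/orP; left; apply/eqP.
by field; rewrite !expf_neq0// gt_eqF.
Qed.

Definition level_weight (tau : R) (n : nat) : R := (2 `^ tau) ^- n / nuv n.

Lemma level_weight_ge0 tau n : 0 <= level_weight tau n.
Proof. by rewrite divr_ge0 ?(ltW (nuv_gt0 n))// invr_ge0 exprn_ge0// powR_ge0. Qed.

(* A discrete Forelli-Rudin estimate: away from the level m of z the summands decay
   geometrically in |n - m|. *)
Lemma lattice_sum b c (sg tau : R) : incr_exponent nu b -> decr_exponent nu c ->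
  2 <= sg -> tau <= sg -> b + 1 < tau ->
  exists2 K : R, 0 < K & forall P m z, rn m <= cmod z -> cmod z < rn m.+1 ->
    \sum_(n < P) level_weight tau n *
      \sum_(j < 2 ^ n) (cmod (1 - conjc (lat n j) * z) `^ sg)^-1 <=
    K * (2 `^ (sg - tau)) ^+ m / nuv m.
Proof.
move=> hb hc sg2 ts bt.
have [K1 K10 h1] := incr_exponent_levels hb; have [K2 K20 h2] := decr_exponent_levels hc.
set B := 2 `^ b in h1; set kap := (2 `^ c)^-1 in h2.
have [b0 _] := hb; have [c0 _] := hc.
have B0 : 0 < B by rewrite powR_gt0.
have kap0 : 0 < kap by rewrite invr_gt0 powR_gt0.
have kap1 : kap < 1 by rewrite invf_lt1 ?powR_gt0// powR2_gt1.
pose q := 2 `^ (b + 1 - tau).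
have q0 : 0 < q by rewrite powR_gt0.
have q1 : q < 1.
  have : 1 < 2 `^ (tau - (b + 1)) by apply: powR2_gt1; rewrite subr_gt0.
  by rewrite /q -(opprB tau) powRN invf_lt1// powR_gt0.
pose th := Num.max kap q.
have th0 : 0 <= th by rewrite /th le_max ltW.
have th1 : th < 1 by rewrite /th gt_max kap1.
have kth : kap <= th by rewrite /th le_max lexx.
have qth : q <= th by rewrite /th le_max lexx orbT.
pose S := 2 `^ sg; pose T := 2 `^ tau; pose U := 2 `^ (sg - tau).
have [S0 T0 U0] : [/\ 0 < S, 0 < T & 0 < U] by split; rewrite powR_gt0.
have n20 : (2 : R) == 0 = false by rewrite pnatr_eq0.
have SE : S = T * U by rewrite /S /T /U -powRD ?n20 ?implybT// subrKC.
have U1 : 1 <= U.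
  by have := ler_powR (ler1n R 2) (_ : 0 <= sg - tau); rewrite powRr0 subr_ge0; apply.
have qE : q = 2 * B / T.
  rewrite /q powRB ?n20 ?implybT// powRD ?n20 ?implybT// powRr1// -/B -/T; ring.
have SE1 : 2 `^ (sg - 1) = S / 2 :> R by rewrite powRB ?n20 ?implybT// powRr1.
pose K0 := 4 * K2 + 2 * K1 * S.
have K00 : 0 < K0 by rewrite addr_gt0 ?mulr_gt0.
exists (K0 * (2 / (1 - th))); first by rewrite mulr_gt0// divr_gt0// subr_gt0.
move=> P m z z1 z2; have hz : disk z by apply: lt_le_trans z2 _; exact/ltW/rn_lt1.
have m0 := nuv_gt0 m.
rewrite [leRHS](_ : _ = U ^+ m / nuv m * K0 * (2 / (1 - th))); last by rewrite /U; ring.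
apply: le_trans (ler_wpM2l _ (sum_two_sided m P th0 th1)); last first.
  by rewrite mulr_ge0 ?(ltW K00)// divr_ge0 ?exprn_ge0 ?(ltW U0) ?(ltW m0).
rewrite mulr_sumr; apply: ler_sum => n _.
have n0 := nuv_gt0 n.
apply: le_trans (ler_wpM2l (level_weight_ge0 tau n) (circle_sum n hz sg2)) _.
rewrite /level_weight -/T.
have s10 : 0 <= sg - 1 by lra.
have dz : rn n * cmod z <= cmod z by rewrite ler_piMl ?cmod_ge0// ltW// rn_lt1.
have dz' : rn n * cmod z <= rn n by rewrite ler_piMr ?rn_ge0// ltW.
have inv_pow k : ((2 ^- k : R) `^ (sg - 1))^-1 = (S / 2) ^+ k by rewrite powR_half_pow invrK SE1.
(* Levels up to that of z: the circle sum is governed by 1 - r_n, the powers of 2 combine to U^n <=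
   U^m, and the decay is 1 / nu(r_n) <= K2 kap^(m-n) / nu(r_m). *)
have [nm|mn] := leqP n m.
  have d1 : 2 ^- n <= 1 - rn n * cmod z by move: dz'; rewrite /rn; lra.
  have := powR_anti (half_pow_gt0 n) d1 s10; rewrite inv_pow => hd.
  rewrite (_ : (m - n + (n - m))%N = (m - n)%N); last by clear -nm; lia.
  apply: (@le_trans _ _ (T ^- n / nuv n * (4 * 2 ^+ n * (S / 2) ^+ n))).
    by rewrite ler_wpM2l ?divr_ge0 ?invr_ge0 ?exprn_ge0 ?(ltW T0) ?(ltW n0)// ler_wpM2l// mulr_ge0 ?exprn_ge0.
  rewrite (_ : T ^- n / nuv n * _ = 4 * U ^+ n / nuv n); last first.
    rewrite SE !exprMn exprVn; field; rewrite !expf_neq0 ?gt_eqF//.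
  apply: (@le_trans _ _ (4 * U ^+ m * (K2 * kap ^+ (m - n) / nuv m))).
    rewrite -mulrA -[leRHS]mulrA ler_wpM2l//; apply: ler_pM; rewrite ?exprn_ge0 ?invr_ge0 ?(ltW U0) ?(ltW n0)//.
      by rewrite ler_weXn2l.
    rewrite ler_pdivlMr// mulrC ler_pdivrMr//; exact: h2.
  apply: (@le_trans _ _ (U ^+ m / nuv m * (4 * K2) * th ^+ (m - n))).
    rewrite [leLHS](_ : _ = U ^+ m / nuv m * (4 * K2) * kap ^+ (m - n)); last by ring.
    rewrite ler_wpM2l ?mulr_ge0 ?divr_ge0 ?exprn_ge0 ?invr_ge0 ?(ltW U0) ?(ltW m0) ?(ltW K20)//.
    by apply: lerXn2r; rewrite ?nnegrE ?(ltW kap0).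
  rewrite ler_wpM2r ?exprn_ge0// ler_wpM2l ?divr_ge0 ?exprn_ge0 ?(ltW U0) ?(ltW m0)//.
  by rewrite /K0 lerDl ?mulr_ge0 ?(ltW K10) ?(ltW S0).
(* Levels beyond that of z: the circle sum is governed by 1 - |z|. The 2^n points, the growth B of 1
   / nu and the weight leave the ratio q = 2 B / T, below 1 because b + 1 < tau. *)
have d1 : 2 ^- m.+1 <= 1 - rn n * cmod z by move: dz z2; rewrite /rn; lra.
have := powR_anti (half_pow_gt0 m.+1) d1 s10; rewrite inv_pow => hd.
rewrite (_ : (m - n + (n - m))%N = (n - m)%N); last by clear -mn; lia.
apply: (@le_trans _ _ (T ^- n / nuv n * (4 * 2 ^+ n * (S / 2) ^+ m.+1))).
  by rewrite ler_wpM2l ?divr_ge0 ?invr_ge0 ?exprn_ge0 ?(ltW T0) ?(ltW n0)// ler_wpM2l// mulr_ge0 ?exprn_ge0.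
apply: (@le_trans _ _ (T ^- n * (4 * 2 ^+ n * (S / 2) ^+ m.+1) * (K1 * B ^+ (n - m) / nuv m))).
  rewrite mulrAC ler_wpM2l ?mulr_ge0 ?divr_ge0 ?invr_ge0 ?exprn_ge0 ?mulr_ge0 ?divr_ge0 ?(ltW T0) ?(ltW S0)//.
  rewrite ler_pdivlMr// mulrC ler_pdivrMr//; apply: h1; exact: ltnW.
apply: (@le_trans _ _ (U ^+ m / nuv m * (2 * K1 * S) * th ^+ (n - m))).
  rewrite [leLHS](_ : _ = U ^+ m / nuv m * (2 * K1 * S) * q ^+ (n - m)); last first.
    rewrite -{1 2}(subnK (ltnW mn)); set k := (n - m)%N.
    rewrite qE SE !exprD [_ ^+ m.+1]exprS !exprMn !exprVn; field; rewrite ?expf_neq0 ?gt_eqF//.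
  rewrite ler_wpM2l ?mulr_ge0 ?divr_ge0 ?exprn_ge0 ?invr_ge0 ?(ltW U0) ?(ltW m0) ?(ltW K10) ?(ltW S0)//.
  by apply: lerXn2r; rewrite ?nnegrE ?(ltW q0).
rewrite ler_wpM2r ?exprn_ge0// ler_wpM2l ?divr_ge0 ?exprn_ge0 ?(ltW U0) ?(ltW m0)//.
by rewrite /K0 lerDr ?mulr_ge0 ?(ltW K20).
Qed.

End NormalWeight.

(** * Weighted function spaces *)

Section FunctionSpaces.
Context {R : realType}.
Local Notation C := (cplx R).
Implicit Types (f h : C -> C) (z w : C).

Lemma HD_holomorphic f : HD f -> holomorphic f.
Proof. by move=> [hf _] z /hf hz; exists (derive1 f z); exact: derivable_isd. Qed.

Lemma holomorphic_HD f : holomorphic f -> (forall z, ~ disk z -> f z = 0) -> HD f.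
Proof. by move=> hf h0; split=> // z /hf [d /isd_derivable[]]. Qed.

Lemma isd_eq_on_disk f h z d : (forall w, disk w -> f w = h w) -> disk z -> isd f z d -> isd h z d.
Proof. by move=> e hz; have [r r0 hr] := disk_near hz; apply: hasd_near r0 _ => w /hr /e. Qed.

Lemma HD_patch h : holomorphic h -> HD (patch (fun=> 0) disk h).
Proof.
move=> hh; apply: holomorphic_HD => [z hz|z hz]; last by rewrite /patch memNset.
have [d hd] := hh z hz; exists d; apply: isd_eq_on_disk hz hd => w hw.
by rewrite /patch mem_set.
Qed.

Lemma HD_lin a f h : HD f -> HD h -> HD (a *: f + h).
Proof.
move=> hf hh; apply: holomorphic_HD => [z hz|z hz].
  have [d hd] := HD_holomorphic hf hz; have [e he] := HD_holomorphic hh hz.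
  exists (a * d + e); exact: (hasdD (hasdMl a hd) he).
have -> : (a *: f + h) z = a * f z + h z by [].
by case: hf => _ ->//; case: hh => _ ->//; rewrite mulr0 addr0.
Qed.

Lemma HD0 : HD (0 : C -> C).
Proof. by apply: holomorphic_HD => // z hz; exists 0; exact: hasd_cst. Qed.

Lemma derive1_lin a f h z : disk z -> HD f -> HD h ->
  derive1 (a *: f + h) z = a * derive1 f z + derive1 h z.
Proof.
move=> hz /HD_holomorphic hf /HD_holomorphic hh; apply: derive1_isd.
exact: (hasdD (hasdMl a (isd_derive1 hf hz)) (isd_derive1 hh hz)).
Qed.

Section WeightedSup.
Variable nu : C -> R.

Lemma weighted_sup_leP f (M : R) : (weighted_sup nu f <= M%:E)%E <->
  forall z, disk z -> nu z * cmod (f z) <= M.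
Proof.
split=> [h z hz|h].
  by rewrite -lee_fin; apply: le_trans h; apply: ereal_sup_ubound; exists z.
by apply: ge_ereal_sup => _ [z hz <-]; rewrite lee_fin h.
Qed.

Hypothesis hrad : radial_weight nu.

Lemma weighted_sup_ge0 f : (0 <= weighted_sup nu f)%E.
Proof.
apply: le_trans (_ : (nu 0 * cmod (f 0))%:E <= _)%E.
  by rewrite lee_fin mulr_ge0 ?cmod_ge0// ltW// weight_gt0//; exact: disk0.
by apply: ereal_sup_ubound; exists 0 => //; exact: disk0.
Qed.

Lemma weighted_sup_fin f : (weighted_sup nu f < +oo)%E ->
  exists2 A : R, 0 <= A & weighted_sup nu f = A%:E.
Proof.
have := weighted_sup_ge0 f; case: (weighted_sup nu f) => // A.
by rewrite lee_fin => A0 _; exists A.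
Qed.

Lemma vanishing_bounded f : holomorphic f -> vanishes_at_boundary nu f ->
  (weighted_sup nu f < +oo)%E.
Proof.
move=> hf /(_ 1 ltr01) [r r1 hr]; have [M M0 hM] := holomorphic_bounded hf r1.
apply: (@le_lt_trans _ _ (nu 0 * M + 1)%:E); last exact: ltry.
apply/weighted_sup_leP => z hz.
have n0 : 0 <= nu 0 * M by rewrite mulr_ge0// ltW// weight_gt0//; exact: disk0.
have [zr|rz] := lerP (cmod z) r; last by apply: ltW; apply: lt_le_trans (hr _ rz hz) _; rewrite lerDr.
rewrite -[leLHS]addr0 lerD//; apply: ler_pM; rewrite ?cmod_ge0 ?hM//.
  by rewrite ltW// weight_gt0.
by apply: weight_anti => //; rewrite cmod0 cmod_ge0.
Qed.

Lemma Hzero_sub_Hinf f : Hzero nu f -> Hinf nu f.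
Proof. by move=> [hf vf]; split=> //; apply: vanishing_bounded => //; exact: HD_holomorphic. Qed.

Lemma Bloch0_sub_Bloch f : Bloch0 nu f -> Bloch nu f.
Proof.
move=> [hf vf]; split=> //; apply: vanishing_bounded => //.
exact/holomorphic_derive1/HD_holomorphic.
Qed.

Lemma vanishes_lin a f h : vanishes_at_boundary nu f -> vanishes_at_boundary nu h ->
  vanishes_at_boundary nu (fun z => a * f z + h z).
Proof.
move=> hf hh e e0; have a0 : 0 < cmod a + 1 by rewrite ltr_wpDl ?cmod_ge0.
have [r r1 h1] := hf (e / 2 / (cmod a + 1)) (divr_gt0 (divr_gt0 e0 (ltr0n _ 2)) a0).
have [s s1 h2] := hh (e / 2) (divr_gt0 e0 (ltr0n _ 2)).
exists (Num.max r s); first by rewrite gt_max r1.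
move=> z; rewrite gt_max => /andP[rz sz] z1.
move: (h1 z rz z1) (h2 z sz z1); rewrite ltr_pdivlMr// => {}h1 {}h2.
have n0 : 0 < nu z by apply: weight_gt0.
apply: le_lt_trans (ler_wpM2l (ltW n0) (cmodD _ _)) _; rewrite cmodM.
have := cmod_ge0 (f z); have := cmod_ge0 a; nra.
Qed.

Lemma Hzero_lin a f h : Hzero nu f -> Hzero nu h -> Hzero nu (a *: f + h).
Proof. by move=> [hf vf] [hh vh]; split; [exact: HD_lin|exact: vanishes_lin]. Qed.

Lemma Hzero0 : Hzero nu 0.
Proof.
split; first exact: HD0.
move=> e e0; exists 0 => // z _ _; by rewrite (_ : (0 : C -> C) z = 0)// cmod0 mulr0.
Qed.

(** Condition (II) of a normal weight forces geometric decay along the levels; monotonicity fills in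
    the radii between them. *)
Lemma weight_vanishes c (e : R) : decr_exponent nu c -> 0 < e ->
  exists2 r : R, r < 1 & forall z, r < cmod z -> disk z -> nu z < e.
Proof.
move=> hc e0; have [K K0 hK] := decr_exponent_levels hrad hc.
have [c0 _] := hc; set k := (2 `^ c)^-1 in hK.
have k0 : 0 < k by rewrite invr_gt0 powR_gt0.
have k1 : `|k| < 1 by rewrite ger0_norm ?(ltW k0)// invf_lt1 ?powR_gt0// powR2_gt1.
pose A := K * nu (rn 0)%:C.
have /cvgrPdist_lt /(_ _ e0) [n _ /(_ n (leqnn _))] := @cvg_geometric R A k k1.
rewrite /= sub0r normrN => /(le_lt_trans (ler_norm _)) hn.
exists (rn n); first exact: rn_lt1.
move=> z nz z1; apply: le_lt_trans hn.
apply: le_trans (_ : nu (rn n)%:C <= _).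
  by apply: weight_anti => //; rewrite cmod_rn ltW.
by apply: le_trans (hK 0%N n (leq0n _)) _; rewrite subn0 /A mulrAC.
Qed.

Lemma bounded_Hzero f c (M : R) : decr_exponent nu c -> HD f ->
  (forall z, disk z -> cmod (f z) <= M) -> Hzero nu f.
Proof.
move=> hv hf hM; split=> // e e0.
have M0 : 0 <= M by apply: le_trans (hM 0 disk0); exact: cmod_ge0.
have M1 : 0 < M + 1 by rewrite ltr_wpDl.
have [r r1 hr] := weight_vanishes hv (divr_gt0 e0 M1); exists r => // z rz z1.
have := hr z rz z1; rewrite ltr_pdivlMr//; apply: le_lt_trans.
rewrite ler_wpM2l//; first by rewrite ltW// weight_gt0.
by apply: le_trans (hM z z1) _; rewrite lerDl.
Qed.

End WeightedSup.

Section DerivativeGrowth.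
Variable nu : C -> R.
Hypothesis hrad : radial_weight nu.
Variable b : R.
Hypothesis hb : incr_exponent nu b.
Local Notation nuv n := (nu (rn n)%:C).

(** A point with |w| <= [rn n.+1] is the centre of a disk of radius 2^-(n+2) inside |z| <=
    [rn n.+2], where 1 / nu is controlled by 1 / nu(r_n) through the exponent b. Cauchy's estimate
    costs one factor 2^n for f' and a second one for f'', whence the 4^n. *)
Lemma derivative_growth : exists2 K : R, 0 < K & forall f (A : R) n, holomorphic f ->
  (forall z, disk z -> nu z * cmod (f z) <= A) ->
  (forall z, cmod z <= rn n.+1 -> cmod (derive1 f z) <= K * 2 ^+ n / nuv n * A) /\
  (forall z w, cmod z <= rn n.+1 -> cmod w <= rn n.+1 ->
     cmod (derive1 f w - derive1 f z) <= K * 4 ^+ n / nuv n * A * cmod (w - z)).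
Proof.
have [K1 K10 h1] := incr_exponent_levels hrad hb; set B := 2 `^ b in h1.
have B0 : 0 < B by rewrite powR_gt0.
pose c1 := K1 * B ^+ 2; pose c2 := K1 * B ^+ 1.
have c10 : 0 < c1 by rewrite mulr_gt0 ?exprn_gt0.
have c20 : 0 < c2 by rewrite mulr_gt0 ?exprn_gt0.
have inv1 n : (nuv n.+2)^-1 <= c1 / nuv n.
  rewrite ler_pdivlMr ?nuv_gt0// mulrC ler_pdivrMr ?nuv_gt0//.
  by have := h1 n n.+2 (leq_trans (leqnSn _) (leqnSn _)); rewrite -[n.+2]addn2 addKn.
have inv2 n : (nuv n.+1)^-1 <= c2 / nuv n.
  rewrite ler_pdivlMr ?nuv_gt0// mulrC ler_pdivrMr ?nuv_gt0//.
  by have := h1 n n.+1 (leqnSn _); rewrite -[n.+1]addn1 addKn.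
have near_circle n z w : cmod w <= rn n.+1 -> cmod (z - w) < 2 ^- n.+2 -> cmod z <= rn n.+2 :> R.
  move=> hw hz; rewrite -(subrK w z); apply: le_trans (cmodD _ _) _.
  by have := rn_step (R := R) n.+1; lra.
have wd n w : cmod w <= rn n.+1 -> cmod w + 2 ^- n.+2 <= 1 :> R.
  by move=> hw; have := rn_step (R := R) n.+1; have := rn_lt1 (R := R) n.+2; lra.
have rd n z : cmod z <= rn n -> disk z by move=> h; apply: le_lt_trans h (rn_lt1 n).
have G1 f (A : R) n w : holomorphic f -> (forall z, disk z -> nu z * cmod (f z) <= A) ->
    cmod w <= rn n.+1 -> cmod (derive1 f w) <= 8 * c1 * 2 ^+ n / nuv n * A.
  move=> hf hA hw.
  have A0 : 0 <= A.
    by apply: le_trans (hA 0 disk0); rewrite mulr_ge0 ?cmod_ge0// ltW// weight_gt0//; exact: disk0.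
  have hM z : cmod (z - w) < 2 ^- n.+2 -> cmod (f z) <= A * (c1 / nuv n).
    move=> /(near_circle n z w hw) hz; apply: le_trans (ler_wpM2l A0 (inv1 n)).
    rewrite ler_pdivlMr ?nuv_gt0//; apply: le_trans (hA z (rd _ _ hz)); rewrite mulrC ler_wpM2r ?cmod_ge0//.
    by apply: weight_anti => //; [exact: disk_rn|rewrite cmod_rn].
  apply: le_trans (cauchy_estimate hf (half_pow_gt0 n.+2) (wd n w hw) hM) _.
  by rewrite invrK !exprS le_eqVlt; apply/orP; left; apply/eqP; ring.
(* 8 = 2 * 4 comes from Cauchy's estimate at radius 2^-(n+2); 128 = 2 * 4 * 8 * 2, the last 2 from
   using the first bound at level n + 1. *)
pose K := 8 * c1 + 128 * c1 * c2.
have k1 : 0 < 8 * c1 by rewrite mulr_gt0.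
have k2 : 0 < 128 * c1 * c2 by rewrite !mulr_gt0.
exists K; first by rewrite addr_gt0.
move=> f A n hf hA.
have A0 : 0 <= A.
  by apply: le_trans (hA 0 disk0); rewrite mulr_ge0 ?cmod_ge0// ltW// weight_gt0//; exact: disk0.
have nn := nuv_gt0 hrad n.
split=> [z hz|].
  apply: le_trans (G1 f A n z hf hA hz) _.
  rewrite ler_wpM2r// ler_wpM2r ?invr_ge0 ?(ltW nn)// ler_wpM2r ?exprn_ge0//.
  by rewrite /K lerDl ltW.
have hf' := holomorphic_derive1 hf.
apply: mean_value_disk (fun z hz => isd_derive1 hf' (rd _ _ hz)) _.
move=> w hw.
have hM z : cmod (z - w) < 2 ^- n.+2 -> cmod (derive1 f z) <= 8 * c1 * 2 ^+ n.+1 * (c2 / nuv n) * A.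
  move=> /(near_circle n z w hw) hz; apply: le_trans (G1 f A n.+1 z hf hA hz) _.
  by rewrite ler_wpM2r// ler_wpM2l// mulr_ge0 ?exprn_ge0// ltW.
apply: le_trans (cauchy_estimate hf' (half_pow_gt0 n.+2) (wd n w hw) hM) _.
have -> : (4 : R) ^+ n = 2 ^+ n * 2 ^+ n by rewrite -exprMn -natrM.
apply: (@le_trans _ _ (128 * c1 * c2 * (2 ^+ n * 2 ^+ n) / nuv n * A)).
  by rewrite invrK !exprS le_eqVlt; apply/orP; left; apply/eqP; ring.
rewrite ler_wpM2r// ler_wpM2r ?invr_ge0 ?(ltW nn)// ler_wpM2r ?mulr_ge0 ?exprn_ge0//.
by rewrite /K lerDr ltW.
Qed.

End DerivativeGrowth.

(** * The symbols g and phi, and the kernel suprema *)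

Section Symbols.
Variables (mu : C -> R) (g phi : C -> C) (c : R).
Hypotheses (hrad : radial_weight mu) (hc : decr_exponent mu c).
Hypotheses (hg : Bloch0 mu g) (hphi : analytic_self_map phi).

Lemma disk_phi z : disk z -> disk (phi z).
Proof. by move=> /hphi []. Qed.

Lemma isd_phi z : disk z -> isd phi z (derive1 phi z).
Proof. by move=> /hphi [h _]; exact: derivable_isd. Qed.

Lemma hol_g : holomorphic g.
Proof. by case: hg => /HD_holomorphic. Qed.

Lemma holomorphic_comp_mul h : holomorphic h -> holomorphic (fun w => h (phi w) * g w).
Proof.
move=> hh z hz; have [d hd] := hh _ (disk_phi hz).
by eexists; exact: (hasdM (hasd_comp hd (isd_phi hz)) (isd_derive1 hol_g hz)).
Qed.

Lemma HD_primitive h : holomorphic h -> HD (patch (fun=> 0) disk (primitive0 h)).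
Proof. by move=> hh; apply: HD_patch => z hz; exists (h z); exact: isd_primitive0. Qed.

Lemma isd_primitive_patch h z : holomorphic h -> disk z ->
  isd (patch (fun=> 0) disk (primitive0 h)) z (h z).
Proof.
move=> hh hz; apply: isd_eq_on_disk hz (isd_primitive0 hh hz) => w hw.
by rewrite /patch mem_set.
Qed.

Lemma primitive_patch_0 h : patch (fun=> 0) disk (primitive0 h) 0 = 0.
Proof. by rewrite /patch; case: ifP => // _; exact: primitive0_0. Qed.

Lemma S_op_HD f : HD f -> HD (S_op g phi f).
Proof. by move=> /HD_holomorphic /holomorphic_derive1 hf; exact/HD_primitive/holomorphic_comp_mul. Qed.

Lemma S_op_derive f z : HD f -> disk z -> derive1 (S_op g phi f) z = derive1 f (phi z) * g z.
Proof.
move=> /HD_holomorphic /holomorphic_derive1 hf hz; apply: derive1_isd.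
exact: (isd_primitive_patch (holomorphic_comp_mul hf)).
Qed.

Lemma S_op_0 f : S_op g phi f 0 = 0.
Proof. exact: primitive_patch_0. Qed.

(** Membership in the little Bloch space controls g' only. Integrating g' radially from the circle
    of radius [r'] gives mu(z) |g(z) - g(a)| <= e / 2, because mu is nowhere smaller on the segment
    than at z; the remaining mu(z) |g(a)| is small since mu tends to 0 at the boundary. *)
Lemma symbol_vanishes : vanishes_at_boundary mu g.
Proof.
move=> e e0; have e2 : 0 < e / 2 by rewrite divr_gt0.
case: hg => hHD /(_ _ e2) [r r1 hr].
have hgh := hol_g.
set r' := Num.max r 0; have r'1 : r' < 1 by rewrite gt_max r1 ltr01.
have r'0 : 0 <= r' by rewrite le_max lexx orbT.
have [M M0 hM] := holomorphic_bounded hgh r'1.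
have M1 : 0 < M + 1 by rewrite ltr_wpDl.
have [s s1 hs] := weight_vanishes hrad hc (divr_gt0 e2 M1).
exists (Num.max r' s); first by rewrite gt_max r'1.
move=> z; rewrite gt_max => /andP[rz sz] z1.
have hmz : 0 < mu z by apply: weight_gt0.
have cz : 0 < cmod z by apply: le_lt_trans rz.
pose a : C := (r' / cmod z)%:C * z.
have tr : 0 <= r' / cmod z <= 1.
  by rewrite divr_ge0 ?(ltW cz)//= ler_pdivrMr// mul1r ltW.
have ca : cmod a = r'.
  by case/andP: tr => t0 _; rewrite cmodM cmod_real ger0_norm// divfK// gt_eqF.
have hseg : cmod (g z - g a) <= e / 2 / mu z.
  have := @mean_value_path R (fun t => g (a + t%:C * (z - a)))
    (fun t => derive1 g (a + t%:C * (z - a)) * (z - a)) (e / 2 / mu z).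
  rewrite mul1r mul0r addr0 subrKC; apply.
    move=> t ht; apply: hasd_comp (isrd_segment a z t); apply: isd_derive1 hgh _.
    by apply: disk_segment => //; rewrite /disk /= ca.
  move=> t /andP[t0 t1].
  have zaE : z - a = (1 - r' / cmod z)%:C * z.
    by rewrite /a (rmorphB (real_complex R) 1) rmorph1 mulrBl mul1r.
  have cza : cmod (z - a) = cmod z - r'.
    rewrite zaE cmodM cmod_real ger0_norm ?subr_ge0; last by case/andP: tr.
    by rewrite mulrBl mul1r divfK// gt_eqF.
  have xE : a + t%:C * (z - a) = (r' / cmod z + t * (1 - r' / cmod z))%:C * z.
    rewrite zaE /a (rmorphD (real_complex R) (r' / cmod z)) (rmorphM (real_complex R) t).
    by rewrite mulrDl mulrA.
  have cx : cmod (a + t%:C * (z - a)) = r' + t * (cmod z - r').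
    case/andP: tr => tr0 tr1.
    rewrite xE cmodM cmod_real ger0_norm; last by rewrite addr_ge0// mulr_ge0 ?subr_ge0// ltW.
    by field; rewrite gt_eqF.
  have x1 : r < cmod (a + t%:C * (z - a)).
    rewrite cx; apply: (@le_lt_trans _ _ r'); first by rewrite le_max lexx.
    by rewrite ltrDl mulr_gt0// subr_gt0.
  have x2 : cmod (a + t%:C * (z - a)) <= cmod z by rewrite cx; nra.
  have := hr _ x1 (le_lt_trans x2 z1).
  have hx := weight_anti hrad z1 x2.
  have mx0 : 0 < mu (a + t%:C * (z - a)) by apply: lt_le_trans hx.
  move=> h; rewrite cmodM cza ler_pdivlMr//.
  have := cmod_ge0 (derive1 g (a + t%:C * (z - a))); set dg := cmod (derive1 g _) in h *.
  move=> d0; have h3 : dg * mu z <= e / 2.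
    by rewrite mulrC; apply: le_trans (ltW h); rewrite ler_wpM2r.
  have : 0 <= dg * mu z by rewrite mulr_ge0// ltW.
  have : cmod z - r' <= 1 by move: z1; rewrite /= ; lra.
  have : 0 <= cmod z - r' by rewrite subr_ge0 ltW.
  nra.
have ga : cmod (g a) <= M by apply: hM; rewrite ca.
have := hs z sz z1; rewrite ltr_pdivlMr// => hms.
have : cmod (g z) <= e / 2 / mu z + M.
  by rewrite -(subrK (g a) (g z)); apply: le_trans (cmodD _ _) _; exact: lerD.
move=> /(ler_wpM2l (ltW hmz)) h; apply: le_lt_trans h _.
rewrite mulrDr mulrCA mulfV ?gt_eqF// mulr1; nra.
Qed.

Lemma symbol_bounded : exists2 G : R, 0 < G & forall z, disk z -> mu z * cmod (g z) <= G.
Proof.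
have /weighted_sup_fin [//|A A0 hA] := vanishing_bounded hrad hol_g symbol_vanishes.
exists (A + 1); first by rewrite ltr_wpDl.
have h : (weighted_sup mu g <= A%:E)%E by rewrite hA.
by move=> z /((weighted_sup_leP _ _ _).1 h) h'; apply: le_trans h' _; rewrite lerDl.
Qed.

Definition kernel_values (s : R) (zeta : C) : set R :=
  [set mu z * cmod (g z) / cmod (1 - conjc zeta * phi z) `^ s | z in disk].

(** The K_s of the overview as a real supremum; [has_sup_kernel] shows that it is attained as a
    finite bound, by boundedness of mu |g|. *)
Definition kernel_sup (s : R) (zeta : C) : R := sup (kernel_values s zeta).

Lemma den_ge (zeta w : C) : disk zeta -> disk w -> 1 - cmod zeta <= cmod (1 - conjc zeta * w).
Proof.
move=> hz hw; have := cmod_subl 1 (conjc zeta * w); rewrite cmod1 cmodM cmodJ => h.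
by apply: le_trans h; rewrite lerB// ler_piMr ?cmod_ge0// ltW.
Qed.

Lemma den_gt0 (zeta w : C) : disk zeta -> disk w -> 0 < cmod (1 - conjc zeta * w).
Proof. by move=> hz hw; apply: lt_le_trans (den_ge hz hw); rewrite subr_gt0. Qed.

Lemma has_sup_kernel (s : R) zeta : 0 <= s -> disk zeta -> has_sup (kernel_values s zeta).
Proof.
move=> s0 hz; have [G G0 hG] := symbol_bounded.
split; first by eexists; exists 0 => //; exact: disk0.
exists (G / (1 - cmod zeta) `^ s) => _ [z hz' <-].
have hw := disk_phi hz'.
apply: ler_pM; rewrite ?mulr_ge0 ?cmod_ge0 ?invr_ge0 ?powR_ge0//; first by rewrite ltW// weight_gt0.
  exact: hG.
by apply: powR_anti => //; [rewrite subr_gt0|exact: den_ge].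
Qed.

Lemma kernel_sup_ub (s : R) zeta z : 0 <= s -> disk zeta -> disk z ->
  mu z * cmod (g z) / cmod (1 - conjc zeta * phi z) `^ s <= kernel_sup s zeta.
Proof. by move=> s0 hz hz'; apply: (sup_upper_bound (has_sup_kernel s0 hz)); exists z. Qed.

Lemma kernel_sup_le (s M : R) zeta : (forall z, disk z ->
  mu z * cmod (g z) / cmod (1 - conjc zeta * phi z) `^ s <= M) -> kernel_sup s zeta <= M.
Proof.
move=> h; apply: ge_sup; first by eexists; exists 0 => //; exact: disk0.
by move=> _ [z hz <-]; exact: h.
Qed.

Lemma kernel_sup_ge0 (s : R) zeta : 0 <= s -> disk zeta -> 0 <= kernel_sup s zeta.
Proof.
move=> s0 hz; apply: le_trans (kernel_sup_ub s0 hz disk0).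
by rewrite divr_ge0 ?powR_ge0// mulr_ge0 ?cmod_ge0// ltW// weight_gt0//; exact: disk0.
Qed.

End Symbols.

End FunctionSpaces.

(** * The lattice condition *)

Section NuclearImpliesLattice.
Context {R : realType}.
Local Notation C := (cplx R).
Implicit Types (f h : C -> C) (z w : C).

(** One flat list of the lattice indices below level P, so that double sums can be exchanged and a
    single point extracted from them. *)
Definition lattice_seq (P : nat) : seq (nat * nat) :=
  [seq (n, j) | n <- iota 0 P, j <- iota 0 (2 ^ n)].

Lemma sum_lattice_seq (V : nmodType) P (F : nat -> nat -> V) :
  \sum_(x <- lattice_seq P) F x.1 x.2 = \sum_(n < P) \sum_(j < 2 ^ n) F n j.
Proof.
rewrite /lattice_seq big_allpairs_dep /= -[P in iota 0 P]subn0 -/(index_iota 0 P) big_mkord.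
apply: eq_bigr => n _.
by rewrite -[X in iota 0 X]subn0 -/(index_iota 0 (2 ^ n)) big_mkord.
Qed.

(** Turns convergence for each test function into a common truncation index for the finitely many of
    them in use. *)
Lemma eventually_all (I : eqType) (r : seq I) (Q : I -> nat -> Prop) :
  (forall x, x \in r -> exists M, forall n, (M <= n)%N -> Q x n) ->
  exists M, forall n, (M <= n)%N -> forall x, x \in r -> Q x n.
Proof.
elim: r => [|x r IH] h; first by exists 0%N.
have [M1 h1] := h x (mem_head _ _).
have [|M2 h2] := IH; first by move=> y yr; apply: h; rewrite in_cons yr orbT.
exists (maxn M1 M2) => n; rewrite geq_max => /andP[n1 n2] y; rewrite in_cons => /orP[/eqP ->|yr].
  exact: h1.
exact: h2.
Qed.

Section Dual.
Variable nu : C -> R.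
Hypothesis hrad : radial_weight nu.

Lemma dual_linear0 (l : (C -> C) -> C) : dual (Hzero nu) l -> l 0 = 0.
Proof.
move=> [hl _]; have := hl 1 0 0 (Hzero0 nu) (Hzero0 nu).
rewrite scaler0 addr0 mul1r => /eqP; rewrite -{1}[l 0]addr0 (inj_eq (addrI _)) => /eqP h.
exact: esym h.
Qed.

Lemma dual_norm_ge0 (l : (C -> C) -> C) : (0 <= dual_norm (Hzero nu) l)%E.
Proof.
apply: le_trans (_ : (cmod (l 0))%:E <= _)%E; first by rewrite lee_fin cmod_ge0.
apply: ereal_sup_ubound; exists 0 => //; split; first exact: Hzero0.
apply/weighted_sup_leP => z _; rewrite (_ : (0 : C -> C) z = 0)//.
by rewrite cmod0 mulr0.
Qed.

Lemma dual_fin (l : (C -> C) -> C) : dual (Hzero nu) l ->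
  exists2 a : R, 0 <= a & dual_norm (Hzero nu) l = a%:E.
Proof.
move=> [_]; have := dual_norm_ge0 l; case: (dual_norm _ _) => // a.
by rewrite lee_fin => a0 _; exists a.
Qed.

Lemma dual_bound (l : (C -> C) -> C) (a A : R) f : dual (Hzero nu) l ->
  dual_norm (Hzero nu) l = a%:E -> 0 < A -> Hzero nu f ->
  (forall z, disk z -> nu z * cmod (f z) <= A) -> cmod (l f) <= a * A.
Proof.
move=> hl ha A0 hf hA; have cA : cmod ((A^-1)%:C : C) = A^-1.
  by rewrite cmod_real ger0_norm// invr_ge0 ltW.
have hx : Hzero nu ((A^-1)%:C *: f) by rewrite -[_ *: f]addr0; apply: Hzero_lin => //; exact: Hzero0.
have E : l ((A^-1)%:C *: f) = (A^-1)%:C * l f.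
  by rewrite -[_ *: f]addr0 (hl.1 _ _ _ hf (Hzero0 nu)) dual_linear0// addr0.
have : (cmod (l ((A^-1)%:C *: f)) <= a)%R.
  rewrite -lee_fin -ha; apply: ereal_sup_ubound; exists ((A^-1)%:C *: f) => //; split=> //.
  apply/weighted_sup_leP => z hz; rewrite (_ : _ z = (A^-1)%:C * f z)// cmodM cA.
  by rewrite mulrCA mulrC ler_pdivrMr// mul1r; exact: hA.
by rewrite E cmodM cA mulrC ler_pdivrMr.
Qed.

(** Phases [u i] make every [u i * l (fs i)] nonnegative, so the sum of moduli is the value of [l]
    on the single function with coefficients [wt i * u i], whose norm is at most A. *)
Lemma dual_sum_bound (I : Type) (r : seq I) (wt : I -> R) (fs : I -> C -> C)
    (l : (C -> C) -> C) (a A : R) : dual (Hzero nu) l ->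
  dual_norm (Hzero nu) l = a%:E -> 0 < A -> (forall i, 0 <= wt i) -> (forall i, Hzero nu (fs i)) ->
  (forall z, disk z -> nu z * \sum_(i <- r) wt i * cmod (fs i z) <= A) ->
  \sum_(i <- r) wt i * cmod (l (fs i)) <= a * A.
Proof.
move=> hl ha A0 wt0 hfs hA.
(* If [l (fs i)] is 0, division by zero gives [u i = 0], which is consistent with [ul]. *)
pose u i : C := conjc (l (fs i)) / (cmod (l (fs i)))%:C.
have u1 i : cmod (u i) <= 1.
  rewrite cmodf cmodJ cmod_real ger0_norm ?cmod_ge0//.
  by have [->|h] := eqVneq (cmod (l (fs i))) 0; rewrite ?mul0r// divff.
have ul i : u i * l (fs i) = (cmod (l (fs i)))%:C.
  rewrite /u mulrAC [conjc _ * _]mulrC mulcJ; have [->|h] := eqVneq (cmod (l (fs i))) 0.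
    by rewrite expr0n /= mul0r.
  by rewrite expr2 rmorphM mulfK// -cmod_gt0 cmod_real normr_gt0.
pose F := \sum_(i <- r) ((wt i)%:C * u i) *: fs i.
have [hF lF] : Hzero nu F /\ l F = \sum_(i <- r) (wt i)%:C * u i * l (fs i).
  rewrite /F; elim: (r) => [|i s [IH1 IH2]].
    by rewrite !big_nil; split; [exact: Hzero0|exact: dual_linear0].
  rewrite !big_cons; split; first exact: Hzero_lin.
  by rewrite hl.1// IH2.
have hFA z : disk z -> nu z * cmod (F z) <= A.
  move=> hz; apply: le_trans (hA z hz); rewrite ler_wpM2l//; first by rewrite ltW// weight_gt0.
  have -> : F z = \sum_(i <- r) (wt i)%:C * u i * fs i z by rewrite /F fct_sumE.
  apply: le_trans (cmod_sum _ _ _) _; apply: ler_sum => i _.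
  rewrite (cmodM ((wt i)%:C * u i)) (cmodM _ (u i)) cmod_real ger0_norm// ler_wpM2r ?cmod_ge0//.
  by rewrite ler_piMr.
have := dual_bound hl ha A0 hF hFA; rewrite lF.
rewrite (eq_bigr (fun i => (wt i * cmod (l (fs i)))%:C)); last first.
  by move=> i _; rewrite -mulrA ul -rmorphM.
have -> : \sum_(i <- r) (wt i * cmod (l (fs i)))%:C = (\sum_(i <- r) wt i * cmod (l (fs i)))%:C :> C.
  by rewrite rmorph_sum.
rewrite cmod_real ger0_norm// sumr_ge0// => i _.
by rewrite mulr_ge0 ?cmod_ge0.
Qed.

End Dual.

Section Main.
Variables (nu mu : C -> R) (g phi : C -> C) (b c cm : R).
Hypotheses (hnu : radial_weight nu) (hb : incr_exponent nu b) (hc : decr_exponent nu c).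
Hypotheses (hmu : radial_weight mu) (hcm : decr_exponent mu cm).
Hypotheses (hg : Bloch0 mu g) (hphi : analytic_self_map phi).

(* The discrete form of condition (e), which is the case s = alpha + 3. *)
Definition lattice_condition (s : R) : Prop := exists B : R, forall P,
  \sum_(n < P) level_weight nu (s - 1) n * \sum_(j < 2 ^ n) kernel_sup mu g phi s (lat n j) <= B.

Definition test_fun (N : nat) (zeta : C) : C -> C :=
  patch (fun=> 0) disk (fun z => (1 - conjc zeta * z)^-1 ^+ N).

Lemma den_neq0 (zeta w : C) : disk zeta -> disk w -> 1 - conjc zeta * w != 0.
Proof. by move=> h1 h2; rewrite -cmod_gt0; exact: den_gt0. Qed.

Lemma isd_test_fun N zeta z : disk zeta -> disk z ->
  isd (test_fun N zeta) z (N%:R * conjc zeta * (1 - conjc zeta * z)^-1 ^+ N.+1).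
Proof.
move=> hze hz; apply: (@isd_eq_on_disk _ (fun z => (1 - conjc zeta * z)^-1 ^+ N)) => //.
  by move=> w hw; rewrite /test_fun /patch mem_set.
have h1 : isd (fun s => 1 - conjc zeta * s) z (0 - conjc zeta * 1).
  exact: hasdB (hasd_cst (fun x : C => x) 1 z) (hasdMl (conjc zeta) (hasd_io (fun x : C => x) z)).
have h2 := hasdX N (hasdV (f := fun s : C => 1 - conjc zeta * s) (den_neq0 hze hz) h1).
apply: hasd_eq h2 _; rewrite sub0r mulr1; case: (N) => [|n]; first by rewrite !mul0r.
by rewrite /= !exprS; ring.
Qed.

Lemma test_fun_Hzero N zeta : disk zeta -> Hzero nu (test_fun N zeta).
Proof.
move=> hze; apply: (@bounded_Hzero _ _ hnu _ c ((1 - cmod zeta)^-1 ^+ N)) => //.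
  by apply: holomorphic_HD => [z hz|z hz]; [eexists; exact: isd_test_fun|rewrite /test_fun /patch memNset].
move=> z hz; rewrite /test_fun /patch mem_set// cmodX cmodV.
have d0 : 0 < 1 - cmod zeta by rewrite subr_gt0.
apply: lerXn2r; rewrite ?nnegrE ?invr_ge0 ?cmod_ge0 ?(ltW d0)//.
by rewrite lef_pV2 ?posrE ?den_gt0//; exact: den_ge.
Qed.

Lemma disk_lat n j : disk (lat n j : C).
Proof. by change (cmod (lat n j : C) < 1); rewrite cmod_lat rn_lt1. Qed.

Lemma bloch_fin y : Bloch mu y -> exists2 B : R, 0 <= B & bloch_norm mu y = B%:E.
Proof.
move=> [_ /(weighted_sup_fin hmu) [A A0 hA]]; exists (cmod (y 0) + A).
  by rewrite addr_ge0 ?cmod_ge0.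
by rewrite /bloch_norm hA.
Qed.

Lemma bloch_norm_ge0 y : (0 <= bloch_norm mu y)%E.
Proof. by rewrite adde_ge0 ?lee_fin ?cmod_ge0//; exact: weighted_sup_ge0. Qed.

Lemma bloch_norm_bound y (B : R) z : (bloch_norm mu y <= B%:E)%E -> disk z ->
  mu z * cmod (derive1 y z) <= B.
Proof.
move=> hB; have : (weighted_sup mu (derive1 y) <= B%:E)%E.
  by apply: le_trans hB; rewrite leeDr// lee_fin cmod_ge0.
by move=> /weighted_sup_leP h /h.
Qed.

(** The derivative of S f_zeta is N conj(zeta) g (1 - conj(zeta) phi)^-(N+1), so its Bloch norm
    dominates N |zeta| times the kernel supremum. The nuclear expansion truncated at m is inserted
    and the sums are exchanged, so that each functional meets the whole weighted family of test
    functions at once. *)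
Lemma nuclear_lattice (N : nat) : (2 <= N)%N -> b + 1 < N%:R ->
  nuclear (Hzero nu) (Bloch mu) (S_op g phi) -> lattice_condition N.+1%:R.
Proof.
move=> N2 bN [_ [x' [y [hx' hy hsum hcv]]]].
have /choice [al hal] : forall k, exists al : R, 0 <= al /\ dual_norm (Hzero nu) (x' k) = al%:E.
  move=> k.
  by have [a a0 ha] := dual_fin (hx' k); exists a.
have /choice [be hbe] : forall k, exists be : R, 0 <= be /\ bloch_norm mu (y k) = be%:E.
  move=> k.
  by have [a a0 ha] := bloch_fin (hy k); exists a.
have [Bn hBn] : exists Bn : R, forall m, \sum_(k < m) al k * be k <= Bn.
  have t0 k : (0 <= dual_norm (Hzero nu) (x' k) * nnorm (Bloch mu) (y k))%E.
    by rewrite mule_ge0 ?dual_norm_ge0//; exact: bloch_norm_ge0.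
  move: hsum; case E : (\sum_(0 <= k <oo) _)%E => [B| |] // _.
    exists B => m; rewrite -lee_fin -E.
    apply: le_trans (nneseries_lim_ge m (fun k _ _ => t0 k)).
    rewrite big_mkord -sumEFin le_eqVlt; apply/orP; left; apply/eqP; apply: eq_bigr => k _.
    by rewrite (hal k).2 /= (hbe k).2 EFinM.
  have := nneseries_ge0 (N := 0%N) (P := xpredT) (fun k _ _ => t0 k).
  by rewrite E.
have bN' : b + 1 < N%:R by [].
have sg2 : (2 : R) <= N%:R by rewrite ler_nat.
have [K K0 hK] := lattice_sum hnu hb hc sg2 (lexx N%:R) bN.
pose f x := test_fun N (lat x.1 x.2).
pose wt (x : nat * nat) := level_weight nu N%:R x.1.
have wt0 x : 0 <= wt x by exact: level_weight_ge0.
have hf x : Hzero nu (f x) by apply: test_fun_Hzero; exact: disk_lat.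
(* The case tau = sg of [lattice_sum]: its bound is K / nu(r_m), and nu(z) <= nu(r_m). *)
have FR P z : disk z -> nu z * \sum_(x <- lattice_seq P) wt x * cmod (f x z) <= K.
  move=> hz; have [m m1 m2] := rn_level hz; have nm := nuv_gt0 hnu m.
  have nz := weight_gt0 hnu hz.
  have := hK P m z m1 m2; rewrite subrr powRr0 expr1n mulr1 => h.
  have E : \sum_(x <- lattice_seq P) wt x * cmod (f x z) = \sum_(n < P) level_weight nu N%:R n *
      \sum_(j < 2 ^ n) (cmod (1 - conjc (lat n j) * z) `^ N%:R)^-1.
    rewrite (sum_lattice_seq P (fun n j => wt (n, j) * cmod (f (n, j) z))).
    apply: eq_bigr => n _; rewrite mulr_sumr; apply: eq_bigr => j _; congr (_ * _).
    by rewrite /f /test_fun /patch mem_set//= cmodX cmodV powR_mulrn ?cmod_ge0// exprVn.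
  rewrite E; apply: le_trans (ler_wpM2l (ltW nz) h) _.
  rewrite mulrCA -[leRHS]mulr1 ler_wpM2l ?(ltW K0)// ler_pdivrMr// mul1r.
  by apply: weight_anti => //; rewrite cmod_rn.
have key P m (e : R) : 0 <= e -> (forall x, x \in lattice_seq P ->
     (bloch_norm mu (S_op g phi (f x) - \sum_(0 <= k < m) x' k (f x) *: y k)%R <= e%:E)%E) ->
   \sum_(x <- lattice_seq P) wt x * (N%:R * cmod (lat x.1 x.2 : C) * kernel_sup mu g phi N.+1%:R (lat x.1 x.2))
     <= e * \sum_(x <- lattice_seq P) wt x + Bn * K.
  move=> e0 he.
  have h1 x : x \in lattice_seq P -> N%:R * cmod (lat x.1 x.2 : C) * kernel_sup mu g phi N.+1%:R (lat x.1 x.2) <=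
      e + \sum_(k < m) cmod (x' k (f x)) * be k.
    move=> xr; set ze := lat x.1 x.2 : C.
    have hze : disk ze := disk_lat _ _.
    (* The factor |zeta| vanishes at the origin, where the claim is trivial; that point is restored
       at the end through [k0]. *)
    have [z0|z0] := eqVneq (cmod ze) 0.
      rewrite z0 mulr0 mul0r addr_ge0// sumr_ge0// => k _.
      by rewrite mulr_ge0 ?cmod_ge0 ?(hbe k).1.
    have p0 : 0 < N%:R * cmod ze.
      by rewrite mulr_gt0 ?ltr0n ?(leq_trans _ N2)// lt_neqAle eq_sym z0 cmod_ge0.
    rewrite mulrC -ler_pdivlMr//; apply: kernel_sup_le => z hz; rewrite ler_pdivlMr//.
    have hw := disk_phi hphi hz.
    have E1 : mu z * cmod (g z) / cmod (1 - conjc ze * phi z) `^ N.+1%:R * (N%:R * cmod ze) =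
       mu z * cmod (derive1 (S_op g phi (f x)) z).
      rewrite (S_op_derive hg hphi (hf x).1 hz) (derive1_isd (isd_test_fun N hze hw)).
      rewrite (cmodM _ (g z)) (cmodM _ (_ ^+ N.+1)) (cmodM N%:R) cmodJ cmod_nat cmodX cmodV powR_mulrn ?cmod_ge0// exprVn; ring.
    rewrite E1.
    have hyd k : isd (y k) z (derive1 (y k) z).
      by apply: isd_derive1 => //; apply: HD_holomorphic; case: (hy k).
    have hSd : isd (S_op g phi (f x)) z (derive1 (S_op g phi (f x)) z).
      by apply: isd_derive1 => //; apply: HD_holomorphic; exact: (S_op_HD hg hphi (hf x).1).
    have hE : derive1 (S_op g phi (f x) - \sum_(0 <= k < m) x' k (f x) *: y k) z =
       derive1 (S_op g phi (f x)) z - \sum_(k < m) x' k (f x) * derive1 (y k) z.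
      apply: derive1_isd.
      have hs : isd (fun w => \sum_(k < m) x' k (f x) * y k w) z (\sum_(k < m) x' k (f x) * derive1 (y k) z).
        by apply: hasd_sum => k _; apply: hasdMl; exact: hyd.
      apply: hasd_ext (hasdB hSd hs) => w; rewrite big_mkord.
      by rewrite (_ : (S_op g phi (f x) - _) w = S_op g phi (f x) w - (\sum_(k < m) x' k (f x) *: y k) w)// fct_sumE.
    have := bloch_norm_bound (he x xr) hz; rewrite hE => h2.
    have mz : 0 < mu z by exact: weight_gt0.
    rewrite -[derive1 (S_op _ _ _) z](subrK (\sum_(k < m) x' k (f x) * derive1 (y k) z)).
    apply: le_trans (ler_wpM2l (ltW mz) (cmodD _ _)) _; rewrite mulrDr; apply: lerD => //.
    apply: le_trans (ler_wpM2l (ltW mz) (cmod_sum _ _ _)) _; rewrite mulr_sumr; apply: ler_sum => k _.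
    rewrite cmodM mulrCA ler_wpM2l ?cmod_ge0//; apply: bloch_norm_bound hz.
    by rewrite (hbe k).2.
  apply: (@le_trans _ _ (\sum_(x <- lattice_seq P) wt x * (e + \sum_(k < m) cmod (x' k (f x)) * be k))).
    by rewrite big_seq [leRHS]big_seq; apply: ler_sum => x xr; rewrite ler_wpM2l// h1.
  rewrite (eq_bigr (fun x => wt x * e + \sum_(k < m) be k * (wt x * cmod (x' k (f x))))); last first.
    by move=> x _; rewrite mulrDr mulr_sumr; congr (_ + _); apply: eq_bigr => k _; ring.
  rewrite big_split /= -mulr_suml [_ * e]mulrC lerD2l exchange_big /=.
  apply: le_trans (ler_wpM2r (ltW K0) (hBn m)); rewrite mulr_suml; apply: ler_sum => k _.
  rewrite -mulr_sumr -mulrA mulrCA ler_wpM2l ?(hbe k).1//.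
  exact: (dual_sum_bound hnu (hx' k) (hal k).2 K0 wt0 hf (FR P)).
have main P : \sum_(x <- lattice_seq P) wt x * (N%:R * cmod (lat x.1 x.2 : C) *
    kernel_sup mu g phi N.+1%:R (lat x.1 x.2)) <= 1 + Bn * K.
  set W := \sum_(x <- lattice_seq P) wt x.
  have W0 : 0 <= W by apply: sumr_ge0.
  have W1 : 0 < W + 1 by rewrite ltr_wpDl.
  (* The truncation error gets multiplied by the total weight W; this choice keeps the product below
     1. *)
  pose e := (W + 1)^-1; have e0 : 0 < e by rewrite invr_gt0.
  have [x xr|m hm] := @eventually_all _ (lattice_seq P) (fun x m =>
     (bloch_norm mu (S_op g phi (f x) - \sum_(0 <= k < m) x' k (f x) *: y k)%R <= e%:E)%E).
    have := hcv (f x) (hf x) => /fine_cvgP [[M1 _ hfin]].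
    move=> /cvgrPdist_le /(_ _ e0) [M2 _ hM2]; exists (maxn M1 M2) => n; rewrite geq_max => /andP[n1 n2].
    have := hM2 n n2; rewrite /= sub0r normrN => /(le_trans (ler_norm _)).
    by rewrite -lee_fin fineK//; exact: hfin.
  apply: le_trans (key P m e (ltW e0) (hm m (leqnn m))) _; rewrite lerD2r -/W /e mulrC.
  by rewrite ler_pdivrMr// mul1r lerDl.
pose k0 := kernel_sup mu g phi N.+1%:R 0.
have kge x : 0 <= kernel_sup mu g phi N.+1%:R (lat x.1 x.2).
  by apply: (kernel_sup_ge0 hmu hcm hg hphi) => //; exact: disk_lat.
have k00 : 0 <= k0 by apply: (kernel_sup_ge0 hmu hcm hg hphi) => //; exact: disk0.
exists (level_weight nu N%:R 0 * k0 + 2 * (1 + Bn * K)) => P.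
rewrite -[X in level_weight nu (X - 1)]natr1 addrK.
have E : \sum_(n < P) level_weight nu N%:R n * \sum_(j < 2 ^ n) kernel_sup mu g phi N.+1%:R (lat n j) =
   \sum_(x <- lattice_seq P) wt x * kernel_sup mu g phi N.+1%:R (lat x.1 x.2).
  rewrite (sum_lattice_seq P (fun n j => wt (n, j) * kernel_sup mu g phi N.+1%:R (lat n j))).
  by apply: eq_bigr => n _; rewrite mulr_sumr.
rewrite E.
(* Level 0 consists of the origin alone; on the other levels N |zeta| >= 1/2, which the factor 2
   undoes. *)
apply: (@le_trans _ _ (\sum_(x <- lattice_seq P) ((if x.1 == 0%N then wt x * k0 else 0) +
   2 * (wt x * (N%:R * cmod (lat x.1 x.2 : C) * kernel_sup mu g phi N.+1%:R (lat x.1 x.2)))))).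
  apply: ler_sum => -[[|n] j] _ /=.
    by rewrite /lat rn0 !mul0r cmod0 mulr0 mul0r mulr0 mulr0 addr0.
  rewrite add0r cmod_lat mulrCA ler_wpM2l//.
  have h2 := rn_geV2 (R := R) n; have kk := kge (n.+1, j); rewrite /= in kk.
  have N1 : 1 <= N%:R :> R by rewrite ler1n (leq_trans _ N2).
  rewrite mulrA ler_peMl//; have : (2^-1 : R) <= N%:R * rn n.+1 by apply: le_trans h2 _; rewrite ler_peMl ?rn_ge0.
  lra.
rewrite big_split /= -mulr_sumr; apply: lerD; last by rewrite ler_wpM2l.
rewrite (sum_lattice_seq P (fun n j => if n == 0%N then wt (n, j) * k0 else 0)).
case: P {E} => [|P].
  by rewrite big_ord0 mulr_ge0// level_weight_ge0.
rewrite big_ord_recl [X in _ + X]big1; last by move=> n _; rewrite big1.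
by rewrite addr0 expn0 big_ord1.
Qed.

End Main.

End NuclearImpliesLattice.

(** * Changing the exponent in the lattice condition *)

Section LatticeExponents.
Context {R : realType}.
Local Notation C := (cplx R).
Implicit Types (z w : C).

Lemma conj_den (a w : C) : cmod (1 - conjc a * w) = cmod (1 - conjc w * a).
Proof. by rewrite -cmodJ conjcB conjcM conjcK mulrC /= oppr0. Qed.

(** The level is read off from |w| and the index from [rt_near]: the angle contributes 8 / 2^m and
    the radius less than 1 / 2^m. *)
Lemma near_lattice w : disk w -> exists m i, [/\ (i < 2 ^ m)%N, rn m <= cmod w, cmod w < rn m.+1 &
  cmod (w - lat m i) <= 9 / 2 ^+ m].
Proof.
move=> hw; have [m m1 m2] := rn_level hw; exists m.
have h0 := half_pow_ge0 (R := R) m; have hs := rn_step (R := R) m; have hh := half_powS (R := R) m.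
have [w0|w0] := eqVneq w 0.
  exists 0%N; rewrite expn_gt0; split=> //.
  have -> : lat m 0 = (rn m)%:C :> C by rewrite /lat expr0 mulr1.
  rewrite w0 sub0r cmodN cmod_rn; move: m1; rewrite w0 cmod0; lra.
have cw : cmod w != 0 by rewrite cmod_eq0.
have u1 : cmod (w / (cmod w)%:C) = 1.
  by rewrite cmodf cmod_real ger0_norm ?cmod_ge0// divff.
have [i im hi] := rt_near m u1; exists i; split=> //.
have wC : (cmod w)%:C != 0 :> C by rewrite -cmod_gt0 cmod_real normr_gt0.
rewrite (_ : w - lat m i = (cmod w - rn m)%:C * (w / (cmod w)%:C) + (rn m)%:C * (w / (cmod w)%:C - rt m ^+ i)); last first.
  rewrite (rmorphB (real_complex R) (cmod w) (rn m)) /lat mulrBl mulrBr addrA subrK.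
  by rewrite [_%:C * (w / _)]mulrC divfK.
set u := w / _ in u1 hi *; clearbody u; apply: le_trans (cmodD _ _) _; rewrite !cmodM u1 mulr1 cmod_rn cmod_real ger0_norm ?subr_ge0//.
have : rn m * cmod (u - rt m ^+ i) <= 8 / 2 ^+ m.
  by apply: le_trans hi; rewrite ler_piMl ?cmod_ge0// ltW// rn_lt1.
lra.
Qed.

Section Main.
Variables (nu mu : C -> R) (g phi : C -> C) (b c cm : R).
Hypotheses (hnu : radial_weight nu) (hb : incr_exponent nu b) (hc : decr_exponent nu c).
Hypotheses (hmu : radial_weight mu) (hcm : decr_exponent mu cm).
Hypotheses (hg : Bloch0 mu g) (hphi : analytic_self_map phi).

Local Notation ks := (kernel_sup mu g phi).
Local Notation cond := (lattice_condition nu mu g phi).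

Lemma two_neq0 : (2 : R) == 0 = false.
Proof. by rewrite pnatr_eq0. Qed.

(** At level n one has |1 - conj(zeta) w| >= 2^-n, so raising the exponent by s' - s costs at most
    2^(n (s' - s)), which is what the level weight gains. *)
Lemma lattice_condition_up (s s' : R) : 0 <= s -> s <= s' -> cond s -> cond s'.
Proof.
move=> s0 ss [B hB]; exists B => P; apply: le_trans (hB P); apply: ler_sum => n _.
have d0 : 0 <= s' - s by rewrite subr_ge0.
have lw : level_weight nu (s' - 1) n = level_weight nu (s - 1) n * (2 `^ (s' - s)) ^- n.
  rewrite /level_weight (_ : s' - 1 = (s - 1) + (s' - s)); last by ring.
  by rewrite powRD ?two_neq0 ?implybT// exprMn invfM mulrAC.
rewrite lw -mulrA ler_wpM2l ?level_weight_ge0// mulr_sumr; apply: ler_sum => j _.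
have u0 : 0 < (2 `^ (s' - s)) ^+ n :> R by rewrite exprn_gt0// powR_gt0.
rewrite mulrC ler_pdivrMr//; apply: kernel_sup_le => z hz.
have hd := disk_lat (R := R) n j; have hw := disk_phi hphi hz.
apply: le_trans (ler_wpM2r (ltW u0) (kernel_sup_ub hmu hcm hg hphi s0 hd hz)).
have x0 := den_gt0 hd hw; set x := cmod _ in x0 *.
have E : x `^ s' = x `^ s * x `^ (s' - s) by rewrite -powRD ?(gt_eqF x0) ?implybT// subrKC.
rewrite E invfM mulrA ler_wpM2l ?divr_ge0 ?powR_ge0 ?mulr_ge0 ?cmod_ge0//; first by rewrite ltW// weight_gt0.
have : 2 ^- n <= x.
  by apply: le_trans (den_ge hd hw); rewrite cmod_lat /rn subKr.
by move=> /(powR_anti (half_pow_gt0 n)) /(_ d0); rewrite powR_half_pow invrK.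
Qed.

(** At a nearly maximising z, the point phi(z) is replaced by a lattice point y close to it. The
    s-th powers are comparable, and mu(z) |g(z)| is at most K_s'(y) |1 - conj(y) phi(z)|^s', where
    the last modulus is of order 2^-m. *)
Lemma kernel_sup_lattice (s s' e : R) zeta : 0 <= s -> 0 <= s' -> 0 < e -> disk zeta ->
  exists y : nat * nat, (y.2 < 2 ^ y.1)%N /\ ks s zeta <= e + (19 `^ s * 11 `^ s') *
    ((2 `^ s') ^- y.1 * ks s' (lat y.1 y.2)) * (cmod (1 - conjc zeta * lat y.1 y.2) `^ s)^-1.
Proof.
move=> s0 s0' e0 hze.
have [v [z hz <-]] := sup_adherent e0 (has_sup_kernel hmu hcm hg hphi s0 hze).
rewrite -/(ks s zeta) ltrBlDr => hv.
have hw := disk_phi hphi hz; have [m [i [im m1 m2 hi]]] := near_lattice hw.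
exists (m, i); split=> //=; apply: le_trans (ltW hv) _; rewrite addrC lerD2l.
set w := phi z in hw m1 m2 hi *; have hl := disk_lat (R := R) m i.
have h0 := half_pow_gt0 (R := R) m; have hh := half_powS (R := R) m.
(* 19 = 1 + 18, since 9 / 2^m <= 18 (1 - |w|) by |w| < [rn m.+1]; in [d2], 11 = 2 + 9 by 1 - r_m^2
   <= 2 * 2^-m. *)
have d1 : cmod (1 - conjc zeta * lat m i) <= 19 * cmod (1 - conjc zeta * w).
  rewrite conj_den (conj_den zeta w) (_ : 19 = 1 + 18) -?natrD//.
  apply: comparable_denominators (ltW hze) => //.
  by apply: le_trans hi _; move: m2; rewrite /rn; lra.
have d2 : cmod (1 - conjc (lat m i) * w) <= 11 * 2 ^- m.
  rewrite (_ : 1 - _ = (1 - conjc (lat m i) * lat m i) - conjc (lat m i) * (w - lat m i)); last by ring.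
  apply: le_trans (cmodB _ _) _; rewrite cmodM cmodJ cmod_lat mulrC mulcJ cmod_lat.
  have -> : 1 - (rn m ^+ 2)%:C = (1 - rn m ^+ 2)%:C :> C by rewrite rmorphB rmorph1.
  have [h3 h2] := one_sub_sqr (R := R) m.
  rewrite cmod_real ger0_norm; last by apply: le_trans h3; exact: ltW.
  have : rn m * cmod (w - lat m i) <= 9 / 2 ^+ m.
    by apply: le_trans hi; rewrite ler_piMl ?cmod_ge0// ltW// rn_lt1.
  lra.
have x1 := den_gt0 hze hw; have x2 := den_gt0 hze hl; have x3 := den_gt0 hl hw.
have mg0 : 0 <= mu z * cmod (g z) by rewrite mulr_ge0 ?cmod_ge0// ltW// weight_gt0.
have mg : mu z * cmod (g z) <= 11 `^ s' * ((2 `^ s') ^- m * ks s' (lat m i)).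
  have k0 : 0 <= ks s' (lat m i) by apply: (kernel_sup_ge0 hmu hcm hg hphi).
  have := kernel_sup_ub hmu hcm hg hphi s0' hl hz; rewrite -/w ler_pdivrMr ?powR_gt0//.
  move=> h; apply: le_trans h _; rewrite mulrC mulrA ler_wpM2r//.
  rewrite -powR_half_pow -powRM ?(ltW h0)//; apply: ge0_ler_powR => //; rewrite nnegrE ?(ltW x3) ?mulr_ge0 ?(ltW h0)//.
apply: (@le_trans _ _ (mu z * cmod (g z) * (19 `^ s / cmod (1 - conjc zeta * lat m i) `^ s))).
  rewrite ler_wpM2l// ler_pdivlMr ?powR_gt0// mulrC ler_pdivrMr ?powR_gt0//.
  rewrite -powRM ?(ltW x1)//; apply: ge0_ler_powR => //; rewrite nnegrE ?(ltW x2) ?mulr_ge0 ?(ltW x1)//.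
rewrite (_ : 19 `^ s * _ * _ / _ = 11 `^ s' * ((2 `^ s') ^- m * ks s' (lat m i)) *
  (19 `^ s / cmod (1 - conjc zeta * lat m i) `^ s)); last by ring.
by rewrite ler_wpM2r// divr_ge0 ?powR_ge0.
Qed.

(** The term found by [kernel_sup_lattice] is majorised by the sum over all y; after exchanging
    sums, [lattice_sum] with sg = s and tau = s - 1 is applied at z = y. Its hypothesis b + 1 < tau
    is the origin of b + 2 < s; the exponents s and s' may be in either order. *)
Lemma lattice_condition_down (s s' : R) : 2 <= s -> b + 2 < s -> 0 <= s' -> cond s' -> cond s.
Proof.
move=> s2 bs s0' [B hB]; have s0 : 0 <= s by apply: le_trans s2.
have bt : b + 1 < s - 1 by lra.
have ts : s - 1 <= s by rewrite gerBl.
have [K K0 hK] := lattice_sum hnu hb hc s2 ts bt.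
pose A : R := 19 `^ s * 11 `^ s'.
have A0 : 0 <= A by rewrite mulr_ge0 ?powR_ge0.
exists (1 + A * K * B) => P.
pose wt (x : nat * nat) := level_weight nu (s - 1) x.1.
have wt0 x : 0 <= wt x by exact: level_weight_ge0.
pose W := \sum_(x <- lattice_seq P) wt x; have W0 : 0 <= W by apply: sumr_ge0.
have W1 : 0 < W + 1 by rewrite ltr_wpDl.
pose e := (W + 1)^-1; have e0 : 0 < e by rewrite invr_gt0.
have /choice [q hq] := fun x : nat * nat => kernel_sup_lattice s0 s0' e0 (disk_lat (R := R) x.1 x.2).
(* [M] exceeds the level of every point selected for the finitely many x, so one finite list of y
   suffices. *)
pose M := (\max_(x <- lattice_seq P) (q x).1).+1.
pose T (x y : nat * nat) : R := A * ((2 `^ s') ^- y.1 * ks s' (lat y.1 y.2)) *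
   (cmod (1 - conjc (lat x.1 x.2) * lat y.1 y.2) `^ s)^-1.
have k0 (y : nat * nat) : 0 <= ks s' (lat y.1 y.2).
  by apply: (kernel_sup_ge0 hmu hcm hg hphi) => //; exact: disk_lat.
have p0 n : 0 <= (2 `^ s') ^- n :> R by rewrite invr_ge0 exprn_ge0// powR_ge0.
have T0 x y : 0 <= T x y.
  by rewrite /T mulr_ge0 ?invr_ge0 ?powR_ge0// mulr_ge0// mulr_ge0.
have hT x : x \in lattice_seq P -> ks s (lat x.1 x.2) <= e + \sum_(y <- lattice_seq M) T x y.
  move=> xr; have [q1 q2] := hq x; apply: le_trans q2 _; rewrite lerD2l -/(T x (q x)).
  have qr : q x \in lattice_seq M.
    apply/allpairsPdep; exists (q x).1, (q x).2; split; last by case: (q x).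
      rewrite mem_iota leq0n add0n ltnS.
      by apply: (@leq_bigmax_seq _ (lattice_seq P) xpredT (fun x => (q x).1)).
    by rewrite mem_iota leq0n add0n.
  by rewrite (big_rem _ qr) /= lerDl sumr_ge0.
have E : \sum_(n < P) level_weight nu (s - 1) n * \sum_(j < 2 ^ n) ks s (lat n j) =
   \sum_(x <- lattice_seq P) wt x * ks s (lat x.1 x.2).
  rewrite (sum_lattice_seq P (fun n j => wt (n, j) * ks s (lat n j))).
  by apply: eq_bigr => n _; rewrite mulr_sumr.
rewrite E; apply: (@le_trans _ _ (\sum_(x <- lattice_seq P) wt x * (e + \sum_(y <- lattice_seq M) T x y))).
  by rewrite big_seq [leRHS]big_seq; apply: ler_sum => x xr; rewrite ler_wpM2l// hT.
under eq_bigr do rewrite mulrDr; rewrite big_split /= -mulr_suml -/W; apply: lerD.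
  by rewrite /e ler_pdivrMr// mul1r lerDl.
under eq_bigr do rewrite mulr_sumr.
rewrite exchange_big /=.
apply: (@le_trans _ _ (\sum_(y <- lattice_seq M) A * K * (level_weight nu (s' - 1) y.1 * ks s' (lat y.1 y.2)))).
  apply: ler_sum => y _.
  have hr : rn y.1 < rn y.1.+1 :> R by rewrite -subr_gt0 rn_step half_pow_gt0.
  have := hK P y.1 (lat y.1 y.2); rewrite cmod_lat => /(_ (lexx _) hr).
  rewrite (_ : s - (s - 1) = 1); last by ring.
  rewrite powRr1// => h.
  have E2 : \sum_(x <- lattice_seq P) wt x * T x y = A * ((2 `^ s') ^- y.1 * ks s' (lat y.1 y.2)) *
    \sum_(n < P) level_weight nu (s - 1) n * \sum_(j < 2 ^ n) (cmod (1 - conjc (lat n j) * lat y.1 y.2) `^ s)^-1.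
    rewrite (sum_lattice_seq P (fun n j => wt (n, j) * T (n, j) y)) mulr_sumr; apply: eq_bigr => n _.
    by rewrite !mulr_sumr; apply: eq_bigr => j _; rewrite /T /wt /=; ring.
  rewrite E2; apply: le_trans (ler_wpM2l _ h) _; first by rewrite mulr_ge0// mulr_ge0.
  rewrite /level_weight (_ : s' = (s' - 1) + 1); last by ring.
  rewrite [2 `^ (s' - 1 + 1)]powRD ?two_neq0 ?implybT// powRr1// addrK exprMn invfM.
  rewrite le_eqVlt; apply/orP; left; apply/eqP; field; rewrite ?expf_neq0//.
  by rewrite gt_eqF ?nuv_gt0// gt_eqF// powR_gt0.
rewrite -mulr_sumr ler_wpM2l ?mulr_ge0 ?(ltW K0)//.
rewrite (sum_lattice_seq M (fun n j => level_weight nu (s' - 1) n * ks s' (lat n j))).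
by apply: le_trans (hB M); rewrite le_eqVlt; apply/orP; left; apply/eqP; apply: eq_bigr => n _; rewrite mulr_sumr.
Qed.

End Main.

End LatticeExponents.

(** * Nuclear representation *)

Section UnorderedSums.
Context {R : realType}.
Local Notation C := (cplx R).

Lemma sub_sum_le (I : eqType) (J E : seq I) (be : I -> R) : (forall i, 0 <= be i) ->
  uniq J -> {subset J <= E} -> \sum_(i <- J) be i <= \sum_(i <- E) be i.
Proof.
move=> be0; elim: J E => [|x J IH] E /=; first by rewrite big_nil sumr_ge0.
move=> /andP[xJ uJ] sJ; have xE : x \in E by apply: sJ; rewrite mem_head.
rewrite big_cons (big_rem _ xE) /= lerD2l; apply: IH => // y yJ.
have yx : y != x by apply: contraNneq xJ => <-.
have : y \in E by apply: sJ; rewrite in_cons yJ orbT.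
by rewrite (perm_mem (perm_to_rem xE)) in_cons (negbTE yx).
Qed.

Lemma cmod_sum_diff (I : eqType) (J E : seq I) (a : I -> C) (be : I -> R) :
  (forall i, cmod (a i) <= be i) -> uniq J -> uniq E -> {subset J <= E} ->
  cmod (\sum_(i <- E) a i - \sum_(i <- J) a i) <= \sum_(i <- E) be i - \sum_(i <- J) be i.
Proof.
move=> ab; elim: J E => [|x J IH] E /=.
  by rewrite !big_nil !subr0 => _ _ _; apply: le_trans (cmod_sum _ _ _) _; exact: ler_sum.
move=> /andP[xJ uJ] uE sJ; have xE : x \in E by apply: sJ; rewrite mem_head.
have e1 (V : zmodType) (f : I -> V) :
    \sum_(i <- E) f i - \sum_(i <- x :: J) f i = \sum_(i <- rem x E) f i - \sum_(i <- J) f i.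
  by rewrite big_cons (big_rem x xE) /= opprD addrACA subrr add0r.
rewrite !e1; apply: IH => //; first exact: rem_uniq.
move=> y yJ; have yx : y != x by apply: contraNneq xJ => <-.
have : y \in E by apply: sJ; rewrite in_cons yJ orbT.
by rewrite (perm_mem (perm_to_rem xE)) in_cons (negbTE yx).
Qed.

Variable I : countType.

Definition enum_upto (m : nat) : seq I := pmap (@pickle_inv I) (iota 0 m).

(** Nuclearity asks for sequences while the atoms are indexed by quadruples; numbers that code no
    index receive the value 0. *)
Definition along (V : zmodType) (a : I -> V) (k : nat) : V :=
  if pickle_inv k is Some i then a i else 0.

Lemma sum_along (V : zmodType) (a : I -> V) m :
  \sum_(k < m) along a k = \sum_(i <- enum_upto m) a i.
Proof.
rewrite -(big_mkord xpredT (along a)) /index_iota subn0 /enum_upto.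
elim: (iota 0 m) => [|k s IH]; first by rewrite !big_nil.
by rewrite big_cons IH /along /=; case: (pickle_inv k) => [i|] /=; rewrite ?big_cons ?add0r.
Qed.

Lemma enum_upto_uniq m : uniq (enum_upto m).
Proof.
apply: (@pmap_uniq _ _ _ (@pickle I)); last exact: iota_uniq.
exact: pickle_invK.
Qed.

Lemma mem_enum_upto i m : (pickle i < m)%N -> i \in enum_upto m.
Proof.
move=> h; rewrite /enum_upto mem_pmap; apply/mapP; exists (pickle i); last by rewrite pickleK_inv.
by rewrite mem_iota.
Qed.

(* T is the unordered sum of the a i, so that its distance to a partial sum is
   controlled by the tail of the sum of the bounds. *)
Lemma unordered_tail (V : pred I) (be : I -> R) (B : R) : (forall i, 0 <= be i) ->
  (forall i, ~~ V i -> be i = 0) ->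
  (forall J, uniq J -> all V J -> \sum_(i <- J) be i <= B) ->
  exists2 tau : nat -> R, tau n @[n --> \oo] --> (0 : R) &
  forall (a : I -> C) (A : R) (T : C), 0 <= A -> (forall i, cmod (a i) <= A * be i) ->
    (forall J e, all V J -> 0 < e -> exists2 E, uniq E /\ all V E & {subset J <= E} /\
        cmod (\sum_(i <- E) a i - T) <= e) ->
    forall m, cmod (T - \sum_(k < m) along a k) <= A * tau m.
Proof.
move=> be0 beV hB.
have filt (W : zmodType) (f : I -> W) s : (forall i, ~~ V i -> f i = 0) ->
    \sum_(i <- s) f i = \sum_(i <- seq.filter V s) f i.
  move=> f0; rewrite big_filter [RHS]big_mkcond; apply: eq_bigr => i _.
  by case: ifPn => // /f0.
pose S : set R := [set \sum_(i <- J) be i | J in [set J | uniq J /\ all V J]].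
have hS : has_sup S.
  split; first by exists 0; exists [::] => //; rewrite big_nil.
  by exists B => _ [J [uJ vJ] <-]; exact: hB.
have inS m : S (\sum_(i <- seq.filter V (enum_upto m)) be i).
  by exists (seq.filter V (enum_upto m)) => //; split; [rewrite filter_uniq ?enum_upto_uniq|exact: filter_all].
(* [tau] depends on the majorant alone, not on [a] or [T]; this uniformity is what gives convergence
   in norm later. *)
exists (fun m => sup S - \sum_(i <- seq.filter V (enum_upto m)) be i).
  apply/cvgrPdist_le => e e0; have [_ [J [uJ vJ] <-] hJ] := sup_adherent e0 hS.
  have [M hM] : exists M, forall i, i \in J -> (pickle i < M)%N.
    elim: (J) => [|x s [M hM]]; first by exists 0%N.
    exists (maxn M (pickle x).+1) => i; rewrite in_cons => /orP[/eqP ->|/hM h].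
      by rewrite leq_max ltnSn orbT.
    by rewrite leq_max h.
  exists M => // m /= hm; rewrite sub0r normrN ger0_norm.
    have : \sum_(i <- J) be i <= \sum_(i <- seq.filter V (enum_upto m)) be i.
      apply: sub_sum_le => // i iJ; rewrite mem_filter (allP vJ)//=.
      by apply: mem_enum_upto; apply: leq_trans (hM i iJ) hm.
    lra.
  by rewrite subr_ge0; apply: sup_upper_bound (inS m).
move=> a A T A0 ha hT m.
have a0 i : ~~ V i -> a i = 0.
  by move=> /beV h; apply/eqP; rewrite -cmod_eq0 eq_le cmod_ge0 andbT; have := ha i; rewrite h mulr0.
apply/ler_addgt0Pr => e e0; rewrite sum_along (filt _ a)//.
set J := seq.filter V _; have uJ : uniq J by rewrite filter_uniq ?enum_upto_uniq.
have vJ : all V J by exact: filter_all.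
have [E [uE vE] [sJE hE]] := hT J e vJ e0.
rewrite -(subrKA (\sum_(i <- E) a i)); apply: le_trans (cmodD _ _) _.
rewrite addrC; apply: lerD; last by rewrite cmodC.
apply: le_trans (cmod_sum_diff ha uJ uE sJE) _.
rewrite -!mulr_sumr -mulrBr ler_wpM2l// lerB//.
by apply: sup_upper_bound => //; exists E.
Qed.

End UnorderedSums.

Section BoxSums.
Context {R : realType}.

Lemma uniq_pairs (T1 T2 : eqType) (s : seq T1) (t : T1 -> seq T2) : uniq s ->
  (forall x, uniq (t x)) -> uniq [seq (x, y) | x <- s, y <- t x].
Proof.
move=> us ut; apply: allpairs_uniq_dep => //= -[x1 y1] [x2 y2] _ _ /= [-> e].
by subst.
Qed.

(** Coordinates (n, q, i, t) of an atom: lattice level, depth of refinement of the dyadic mean,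
    node, and kind of atom. *)
Definition index4 := (nat * nat * nat * nat)%type.

Definition valid4 (x : index4) : bool :=
  let: (n, q, i, t) := x in (i < 2 ^ (n + q))%N && (t < 3)%N.

Definition box (M Q : nat) : seq index4 :=
  [seq (y, t) | y <- [seq (x, i) | x <- [seq (n, q) | n <- iota 0 M, q <- iota 0 Q],
     i <- iota 0 (2 ^ (x.1 + x.2))], t <- iota 0 3].

Lemma box_uniq M Q : uniq (box M Q).
Proof. by do 3!(apply: uniq_pairs => [|?]; rewrite ?iota_uniq//). Qed.

Lemma mem_box M Q (x : index4) : valid4 x -> (x.1.1.1 < M)%N -> (x.1.1.2 < Q)%N -> x \in box M Q.
Proof.
move: x => [[[n q] i] t] /= /andP[hi ht] hn hq.
apply/allpairsPdep; exists (n, q, i), t; split=> //; last by rewrite mem_iota.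
apply/allpairsPdep; exists (n, q), i; split=> //; last by rewrite mem_iota.
by apply/allpairsPdep; exists n, q; split=> //; rewrite mem_iota.
Qed.

Lemma bounded_index (J : seq index4) :
  exists M, forall x, x \in J -> (x.1.1.1 < M)%N && (x.1.1.2 < M)%N.
Proof.
elim: J => [|x s [M hM]]; first by exists 0%N.
exists (maxn M (maxn x.1.1.1 x.1.1.2).+1) => y; rewrite in_cons => /orP[/eqP ->|/hM /andP[h1 h2]].
  by apply/andP; split; rewrite leq_max; apply/orP; right; rewrite ltnS leq_max leqnn ?orbT.
by rewrite !leq_max h1 h2.
Qed.

Lemma box_valid M Q : all valid4 (box M Q).
Proof.
apply/allP => x /allpairsPdep [y [t [/allpairsPdep [z [i [_ hi ->]]] ht ->]]].
by move: z hi => [n q] /=; rewrite mem_iota /= add0n => ->; move: ht; rewrite mem_iota.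
Qed.

Lemma sum_box (V : nmodType) M Q (F : nat -> nat -> nat -> nat -> V) :
  \sum_(x <- box M Q) F x.1.1.1 x.1.1.2 x.1.2 x.2 =
  \sum_(n < M) \sum_(q < Q) \sum_(i < 2 ^ (n + q)) \sum_(t < 3) F n q i t.
Proof.
have io (W : nmodType) k (f : nat -> W) : \sum_(i <- iota 0 k) f i = \sum_(i < k) f i.
  by rewrite -[k in iota 0 k]subn0 -/(index_iota 0 k) big_mkord.
rewrite /box big_allpairs_dep /= big_allpairs_dep /= big_allpairs_dep /= io.
by apply: eq_bigr => n _; rewrite io; apply: eq_bigr => q _; rewrite io; apply: eq_bigr => i _; rewrite (io V 3%N).
Qed.

(** Used with k = 2^q: the nodes at depth q fall into blocks of 2^q, one block for each lattice
    point of level n. *)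
Lemma sum_blocks (V : nmodType) m k (F : nat -> V) : (0 < k)%N ->
  \sum_(i < m * k) F (i %/ k)%N = \sum_(j < m) F j *+ k.
Proof.
move=> k0; elim: m => [|m IH]; first by rewrite mul0n !big_ord0.
rewrite mulSn addnC big_split_ord /= IH big_ord_recr /=; congr (_ + _).
rewrite (eq_bigr (fun=> F m)) ?sumr_const ?card_ord// => i _.
by rewrite divnMDl// divn_small ?addn0.
Qed.

Lemma sum_even_odd (V : nmodType) m (F : nat -> V) :
  \sum_(j < m.*2) F j = \sum_(i < m) (F i.*2 + F i.*2.+1).
Proof.
elim: m => [|m IH]; first by rewrite !big_ord0.
by rewrite doubleS !big_ord_recr /= IH addrA.
Qed.

End BoxSums.

(** * Atoms: point evaluations of f' paired with kernels *)

Section LatticeImpliesNuclear.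
Context {R : realType}.
Local Notation C := (cplx R).
Implicit Types (f h : C -> C) (z w a : C).

Lemma rt_dist p i k : cmod (rt p ^+ (i + k) - rt p ^+ i : C) <= k%:R * (8 / 2 ^+ p) :> R.
Proof.
rewrite exprD -{2}[rt p ^+ i]mulr1 -mulrBr cmodM cmod_rtX mul1r /rt -expiMn -expi0.
apply: le_trans (expi_lip _ _) _; rewrite subr0 ger0_norm; last first.
  by rewrite mulrn_wge0// divr_ge0 ?exprn_ge0// mulrn_wge0// pi_ge0.
rewrite -[leLHS]mulr_natl ler_wpM2l// ler_pM2r ?invr_gt0 ?exprn_gt0//.
by have := @pi_lt4 R; lra.
Qed.

Lemma rt_parent n q i : cmod (rt (n + q) ^+ i - rt n ^+ (i %/ 2 ^ q) : C) <= 8 / 2 ^+ n :> R.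
Proof.
rewrite -(rt_exp n q) {1}(divn_eq i (2 ^ q)) [(i %/ _ * _)%N]mulnC.
apply: le_trans (rt_dist _ _ _) _; set m := (i %% _)%N.
rewrite (_ : m%:R * _ = 8 / 2 ^+ n * (m%:R / 2 ^+ q)); last by rewrite exprD; field; rewrite !expf_neq0.
rewrite ler_piMr//.
rewrite ler_pdivrMr ?exprn_gt0// mul1r -natrX ler_nat ltnW//.
by rewrite ltn_mod expn_gt0.
Qed.

Lemma rt_even p i : rt p.+1 ^+ i.*2 = rt p ^+ i :> C.
Proof. by rewrite -muln2 mulnC exprM rtS. Qed.

Lemma rt_odd p i : cmod (rt p.+1 ^+ i.*2.+1 - rt p ^+ i : C) <= 8 / 2 ^+ p.+1 :> R.
Proof. by rewrite -(rt_even p i) -(addn1 i.*2); apply: le_trans (rt_dist _ _ _) _; rewrite mul1r. Qed.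

Lemma holomorphic_kern N n a : cmod a = rn n.+1 -> holomorphic (fun w => kern N n (w / a)).
Proof.
move=> ha; have a0 : 0 < cmod a by rewrite ha; apply: lt_le_trans (rn_geV2 n); rewrite invr_gt0.
have hP (r : R) : 0 <= r -> r <= rn n -> holomorphic (fun w => Phi N r (w / a)).
  move=> r0 rr w hw; have hu : isd (fun s => s / a) w (1 / a) by exact: hasdMr (hasd_io (fun x : C => x) w).
  have d0 : 1 - r%:C * (w / a) != 0.
    rewrite -cmod_gt0; have := cmod_subl 1 (r%:C * (w / a)); apply: lt_le_trans.
    rewrite cmod1 cmodM cmodf cmod_real ger0_norm// subr_gt0 mulrA ltr_pdivrMr// mul1r ha.
    apply: (@le_lt_trans _ _ r); first by rewrite ler_piMr//; exact: ltW.
    by apply: le_lt_trans rr _; rewrite -subr_gt0 rn_step half_pow_gt0.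
  have hd : isd (fun s => 1 - r%:C * (s / a)) w (0 - r%:C * (1 / a)).
    exact: hasdB (hasd_cst (fun x : C => x) 1 w) (hasdMl r%:C hu).
  have hl (l : 'I_N) : isd (fun s => (s / a * (1 - r)%:C) ^+ l * (1 - r%:C * (s / a))^-1 ^+ l.+1) w _ :=
    hasdM (hasdX l (hasdMr (1 - r)%:C hu)) (hasdX l.+1 (hasdV (f := fun s : C => 1 - r%:C * (s / a)) d0 hd)).
  by eexists; exact: (hasd_sum (index_enum 'I_N) (P := xpredT) (fun l _ => hl l)).
case: n ha hP => [|n] ha hP w hw; first exact: hP (rn_ge0 0) (lexx _) _ hw.
have [d hd] := hP _ (rn_ge0 n.+1) (lexx _) _ hw.
have [e he] := hP _ (rn_ge0 n) (rn_homo (leqnSn n)) _ hw.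
by exists (d - e); exact: hasdB hd he.
Qed.

Section Main.
Variables (nu mu : C -> R) (g phi : C -> C) (b cm : R) (N : nat).
Hypotheses (hnu : radial_weight nu) (hb : incr_exponent nu b).
Hypotheses (hmu : radial_weight mu) (hcm : decr_exponent mu cm).
Hypotheses (hg : Bloch0 mu g) (hphi : analytic_self_map phi) (N0 : (0 < N)%N).

Local Notation ks := (kernel_sup mu g phi N.+1%:R).
Local Notation nuv n := (nu (rn n)%:C).

(** The nodes of level n sit one radius further out than its lattice points, on the circle where
    [level_rep_lim] holds. *)
Definition node (n p i : nat) : C := (rn n.+1)%:C * rt p ^+ i.

Lemma cmod_node n p i : cmod (node n p i) = rn n.+1.
Proof. by rewrite cmodM cmod_rn cmod_rtX mulr1. Qed.

(* One term F(a') k(a') - F(a) k(a) of a difference of two consecutive dyadic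
   means is split as F(a') (k(a') - k(a)) + (F(a') - F(a)) k(a); these are the
   atoms with t = 0 and t = 1.  The atoms with t = 2 make up the first mean. *)
Definition atom_val (x : index4) (f : C -> C) : C :=
  let: (n, q, i, t) := x in
  let u := derive1 f (node n (n + q) i) in
  let v := derive1 f (node n (n + q).+1 i.*2.+1) in
  if ~~ valid4 x then 0 else
  if t == 0%N then v else if t == 1%N then v - u else if q == 0%N then u else 0.

Definition atom_kern (x : index4) (w : C) : C :=
  let: (n, q, i, t) := x in
  let k := kern N n (w / node n (n + q) i) in
  let l := kern N n (w / node n (n + q).+1 i.*2.+1) in
  if t == 0%N then (2 ^- (n + q).+1)%:C * (l - k) else
  if t == 1%N then (2 ^- (n + q).+1)%:C * k else
  if q == 0%N then (2 ^- n)%:C * k else 0.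

(** Doubling the number of roots keeps the old nodes as the even ones, so mean p + 1 minus mean p is
    the sum of 2^-(p+1) times odd node minus preceding even node. With the first mean, the stages p
    = n, ..., n + Q telescope. *)
Lemma sum_atoms f w n Q :
  \sum_(q < Q.+1) \sum_(i < 2 ^ (n + q)) \sum_(t < 3)
     atom_val (n, q : nat, i : nat, t : nat) f * atom_kern (n, q : nat, i : nat, t : nat) w =
  mean (n + Q.+1) (fun z => derive1 f ((rn n.+1)%:C * z) * kern N n (w / ((rn n.+1)%:C * z))).
Proof.
set psi := fun z => _ * _.
have alg (u v k l c e : C) (B : bool) : v * (c * (l - k)) + ((v - u) * (c * k) +
    ((if B then u else 0) * (if B then e * k else 0) + 0)) =
    c * (v * l - u * k) + (if B then e * (u * k) else 0) by case: B; ring.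
have tE q i : (i < 2 ^ (n + q))%N -> \sum_(t < 3) atom_val (n, q, i, t : nat) f * atom_kern (n, q, i, t : nat) w =
    (2 ^- (n + q).+1)%:C * (psi (rt (n + q).+1 ^+ i.*2.+1) - psi (rt (n + q) ^+ i)) +
    (if q == 0%N then (2 ^- n)%:C * psi (rt (n + q) ^+ i) else 0).
  move=> hi; rewrite 3!big_ord_recl big_ord0 /atom_val /atom_kern /= hi /= /psi /node.
  exact: alg.
have mS p : mean p.+1 psi = mean p psi +
    \sum_(i < 2 ^ p) (2 ^- p.+1)%:C * (psi (rt p.+1 ^+ i.*2.+1) - psi (rt p ^+ i)).
  have hp : (2 ^- p)%:C = (2 ^- p.+1)%:C * 2 :> C.
    rewrite -(rmorph_nat (real_complex R) 2) -(rmorphM (real_complex R)) half_powS.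
    by rewrite divfK// pnatr_eq0.
  rewrite /mean expnS mul2n (sum_even_odd _ (fun j => psi (rt p.+1 ^+ j))) -mulr_sumr hp -mulrA -mulrDr.
  congr (_ * _); rewrite mulr_sumr -big_split /=; apply: eq_bigr => i _.
  by rewrite (rt_even p i); move: (psi _) (psi _) => x y; ring.
elim: Q => [|Q IH].
  rewrite big_ord1 (eq_bigr _ (fun (i : 'I_(2 ^ (n + 0))) _ => tE 0%N i (ltn_ord i))) /=.
  by rewrite big_split /= -[X in _ + X]mulr_sumr addn1 mS addn0 [RHS]addrC.
rewrite big_ord_recr /= IH (addnS n Q.+1) mS; congr (_ + _).
by rewrite (eq_bigr _ (fun (i : 'I_(2 ^ (n + Q.+1))) _ => tE Q.+1 i (ltn_ord i))); apply: eq_bigr => i _; rewrite /= addr0.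
Qed.

(** Share of the decay in q carried by the functional: paired nodes are at most 8 / 2^(n+q+1) apart,
    and the Lipschitz bound of f' is 2^n times its size bound, which gives 4 * 2^-q for t = 1. *)
Definition atom_scale (q t : nat) : R := if t == 1%N then 4 * 2 ^- q else 1.

Lemma atom_scale_gt0 q t : 0 < atom_scale q t.
Proof. by rewrite /atom_scale; case: ifP => // _; rewrite mulr_gt0// half_pow_gt0. Qed.

Lemma atom_val_bound : exists2 K : R, 0 < K & forall n q i t f (A : R), holomorphic f ->
  (forall z, disk z -> nu z * cmod (f z) <= A) ->
  cmod (atom_val (n, q, i, t) f) <= K * 2 ^+ n / nuv n * atom_scale q t * A.
Proof.
have [K K0 hK] := derivative_growth hnu hb; exists K => // n q i t f A hf hA.
have [h1 h2] := hK f A n hf hA.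
have A0 : 0 <= A.
  by apply: le_trans (hA 0 disk0); rewrite mulr_ge0 ?cmod_ge0// ltW// weight_gt0//; exact: disk0.
have nn := nuv_gt0 hnu n.
have k0 : 0 <= K * 2 ^+ n / nuv n * atom_scale q t * A.
  by rewrite !mulr_ge0 ?invr_ge0 ?exprn_ge0// ltW// atom_scale_gt0.
rewrite /atom_val; case: ifP => _; first by rewrite cmod0.
case: t k0 => [|[|t]] /= k0.
- by rewrite mulr1; apply: h1; rewrite cmod_node.
- apply: le_trans (h2 _ _ _ _) _; rewrite ?cmod_node//.
  have -> : (4 : R) ^+ n = 2 ^+ n * 2 ^+ n by rewrite -exprMn -natrM.
  have -> : K * (2 ^+ n * 2 ^+ n) / nuv n * A * cmod (node n (n + q).+1 i.*2.+1 - node n (n + q) i) =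
     K * 2 ^+ n / nuv n * A * (2 ^+ n * cmod (node n (n + q).+1 i.*2.+1 - node n (n + q) i)) by ring.
  rewrite /atom_scale /= [leRHS]mulrAC ler_wpM2l//.
    by rewrite !mulr_ge0 ?invr_ge0 ?exprn_ge0// ltW.
  rewrite /node -mulrBr cmodM cmod_rn.
  apply: (@le_trans _ _ (2 ^+ n * (8 / 2 ^+ (n + q).+1))).
    rewrite ler_wpM2l ?exprn_ge0//; apply: le_trans (rt_odd (n + q) i).
    by rewrite ler_piMl ?cmod_ge0// ltW// rn_lt1.
  by rewrite exprS exprD le_eqVlt; apply/orP; left; apply/eqP; field; rewrite !expf_neq0.
- case: ifP k0 => _ k0; last by rewrite cmod0.
  by rewrite mulr1; apply: h1; rewrite cmod_node.
Qed.

Lemma holomorphic_atom_kern x : holomorphic (atom_kern x).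
Proof.
move: x => [[[n q] i] t] w hw.
have [d hd] := holomorphic_kern N (cmod_node n (n + q) i) hw.
have [e he] := holomorphic_kern N (cmod_node n (n + q).+1 i.*2.+1) hw.
case: t => [|[|t]]; first by eexists; exact: (hasdMl (2 ^- (n + q).+1)%:C (hasdB he hd)).
  by eexists; exact: (hasdMl (2 ^- (n + q).+1)%:C hd).
case: q hd {he} => [|q] hd; last by exists 0; exact: hasd_cst.
by eexists; exact: (hasdMl (2 ^- n)%:C hd).
Qed.

(** 12 bounds the distance from a node to its lattice point in units of 2^-n: 8 to the parent root
    and 4 to the next odd root. 24 is 3 from [rel_lip_kern], times 16 from [lam], times 1/2 from the
    weight of the mean. *)
Definition kern_scale : R := 24 * N.+1%:R * kern_const 12 N.

Lemma kern_const_ge0 : 0 <= kern_const 12 N :> R.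
Proof. by rewrite /kern_const !mulr_ge0// exprn_ge0// addr_ge0// mulr_ge0. Qed.

Lemma kern_scale_ge0 : 0 <= kern_scale.
Proof. by rewrite /kern_scale mulr_ge0// kern_const_ge0. Qed.

(** The weight of the mean contributes 2^-q. A second 2^-q comes from the kernel difference when t =
    0 and is left to [atom_scale] when t = 1; for t = 2 only q = 0 occurs. *)
Lemma atom_kern_bound n q i t w : disk w ->
  cmod (atom_kern (n, q, i, t) w) <= kern_scale * 2 ^- n * (2 ^- n) ^+ N * 4 ^- q / atom_scale q t /
    cmod (1 - conjc (lat n (i %/ 2 ^ q)) * w) ^+ N.+1.
Proof.
move=> hw; set j := (i %/ 2 ^ q)%N.
have c120 : 0 <= 12 :> R by [].
have hz : cmod (rt (n + q) ^+ i - rt n ^+ j : C) <= 12 * 2 ^- n.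
  by apply: le_trans (rt_parent n q i) _; rewrite ler_wpM2r ?half_pow_ge0// ler_nat.
have hz' : cmod (rt (n + q).+1 ^+ i.*2.+1 - rt n ^+ j : C) <= 12 * 2 ^- n.
  apply: le_trans (cmodB3 (rt (n + q) ^+ i) _ _) _.
  have := rt_odd (n + q) i; have := rt_parent n q i; rewrite -/j.
  have : 2 ^- (n + q).+1 <= 2 ^- n.+1 :> R by apply: half_pow_homo; rewrite ltnS leq_addr.
  rewrite (half_powS n); lra.
have D0 := lat_den_gt0 n j hw.
set D := cmod _ in D0 *.
have [h1 _ h3] := rel_lip_kern c120 hw N0 (cmod_rtX _ _) (cmod_rtX _ _) hz hz'.
rewrite -/D -/(node n (n + q) i) -/(node n (n + q).+1 i.*2.+1) in h1 h3.
have kc := kern_const_ge0; have ksc := kern_scale_ge0.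
have p0 m : 0 <= (2 ^- m : R) by exact: half_pow_ge0.
have p4 : (4 ^- q : R) = 2 ^- q * 2 ^- q by rewrite -invfM -exprMn -natrM.
have N1 : 1 <= N.+1%:R :> R by rewrite ler1n.
have DN : 0 <= D ^+ N.+1 by rewrite exprn_ge0// ltW.
have T0 : 0 <= (2 ^- n) ^+ N / D ^+ N.+1 :> R by rewrite divr_ge0// exprn_ge0.
have big : 0 <= kern_scale * 2 ^- n * (2 ^- n) ^+ N * 4 ^- q / atom_scale q t / D ^+ N.+1.
  rewrite divr_ge0// divr_ge0 ?(ltW (atom_scale_gt0 _ _))// mulr_ge0 ?invr_ge0 ?exprn_ge0//.
  by rewrite mulr_ge0 ?exprn_ge0// mulr_ge0.
have pE : 2 ^- (n + q).+1 = 2 ^- n * 2 ^- q / 2 :> R by rewrite half_powS exprD invfM.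
case: t big => [|[|t]] /= big; rewrite /atom_kern /=.
- rewrite cmodM cmod_half_pow pE invr1 mulr1 p4.
  have lam : 2 ^+ n.+2 * cmod (rt (n + q).+1 ^+ i.*2.+1 - rt (n + q) ^+ i : C) <= 16 * 2 ^- q.
    apply: le_trans (ler_wpM2l (exprn_ge0 _ (ler0n _ 2)) (rt_odd _ _)) _.
    rewrite !exprS exprD le_eqVlt; apply/orP; left; apply/eqP; field; by rewrite !expf_neq0.
  apply: le_trans (ler_wpM2l _ h3) _; first by rewrite divr_ge0// mulr_ge0.
  rewrite (_ : kern_scale * 2 ^- n * (2 ^- n) ^+ N * (2 ^- q * 2 ^- q) / D ^+ N.+1 =
    2 ^- n * 2 ^- q / 2 * (kern_const 12 N * (2 ^- n) ^+ N / D ^+ N.+1 * (3 * N.+1%:R * (16 * 2 ^- q)))); last first.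
    by rewrite /kern_scale; set X := (D ^+ _)^-1; field; rewrite ?expf_neq0.
  rewrite ler_wpM2l ?divr_ge0 ?mulr_ge0// ler_wpM2l//; first by rewrite -mulrA mulr_ge0.
  by rewrite ler_wpM2l// mulr_ge0.
- rewrite cmodM cmod_half_pow pE /atom_scale /= p4.
  apply: le_trans (ler_wpM2l _ h1) _; first by rewrite divr_ge0// mulr_ge0.
  rewrite (_ : _ * _ / _ / _ = 2 ^- n * 2 ^- q / 2 * (12 * N.+1%:R * (kern_const 12 N * (2 ^- n) ^+ N / D ^+ N.+1))); last first.
    rewrite /kern_scale; set X := (D ^+ _)^-1; field; by rewrite ?expf_neq0.
  rewrite ler_wpM2l ?divr_ge0 ?mulr_ge0// ler_peMl//; first by rewrite -mulrA mulr_ge0.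
  by lra.
- rewrite /atom_scale /= invr1 mulr1 in big *; case: ifP => [/eqP q0|_]; last by rewrite cmod0.
  rewrite q0 expr0 invr1 mulr1 cmodM cmod_half_pow.
  rewrite q0 in h1; apply: le_trans (ler_wpM2l (p0 n) h1) _.
  rewrite (_ : kern_scale * _ * _ / _ = 2 ^- n * (24 * N.+1%:R * (kern_const 12 N * (2 ^- n) ^+ N / D ^+ N.+1))); last first.
    by rewrite /kern_scale; ring.
  rewrite ler_wpM2l// ler_peMl//; first by rewrite -mulrA mulr_ge0.
  by lra.
Qed.

Definition atom_fun (x : index4) : C -> C :=
  patch (fun=> 0) disk (primitive0 (fun z => atom_kern x (phi z) * g z)).

Definition atom_majorant (K : R) (x : index4) : R :=
  let: (n, q, i, t) := x in
  if valid4 x then K * 4 ^- q * level_weight nu N%:R n * ks (lat n (i %/ 2 ^ q)) else 0.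

Lemma ks_ge0 n j : 0 <= ks (lat n j).
Proof. by apply: (kernel_sup_ge0 hmu hcm hg hphi) => //; exact: disk_lat. Qed.

Lemma atom_majorant_ge0 (K : R) x : 0 <= K -> 0 <= atom_majorant K x.
Proof.
move: x => [[[n q] i] t] K0; rewrite /atom_majorant; case: ifP => // _.
by rewrite mulr_ge0 ?ks_ge0// mulr_ge0 ?level_weight_ge0// mulr_ge0 ?invr_ge0 ?exprn_ge0.
Qed.

(** At depth q each lattice point has 2^q nodes and each atom carries 4^-q, so the sum over q is
    geometric and at most 2; the three kinds of atoms make it 6. *)
Lemma sum_majorant (K B : R) J : 0 <= K ->
  (forall P, \sum_(n < P) level_weight nu N%:R n * \sum_(j < 2 ^ n) ks (lat n j) <= B) ->
  uniq J -> all valid4 J -> \sum_(x <- J) atom_majorant K x <= 6 * K * B.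
Proof.
move=> K0 hB uJ vJ.
have [M hM] := bounded_index J.
apply: le_trans (sub_sum_le (E := box M M) _ uJ _) _.
- by move=> x; exact: atom_majorant_ge0.
- by move=> x xJ; have /andP[h1 h2] := hM x xJ; apply: mem_box => //; exact: (allP vJ).
rewrite (eq_bigr (fun x : index4 => atom_majorant K (x.1.1.1, x.1.1.2, x.1.2, x.2))); last by move=> [[[? ?] ?] ?].
rewrite (sum_box M M (fun n q i t => atom_majorant K (n, q, i, t))).
apply: (@le_trans _ _ (\sum_(n < M) 6 * K * (level_weight nu N%:R n * \sum_(j < 2 ^ n) ks (lat n j)))); last first.
  by rewrite -mulr_sumr ler_wpM2l ?mulr_ge0.
apply: ler_sum => n _; set L := level_weight _ _ _; set S := \sum_(j < 2 ^ n) _.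
have L0 : 0 <= L by exact: level_weight_ge0.
have S0 : 0 <= S by apply: sumr_ge0 => j _; exact: ks_ge0.
have E (q : 'I_M) : \sum_(i < 2 ^ (n + q)) \sum_(t < 3) atom_majorant K (n : nat, q : nat, i : nat, t : nat) =
    3 * K * (L * S) * 2^-1 ^+ q.
  have E1 (i : 'I_(2 ^ (n + q))) : \sum_(t < 3) atom_majorant K (n : nat, q : nat, i : nat, t : nat) =
      3 * (K * 4 ^- q * L) * ks (lat n (i %/ 2 ^ q)).
    rewrite 3!big_ord_recl big_ord0 /atom_majorant /= ltn_ord /= -/L; ring.
  rewrite (eq_bigr _ (fun i _ => E1 i)) -mulr_sumr expnD.
  rewrite (sum_blocks _ (fun j => ks (lat n j)))// ?expn_gt0// sumrMnl -/S.
  rewrite -[S *+ _]mulr_natl natrX (_ : (4 : R) ^+ q = 2 ^+ q * 2 ^+ q); last by rewrite -exprMn -natrM.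
  by rewrite exprVn; field; rewrite expf_neq0.
rewrite (eq_bigr _ (fun q _ => E q)) -mulr_sumr.
have h2 : (2^-1 : R) < 1 by rewrite invf_lt1// ltr1n.
have := geometric_sum_le M (_ : 0 <= 2^-1 :> R) h2; rewrite invr_ge0 ler0n => /(_ isT) h.
apply: (@le_trans _ _ (3 * K * (L * S) * 2)); last first.
  by rewrite le_eqVlt; apply/orP; left; apply/eqP; ring.
apply: ler_wpM2l; first by apply: mulr_ge0; apply: mulr_ge0.
apply: le_trans h _.
by rewrite (_ : 1 - 2^-1 = 2^-1 :> R) ?invrK//; field.
Qed.

Lemma atom_val_lin x (a : C) f h : HD f -> HD h ->
  atom_val x (a *: f + h) = a * atom_val x f + atom_val x h.
Proof.
move=> hf hh; move: x => [[[n q] i] t].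
have dn p j : disk (node n p j) by change (cmod (node n p j) < 1); rewrite cmod_node rn_lt1.
rewrite /atom_val !derive1_lin//; case: ifP => _; first by rewrite mulr0 addr0.
case: t => [|[|t]] //=; last by case: ifP => // _; rewrite mulr0 addr0.
move: (derive1 f _) (derive1 f _) (derive1 h _) (derive1 h _) => u v x y; ring.
Qed.

Lemma isd_atom_fun x z : disk z -> isd (atom_fun x) z (atom_kern x (phi z) * g z).
Proof. by move=> hz; apply: isd_primitive_patch (holomorphic_comp_mul hg hphi (holomorphic_atom_kern x)) hz. Qed.

Lemma atom_fun_0 x : atom_fun x 0 = 0.
Proof. exact: primitive_patch_0. Qed.

Lemma atom_fun_HD x : HD (atom_fun x).
Proof. exact/HD_primitive/(holomorphic_comp_mul hg hphi)/holomorphic_atom_kern. Qed.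

Definition atom_size (x : index4) : R :=
  let: (n, q, i, t) := x in
  kern_scale * 2 ^- n * (2 ^- n) ^+ N * 4 ^- q / atom_scale q t * ks (lat n (i %/ 2 ^ q)).

Lemma atom_fun_bound x z : disk z -> mu z * cmod (derive1 (atom_fun x) z) <= atom_size x.
Proof.
move=> hz; rewrite (derive1_isd (isd_atom_fun x hz)); move: x => [[[n q] i] t].
have hw := disk_phi hphi hz; have mz := weight_gt0 hmu hz.
rewrite cmodM mulrCA; apply: le_trans (ler_wpM2r _ (atom_kern_bound n q i t hw)) _.
  by rewrite mulr_ge0 ?cmod_ge0// ltW.
rewrite /atom_size -[leLHS]mulrA; apply: ler_wpM2l.
  rewrite divr_ge0 ?(ltW (atom_scale_gt0 _ _))// mulr_ge0 ?invr_ge0 ?exprn_ge0//.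
  by rewrite mulr_ge0 ?exprn_ge0 ?half_pow_ge0// mulr_ge0 ?half_pow_ge0// kern_scale_ge0.
have := kernel_sup_ub hmu hcm hg hphi (ler0n R N.+1) (disk_lat n (i %/ 2 ^ q)) hz.
by rewrite powR_mulrn ?cmod_ge0// mulrC.
Qed.

(** A single atom kernel is bounded on the disk, with a bound depending on the atom, so the decay at
    the boundary is inherited from mu |g|. *)
Lemma atom_fun_Bloch0 x : Bloch0 mu (atom_fun x).
Proof.
split; first exact: atom_fun_HD.
have [M M0 hM] : exists2 M : R, 0 <= M & forall w, disk w -> cmod (atom_kern x w) <= M.
  move: x => [[[n q] i] t]; set G := kern_scale * 2 ^- n * (2 ^- n) ^+ N * 4 ^- q / atom_scale q t.
  have G0 : 0 <= G.
    rewrite divr_ge0 ?(ltW (atom_scale_gt0 _ _))// mulr_ge0 ?invr_ge0 ?exprn_ge0//.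
    by rewrite mulr_ge0 ?exprn_ge0 ?half_pow_ge0// mulr_ge0 ?half_pow_ge0// kern_scale_ge0.
  exists (G / (2 ^- n) ^+ N.+1); first by rewrite divr_ge0// exprn_ge0// half_pow_ge0.
  move=> w hw; apply: le_trans (atom_kern_bound n q i t hw) _; rewrite -/G ler_wpM2l//.
  have := den_ge (disk_lat n (i %/ 2 ^ q)) hw; rewrite cmod_lat /rn subKr => h.
  rewrite lef_pV2 ?posrE ?exprn_gt0 ?half_pow_gt0 ?(lt_le_trans (half_pow_gt0 n) h)//.
  by apply: lerXn2r; rewrite ?nnegrE ?half_pow_ge0 ?cmod_ge0.
have M1 : 0 < M + 1 by rewrite ltr_wpDl.
move=> e e0; have [r r1 hr] := symbol_vanishes hmu hcm hg (divr_gt0 e0 M1).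
exists r => // z rz z1; have := hr z rz z1; rewrite ltr_pdivlMr//; apply: le_lt_trans.
rewrite (derive1_isd (isd_atom_fun x z1)) cmodM [cmod _ * cmod _]mulrC mulrA ler_wpM2l//.
  by rewrite mulr_ge0 ?cmod_ge0// ltW// weight_gt0.
by apply: le_trans (hM _ (disk_phi hphi z1)) _; rewrite lerDl.
Qed.

(* First the number M of levels, then the common depth Q of the dyadic means. *)
Lemma atoms_net f w J (e : R) : holomorphic f -> disk w -> all valid4 J -> 0 < e ->
  exists2 E, uniq E /\ all valid4 E & {subset J <= E} /\
    cmod (\sum_(x <- E) atom_val x f * atom_kern x w - derive1 f w) <= e.
Proof.
move=> hf hw vJ e0; have hf' := holomorphic_derive1 hf.
have [M hM] := bounded_index J.
have e2 : 0 < e / 2 by rewrite divr_gt0.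
have /climP /(_ _ e2) [n1 h1] := partial_rep_lim N0 hf' hw.
pose P := maxn M n1; have {}h1 := h1 P (leq_maxr _ _).
pose psi n z := derive1 f ((rn n.+1)%:C * z) * kern N n (w / ((rn n.+1)%:C * z)).
have /climP /(_ _ e2) [n2 h2] : clim (fun Q => \sum_(n < P.+1) mean (Q + n.+1) (psi n)) (partial_rep N (derive1 f) w P).
  rewrite -sum_level_rep; apply: clim_sum => n _.
  exact: (clim_shift n.+1 (level_rep_lim N n hf' hw)).
pose Q := maxn M n2; have {}h2 := h2 Q (leq_maxr _ _).
exists (box P.+1 Q.+1); first by split; [exact: box_uniq|exact: box_valid].
split.
  move=> x xJ; have /andP[a1 a2] := hM x xJ; apply: mem_box; first exact: (allP vJ).
    by apply: (leq_trans a1); rewrite leqW// leq_maxl.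
  by apply: (leq_trans a2); rewrite leqW// leq_maxl.
rewrite (eq_bigr (fun x : index4 => atom_val (x.1.1.1, x.1.1.2, x.1.2, x.2) f *
   atom_kern (x.1.1.1, x.1.1.2, x.1.2, x.2) w)); last by move=> [[[? ?] ?] ?].
rewrite (sum_box P.+1 Q.+1 (fun n q i t => atom_val (n, q, i, t) f * atom_kern (n, q, i, t) w)).
rewrite (eq_bigr (fun n : 'I_P.+1 => mean (Q + n.+1) (psi n))); last first.
  by move=> n _; rewrite sum_atoms addnS addnC -addnS.
apply: le_trans (cmodB3 (partial_rep N (derive1 f) w P) _ _) _; lra.
Qed.

(** Atom values are the functionals and atom functions the vectors. The remainder bounds are uniform
    in z, hence hold in the Bloch norm; uniform approximation by finite combinations also puts S f
    in the little Bloch space. *)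
Lemma lattice_nuclear : lattice_condition nu mu g phi N.+1%:R ->
  nuclear (Hinf nu) (Bloch0 mu) (S_op g phi).
Proof.
move=> [B hB0].
have hB P : \sum_(n < P) level_weight nu N%:R n * \sum_(j < 2 ^ n) ks (lat n j) <= B.
  by apply: le_trans (hB0 P); rewrite -[X in _ <= \sum_(_ < _) level_weight _ (X - 1) _ * _]natr1 addrK.
have [K K0 hK] := atom_val_bound.
pose be := atom_majorant (K * kern_scale).
have KG : 0 <= K * kern_scale by rewrite mulr_ge0 ?kern_scale_ge0// ltW.
have be0 x : 0 <= be x by exact: atom_majorant_ge0.
have beV x : ~~ valid4 x -> be x = 0.
  by move: x => [[[n q] i] t] /negbTE h; rewrite /be /atom_majorant h.
have [tau tau0 htau] := unordered_tail be0 beV (fun J uJ vJ => sum_majorant KG hB uJ vJ).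
pose al (x : index4) : R := let: (n, q, i, t) := x in
  if valid4 x then K * 2 ^+ n / nuv n * atom_scale q t else 0.
have al0 x : 0 <= al x.
  move: x => [[[n q] i] t]; rewrite /al; case: ifP => // _.
  by rewrite mulr_ge0 ?(ltW (atom_scale_gt0 _ _))// divr_ge0 ?(ltW (nuv_gt0 hnu n))// mulr_ge0 ?exprn_ge0// ltW.
have hal x f A : holomorphic f -> (forall z, disk z -> nu z * cmod (f z) <= A) ->
    cmod (atom_val x f) <= al x * A.
  move: x => [[[n q] i] t] hf hA; have := hK n q i t f A hf hA; rewrite /al.
  case: ifP => h H; first exact: H.
  have -> : atom_val (n, q, i, t) f = 0 by rewrite /atom_val h.
  by rewrite cmod0 mul0r.
(* The scales of functional and function cancel, and 2^n / nu(r_n) times 2^-n 2^(-nN) is the level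
   weight of exponent N. *)
have alb x : al x * atom_size x = be x.
  move: x => [[[n q] i] t]; rewrite /al /be /atom_majorant; case: ifP => _; last by rewrite mul0r.
  rewrite /atom_size /level_weight powR_mulrn// -exprVn -exprVn -!exprM [(n * N)%N]mulnC !exprVn.
  by field; rewrite !expf_neq0// !gt_eqF// ?nuv_gt0// atom_scale_gt0.
have size0 x : 0 <= atom_size x.
  apply: le_trans (atom_fun_bound x disk0).
  by rewrite mulr_ge0 ?cmod_ge0// ltW// weight_gt0//; exact: disk0.
pose x' (k : nat) (f : C -> C) : C := along (fun x => atom_val x f) k.
pose y (k : nat) : C -> C := along atom_fun k.
have alE (V : zmodType) (u : index4 -> V) k x : pickle_inv k = Some x -> along u k = u x.
  by rewrite /along => ->.
have al0E (V : zmodType) (u : index4 -> V) k : pickle_inv k = None :> option index4 -> along u k = 0.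
  by rewrite /along => ->.
have y0 k : y k 0 = 0.
  rewrite /y; case E : (pickle_inv k : option index4) => [x|].
    by rewrite (alE _ _ _ _ E) atom_fun_0.
  by rewrite (al0E _ _ _ E).
have yB k : Bloch0 mu (y k).
  rewrite /y; case E : (pickle_inv k : option index4) => [x|].
    by rewrite (alE _ _ _ _ E); exact: atom_fun_Bloch0.
  rewrite (al0E _ _ _ E); split; first exact: HD0.
  move=> e e0; exists 0 => // z _ z1; rewrite (derive1_isd (hasd_cst (fun x : C => x) 0 z)).
  by rewrite cmod0 mulr0.
have yD k z : disk z -> derive1 (y k) z = along (fun x => atom_kern x (phi z) * g z) k.
  move=> hz; rewrite /y; case E : (pickle_inv k : option index4) => [x|].
    by rewrite !(alE _ _ _ _ E) (derive1_isd (isd_atom_fun x hz)).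
  by rewrite !(al0E _ _ _ E) (derive1_isd (hasd_cst (fun x : C => x) 0 z)).
have normP f : Hinf nu f -> exists2 A : R, 0 <= A & forall z, disk z -> nu z * cmod (f z) <= A.
  move=> [_ /(weighted_sup_fin hnu) [A A0 hA]]; exists A => //.
  by apply/weighted_sup_leP; rewrite hA.
have dn k : (dual_norm (Hinf nu) (x' k) <= (along al k)%:E)%E.
  apply: ge_ereal_sup => _ [f [[hf _] f1] <-]; rewrite lee_fin /x'.
  case E : (pickle_inv k : option index4) => [x|]; last by rewrite !(al0E _ _ _ E) cmod0.
  rewrite !(alE _ _ _ _ E) -[leRHS]mulr1; apply: hal; first exact: HD_holomorphic.
  exact/weighted_sup_leP.
have Hinf0 : Hinf nu 0 by apply: Hzero_sub_Hinf => //; exact: Hzero0.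
have dn0 k : (0 <= dual_norm (Hinf nu) (x' k))%E.
  apply: (@le_trans _ _ (cmod (x' k 0))%:E); first by rewrite lee_fin cmod_ge0.
  apply: ereal_sup_ubound; exists 0 => //; split=> //.
  apply/weighted_sup_leP => z _; rewrite (_ : (0 : C -> C) z = 0)//.
  by rewrite cmod0 mulr0.
have bn k : (bloch_norm mu (y k) <= (along atom_size k)%:E)%E.
  rewrite /bloch_norm y0 cmod0 add0e; apply/weighted_sup_leP => z hz; rewrite /y.
  case E : (pickle_inv k : option index4) => [x|].
    by rewrite !(alE _ _ _ _ E); exact: atom_fun_bound.
  by rewrite !(al0E _ _ _ E) (derive1_isd (hasd_cst (fun x : C => x) 0 z)) cmod0 mulr0.
have Dsum f m z : HD f -> disk z ->
    isd (S_op g phi f - \sum_(0 <= k < m) x' k f *: y k) z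
      (derive1 f (phi z) * g z - \sum_(k < m) along (fun x => atom_val x f * (atom_kern x (phi z) * g z)) k).
  move=> hf hz; have hS : isd (S_op g phi f) z (derive1 f (phi z) * g z).
    rewrite -(S_op_derive hg hphi hf hz); apply: isd_derive1 => //.
    exact/HD_holomorphic/(S_op_HD hg hphi).
  have hs : isd (fun w => \sum_(k < m) x' k f * y k w) z (\sum_(k < m) x' k f * derive1 (y k) z).
    apply: hasd_sum => k _; apply: hasdMl; apply: isd_derive1 => //.
    by apply: HD_holomorphic; case: (yB k).
  have E : \sum_(k < m) x' k f * derive1 (y k) z =
      \sum_(k < m) along (fun x => atom_val x f * (atom_kern x (phi z) * g z)) k.
    apply: eq_bigr => k _; rewrite yD// /x'.
    case E : (pickle_inv k : option index4) => [x|]; last by rewrite !(al0E _ _ _ E) mul0r.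
    by rewrite !(alE _ _ _ _ E).
  rewrite -E; apply: hasd_ext (hasdB hS hs) => w; rewrite big_mkord.
  by rewrite (_ : (S_op g phi f - _) w = S_op g phi f w - (\sum_(k < m) x' k f *: y k) w)// fct_sumE.
have tail f A m z : holomorphic f -> 0 <= A -> (forall z, disk z -> nu z * cmod (f z) <= A) -> disk z ->
    mu z * cmod (derive1 f (phi z) * g z - \sum_(k < m) along (fun x => atom_val x f * (atom_kern x (phi z) * g z)) k)
      <= A * tau m.
  move=> hf A0 hA hz; have mz := weight_gt0 hmu hz; have hw := disk_phi hphi hz.
  have cm0 : cmod ((mu z)%:C : C) = mu z by rewrite cmod_real ger0_norm// ltW.
  rewrite -{1}cm0 -cmodM mulrBr.
  have -> : (mu z)%:C * (\sum_(k < m) along (fun x => atom_val x f * (atom_kern x (phi z) * g z)) k) =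
      \sum_(k < m) along (fun x => (mu z)%:C * (atom_val x f * (atom_kern x (phi z) * g z))) k.
    rewrite mulr_sumr; apply: eq_bigr => k _.
    case E : (pickle_inv k : option index4) => [x|]; last by rewrite !(al0E _ _ _ E) mulr0.
    by rewrite !(alE _ _ _ _ E).
  (* The family is mu(z) times value, kernel and g(z) at a fixed z; its majorant [A * be x] does not
     depend on z. *)
  apply: htau => //.
    move=> x; rewrite cmodM cm0 cmodM mulrCA -alb.
    rewrite (_ : A * (al x * atom_size x) = al x * A * atom_size x); last by ring.
    apply: ler_pM; rewrite ?cmod_ge0 ?mulr_ge0 ?cmod_ge0 ?(ltW mz)//; first exact: hal.
    by have := atom_fun_bound x hz; rewrite (derive1_isd (isd_atom_fun x hz)).
  (* The net for f' is requested with tolerance e / c, since it is multiplied by mu(z) |g(z)|; the +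
     1 keeps the divisor positive. *)
  move=> J e vJ e0; set c := mu z * cmod (g z) + 1.
  have c0 : 0 < c by rewrite ltr_wpDl// mulr_ge0 ?cmod_ge0// ltW.
  have [E hE1 [hE2 hE3]] := atoms_net hf hw vJ (divr_gt0 e0 c0).
  exists E => //; split=> //.
  rewrite (_ : \sum_(i <- E) _ - _ = (mu z)%:C * g z * (\sum_(x <- E) atom_val x f * atom_kern x (phi z) - derive1 f (phi z))); last first.
    rewrite mulrBr mulr_sumr; congr (_ - _); last by ring.
    by apply: eq_bigr => x _; ring.
  rewrite cmodM cmodM cm0; apply: le_trans (ler_wpM2l _ hE3) _.
    by rewrite mulr_ge0 ?cmod_ge0// ltW.
  by rewrite mulrA ler_pdivrMr// mulrC ler_wpM2l ?(ltW e0)// lerDl.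
have Sb f : Hinf nu f -> Bloch0 mu (S_op g phi f).
  move=> hfi; have [A A0 hA] := normP f hfi; have hf := hfi.1.
  split; first exact: (S_op_HD hg hphi).
  move=> e e0; have e2 : 0 < e / 2 by rewrite divr_gt0.
  have A1 : 0 < A + 1 by rewrite ltr_wpDl.
  have := tau0; move=> /cvgrPdist_lt /(_ _ (divr_gt0 e2 A1)) [m _ /(_ m (leqnn _))].
  rewrite /= sub0r normrN => /(le_lt_trans (ler_norm _)); rewrite ltr_pdivlMr// => tm.
  have vs : vanishes_at_boundary mu (fun z => \sum_(k < m) x' k f * derive1 (y k) z).
    elim: (m) => [|p IH].
      by move=> d d0; exists 0 => // z _ _; rewrite big_ord0 cmod0 mulr0.
    have := vanishes_lin hmu (x' p f) (yB p).2 IH.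
    by congr (vanishes_at_boundary _ _); apply/funext => z; rewrite big_ord_recr /= addrC.
  have [r r1 hr] := vs _ e2; exists r => // z rz z1.
  have := hr z rz z1; have := tail f A m z (HD_holomorphic hf) A0 hA z1.
  have E : \sum_(k < m) along (fun x => atom_val x f * (atom_kern x (phi z) * g z)) k = \sum_(k < m) x' k f * derive1 (y k) z.
    apply: eq_bigr => k _; rewrite (yD k z z1) /x'.
    case E : (pickle_inv k : option index4) => [x|]; last by rewrite !(al0E _ _ _ E) mul0r.
    by rewrite !(alE _ _ _ _ E).
  rewrite E (S_op_derive hg hphi hf z1); set u := derive1 f _ * _; set v := \sum_(k < _) _.
  have mz := weight_gt0 hmu z1; have : mu z * cmod u <= mu z * (cmod (u - v) + cmod v).
    by rewrite ler_wpM2l ?(ltW mz)// -{1}(subrK v u); exact: cmodD.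
  have At : A * tau m <= e / 2.
    have [t0|t0] := lerP 0 (tau m); first by nra.
    by apply: le_trans (ltW e2); rewrite mulr_ge0_le0// ltW.
  rewrite mulrDr; lra.
split=> //; exists x', y; split=> //.
- move=> k; split; last by apply: le_lt_trans (dn k) _; exact: ltry.
  move=> a f h hf hh; rewrite /x'; case E : (pickle_inv k : option index4) => [x|].
    by rewrite /along E; exact: atom_val_lin hf.1 hh.1.
  by rewrite /along E mulr0 addr0.
- apply: (@le_lt_trans _ _ (6 * (K * kern_scale) * B)%:E); last exact: ltry.
  have t0 k : (0 <= dual_norm (Hinf nu) (x' k) * nnorm (Bloch0 mu) (y k))%E.
    by rewrite mule_ge0//; exact: bloch_norm_ge0.
  apply: lime_le; first by apply: is_cvg_nneseries => k _ _.
  apply: nearW => m; apply: (@le_trans _ _ (\sum_(k < m) along be k)%:E).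
    rewrite big_mkord -sumEFin; apply: lee_sum => k _.
    apply: (@le_trans _ _ ((along al k)%:E * (along atom_size k)%:E)%E).
      exact: (lee_pmul (dn0 k) (bloch_norm_ge0 hmu (y k)) (dn k) (bn k)).
    rewrite -EFinM lee_fin; case E : (pickle_inv k : option index4) => [x|]; last by rewrite !(al0E _ _ _ E) mul0r.
    by rewrite !(alE _ _ _ _ E) alb.
  rewrite lee_fin sum_along.
  rewrite (_ : \sum_(i <- _) be i = \sum_(i <- [seq i <- enum_upto index4 m | valid4 i]) be i).
    apply: sum_majorant KG hB _ _; last exact: filter_all.
    by rewrite filter_uniq// enum_upto_uniq.
  rewrite big_filter [RHS]big_mkcond; apply: eq_bigr => x _.
  by case: ifPn => // /beV.
- move=> f hfi; have [A A0 hA] := normP f hfi; have hf := hfi.1.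
  have h0 : (A * tau m)%:E @[m --> \oo] --> 0%E.
    apply: cvg_EFin; first by apply: nearW.
    rewrite -[0]/(fine 0%E) /= -(mulr0 A); exact: cvgMl_tmp.
  apply: (squeeze_cvge _ (cvg_cst 0%E) h0); apply: nearW => m; apply/andP; split; first exact: bloch_norm_ge0.
  rewrite /= /bloch_norm.
  have -> : (S_op g phi f - \sum_(0 <= k < m) x' k f *: y k) 0 = 0.
    rewrite (_ : (S_op g phi f - _) 0 = S_op g phi f 0 - (\sum_(0 <= k < m) x' k f *: y k) 0)// S_op_0 fct_sumE.
    rewrite big1 ?subrr// => k _; rewrite (_ : (x' k f *: y k) 0 = x' k f * y k 0)// y0 mulr0//.
  rewrite cmod0 add0e; apply/weighted_sup_leP => z hz.
  by rewrite (derive1_isd (Dsum f m z hf hz)); apply: tail => //; exact: HD_holomorphic.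
Qed.

End Main.

End LatticeImpliesNuclear.

(** * The integral condition *)

Section NonmeasurableIntegral.
Context d (T : measurableType d) (R : realType) (m : {measure set T -> \bar R}).
Local Open Scope ereal_scope.

(* No measurability: the integral of a nonnegative function is a supremum over
   the simple functions below it. *)
Lemma ge0_subset_integral_le (D : set T) (f h : T -> \bar R) :
  (forall x, D x -> 0 <= f x) -> (forall x, 0 <= h x) -> (forall x, D x -> f x <= h x) ->
  \int[m]_(x in D) f x <= \int[m]_x h x.
Proof.
move=> f0 h0 fh; rewrite integral_mkcond.
have le x : (f \_ D) x <= h x.
  by rewrite /patch; case: ifPn => [/set_mem /fh//|_]; exact: h0.
have ge x : 0 <= (f \_ D) x by apply: erestrict_ge0.
rewrite !ge0_integralTE//; apply: ereal_sup_le => _ [u hu <-]; exists u => // x.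
exact: le_trans (hu x) (le x).
Qed.

Lemma ge0_integral_le_subset (D : set T) (f h : T -> \bar R) :
  (forall x, D x -> 0 <= f x) -> (forall x, 0 <= h x) ->
  (forall x, D x -> h x <= f x) -> (forall x, ~ D x -> h x = 0) ->
  \int[m]_x h x <= \int[m]_(x in D) f x.
Proof.
move=> f0 h0 fh hD; rewrite [leRHS]integral_mkcond.
have le x : h x <= (f \_ D) x.
  by rewrite /patch; case: ifPn => [/set_mem /fh//|/negP hx]; rewrite hD// => Dx; apply: hx; exact: mem_set.
have ge x : 0 <= (f \_ D) x by apply: erestrict_ge0.
rewrite !ge0_integralTE//; apply: ereal_sup_le => _ [u hu <-]; exists u => // x.
exact: le_trans (hu x) (le x).
Qed.

End NonmeasurableIntegral.

(** * Squares around lattice points *)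

Section Squares.
Context {R : realType}.
Local Notation C := (cplx R).
Local Notation area := (@lebesgue_measure R \x @lebesgue_measure R)%E.

(** Axis-parallel squares stand in for disks because their area is a product of two lengths; h is
    half the side. *)
Definition square (c : C) (h : R) : set (R * R) :=
  `[complex.Re c - h, complex.Re c + h] `*` `[complex.Im c - h, complex.Im c + h].

Lemma measurable_square c h : measurable (square c h).
Proof. by apply: measurableX; exact: measurable_itv. Qed.

Lemma area_square c h : 0 <= h -> area (square c h) = ((2 * h) ^+ 2)%:E.
Proof.
move=> h0; transitivity (lebesgue_measure (`[(complex.Re c - h)%R, (complex.Re c + h)%R]%classic : set R) *
    lebesgue_measure (`[(complex.Im c - h)%R, (complex.Im c + h)%R]%classic : set R))%E.
  by apply: product_measure1E; exact: measurable_itv.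
have L (x : R) : lebesgue_measure (`[x - h, x + h]%classic : set R) = (2 * h)%:E.
  rewrite lebesgue_measure_itv /= lte_fin; case: ltP => h1; first by rewrite -EFinD; congr EFin; ring.
  by congr EFin; lra.
by rewrite !L -EFinM expr2.
Qed.

Lemma squareP (c : C) h (p : R * R) : square c h p <->
  `|complex.Re c - p.1| <= h /\ `|complex.Im c - p.2| <= h.
Proof.
rewrite /square; split=> [[/= + +]|[]]; rewrite ?in_itv /= !ler_norml.
  by move=> /andP[a1 a2] /andP[b1 b2]; split; lra.
by move=> a b; split; rewrite /= in_itv /=; lra.
Qed.

Lemma square_in (c : C) h (p : R * R) : cmod ((p.1 +i* p.2) - c) <= h -> square c h p.
Proof.
rewrite cmodC => hc; apply/squareP; split.
  by apply: le_trans hc; have := Re_le_cmod (c - (p.1 +i* p.2)); rewrite ReB.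
by apply: le_trans hc; have := Im_le_cmod (c - (p.1 +i* p.2)); rewrite ImB.
Qed.

Lemma square_out (c : C) h (p : R * R) : square c h p -> cmod ((p.1 +i* p.2) - c) <= 2 * h.
Proof.
move=> /squareP [h1 h2]; rewrite cmodC; apply: le_trans (cmod_le_ReIm _) _.
rewrite ReB ImB /=; lra.
Qed.

Lemma integral_squares (I : Type) (s : seq I) (a : I -> R) (c : I -> C) (h : I -> R) :
  (forall i, 0 <= a i) -> (forall i, 0 <= h i) ->
  (\int[area]_p \sum_(i <- s) (a i)%:E * (\1_(square (c i) (h i)) p)%:E =
   (\sum_(i <- s) a i * (2 * h i) ^+ 2)%:E)%E.
Proof.
move=> a0 h0; rewrite ge0_integral_sum//; first last.
- by move=> i p _; rewrite mule_ge0// lee_fin.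
- move=> i; apply: measurable_funeM; apply/measurable_EFinP.
  exact: measurable_indic (measurable_square _ _).
rewrite -sumEFin; apply: eq_bigr => i _.
rewrite ge0_integralZl_EFin//; last first.
  by apply/measurable_EFinP; exact: measurable_indic (measurable_square _ _).
rewrite EFinM; congr (_ * _)%E; rewrite integral_indic ?setIT//; first exact: area_square.
exact: measurable_square.
Qed.

Lemma at_most_one_sum (I : eqType) (r : seq I) (P : I -> bool) (v : I -> R) (M : R) : 0 <= M ->
  uniq r -> (forall x, x \in r -> P x -> v x <= M) ->
  (forall x y, x \in r -> y \in r -> P x -> P y -> x = y) ->
  \sum_(x <- r) (if P x then v x else 0) <= M.
Proof.
move=> M0 ur hv h1; have [/hasP [x xr Px]|/hasPn hn] := boolP (has P r).
  rewrite (big_rem _ xr) /= Px big1_seq ?addr0; first exact: hv.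
  move=> y /andP[_ yr]; case: ifPn => // Py.
  move: (yr); rewrite mem_rem_uniq// inE => /andP[+ yr']; rewrite (h1 _ _ yr' xr Py Px).
  by rewrite eqxx.
by rewrite big1_seq// => x /andP[_ /hn /negbTE ->].
Qed.


(** The exponent is allowed to be negative, as alpha may be, whence the absolute value in the
    constant. *)
Lemma powR_comparable (t x a : R) : 0 < t -> t / 4 <= x -> x <= 4 * t ->
  x `^ a <= 4 `^ `|a| * t `^ a.
Proof.
move=> t0 h1 h2; have x0 : 0 < x by apply: lt_le_trans h1; rewrite divr_gt0.
have r0 : 0 < x / t by rewrite divr_gt0.
have -> : x `^ a = (x / t) `^ a * t `^ a by rewrite -powRM ?(ltW r0) ?(ltW t0)// divfK// gt_eqF.
rewrite ler_wpM2r ?powR_ge0//; have [a0|a0] := lerP 0 a.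
  by rewrite ger0_norm//; apply: ge0_ler_powR; rewrite ?nnegrE ?(ltW r0)// ler_pdivrMr.
rewrite ltr0_norm// -{1}[a]opprK powRN.
apply: (@le_trans _ _ (((4^-1) `^ (- a))^-1)); last first.
  have p0 : (4^-1 : R) `^ (- a) != 0 by rewrite gt_eqF// powR_gt0// invr_gt0.
  by rewrite le_eqVlt; apply/orP; left; apply/eqP/(mulfI p0); rewrite mulfV// -powRM// mulVf// powR1.
apply: powR_anti; rewrite ?invr_gt0 ?oppr_ge0 ?(ltW a0)//.
by rewrite ler_pdivlMr// mulrC.
Qed.

End Squares.

Section IntegralCondition.
Context {R : realType}.
Local Notation C := (cplx R).
Local Notation area := (@lebesgue_measure R \x @lebesgue_measure R)%E.
Variables (nu mu : C -> R) (g phi : C -> C) (b cm alpha : R).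
Hypotheses (hnu : radial_weight nu) (hb : incr_exponent nu b).
Hypotheses (hmu : radial_weight mu) (hcm : decr_exponent mu cm).
Hypotheses (hg : Bloch0 mu g) (hphi : analytic_self_map phi) (ha : -1 < alpha).

Local Notation ks := (kernel_sup mu g phi (alpha + 3)).
Local Notation nuv n := (nu (rn n)%:C).

Definition area_density (z : C) : R := (1 - cmod z ^+ 2) `^ alpha / nu z.

Lemma alpha3_ge0 : 0 <= alpha + 3.
Proof. by have := ha; lra. Qed.

Lemma kernel_sup_comparable (x y : C) (k : R) : 0 <= k -> disk x -> disk y ->
  (forall w, disk w -> cmod (1 - conjc y * w) <= k * cmod (1 - conjc x * w)) ->
  ks x <= k `^ (alpha + 3) * ks y.
Proof.
move=> k0 hx hy h; apply: kernel_sup_le => z hz; have hw := disk_phi hphi hz.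
have x0 := den_gt0 hx hw; have y0 := den_gt0 hy hw; have s0 := alpha3_ge0.
apply: le_trans (ler_wpM2l (powR_ge0 _ _) (kernel_sup_ub hmu hcm hg hphi s0 hy hz)).
rewrite mulrCA ler_wpM2l ?mulr_ge0 ?cmod_ge0//; first by rewrite ltW// weight_gt0.
rewrite ler_pdivlMr ?powR_gt0// mulrC ler_pdivrMr ?powR_gt0// -powRM ?(ltW x0)//.
by apply: ge0_ler_powR; rewrite ?nnegrE ?(ltW y0) ?mulr_ge0 ?(ltW x0)// h.
Qed.

Lemma integrand_kernel_sup z : disk z ->
  ereal_sup [set ((mu w * cmod (g w)) / cmod (1 - (conjc z : C) * phi w) `^ (alpha + 3))%:E | w in disk] =
  (ks z)%:E.
Proof.
move=> hz; have [hne hub] := has_sup_kernel hmu hcm hg hphi alpha3_ge0 hz.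
rewrite -ereal_sup_EFin//; congr ereal_sup; apply/seteqP; split.
  by move=> _ [w hw <-]; eexists; last by []; exists w.
by move=> _ [_ [w hw <-] <-]; exists w.
Qed.

(** Size of the integrand near a lattice point up to constants; an area of order 4^-n turns it into
    the level weight of exponent alpha + 2. *)
Definition lattice_term (x : nat * nat) : R :=
  (2 ^- x.1) `^ alpha / nuv x.1 * ks (lat x.1 x.2).

Lemma kernel_sup_alpha_ge0 z : disk z -> 0 <= ks z.
Proof. by move=> hz; apply: (kernel_sup_ge0 hmu hcm hg hphi) => //; exact: alpha3_ge0. Qed.

Lemma lattice_term_ge0 x : 0 <= lattice_term x.
Proof.
rewrite /lattice_term mulr_ge0 ?kernel_sup_alpha_ge0//; last exact: disk_lat.
by rewrite divr_ge0 ?powR_ge0// ltW// nuv_gt0.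
Qed.

Lemma sum_lattice_term (k : R) P :
  \sum_(x <- lattice_seq P) lattice_term x * (k * 2 ^- x.1) ^+ 2 =
  k ^+ 2 * \sum_(n < P) level_weight nu (alpha + 3 - 1) n * \sum_(j < 2 ^ n) ks (lat n j).
Proof.
rewrite (sum_lattice_seq P (fun n j => lattice_term (n, j) * (k * 2 ^- n) ^+ 2)) mulr_sumr.
apply: eq_bigr => n _; rewrite !mulr_sumr; apply: eq_bigr => j _.
rewrite /lattice_term /level_weight /= -powR_half_pow (_ : alpha + 3 - 1 = alpha + 2%:R); last by ring.
rewrite powRD; last by rewrite (gt_eqF (half_pow_gt0 n)) implybT.
by rewrite powR_mulrn ?half_pow_ge0// exprMn; ring.
Qed.

Lemma one_sub_cmod_sqr (z : C) : disk z -> 1 - cmod z <= 1 - cmod z ^+ 2 /\ 1 - cmod z ^+ 2 <= 2 * (1 - cmod z).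
Proof.
move=> hz; have z1 : cmod z < 1 by [].
have := cmod_ge0 z; move: (cmod z) z1 => x; rewrite expr2; split; nra.
Qed.

Lemma density_upper : exists2 K : R, 0 < K & forall z n j, disk z -> cmod z < rn n.+1 -> rn n <= cmod z ->
  cmod (z - lat n j) <= 9 * 2 ^- n -> area_density z * ks z <= K * lattice_term (n, j).
Proof.
have [K K0 hK] := incr_exponent_levels hnu hb.
pose L := 4 `^ `|alpha| * (K * 2 `^ b) * 19 `^ (alpha + 3).
exists L; first by rewrite /L !mulr_gt0 ?powR_gt0.
move=> z n j hz z1 z2 hj; have n0 := nuv_gt0 hnu n; have z0 := weight_gt0 hnu hz.
have [q1 q2] := one_sub_cmod_sqr hz; have t0 := half_pow_gt0 (R := R) n; have tS := half_powS (R := R) n.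
have e1 : (1 - cmod z ^+ 2) `^ alpha <= 4 `^ `|alpha| * (2 ^- n) `^ alpha.
  by apply: powR_comparable => //; move: z1 z2; rewrite /rn; lra.
have e2 : (nu z)^-1 <= K * 2 `^ b / nuv n.
  rewrite ler_pdivlMr// mulrC ler_pdivrMr//.
  have h := hK n n.+1 (leqnSn n); rewrite subSn// subnn expr1 in h.
  apply: le_trans h _; rewrite ler_wpM2l ?mulr_ge0 ?powR_ge0 ?(ltW K0)//.
  by apply: weight_anti => //; [exact: disk_rn|rewrite cmod_rn ltW].
have e3 : ks z <= 19 `^ (alpha + 3) * ks (lat n j).
  apply: kernel_sup_comparable => //; first exact: disk_lat.
  move=> w hw; rewrite (_ : 19 = 1 + 18) -?natrD//.
  apply: comparable_denominators => //; last exact: ltW.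
  by apply: le_trans hj _; move: z1; rewrite /rn; lra.
rewrite /area_density /lattice_term /=.
apply: (@le_trans _ _ (4 `^ `|alpha| * (2 ^- n) `^ alpha * (K * 2 `^ b / nuv n) * (19 `^ (alpha + 3) * ks (lat n j)))).
  apply: ler_pM => //; first by rewrite divr_ge0 ?powR_ge0// ltW.
    exact: kernel_sup_alpha_ge0.
  by apply: ler_pM => //; rewrite ?powR_ge0// invr_ge0 ltW.
rewrite /L le_eqVlt; apply/orP; left; apply/eqP; ring.
Qed.

Lemma density_lower : exists2 K : R, 0 < K & forall z n j, cmod (z - lat n j) <= 4^-1 * 2 ^- n ->
  lattice_term (n, j) <= K * (area_density z * ks z).
Proof.
have [K K0 hK] := incr_exponent_levels hnu hb.
pose L := 4 `^ `|alpha| * (1 + K * 2 `^ b) * (5 / 4) `^ (alpha + 3).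
have K1 : 0 < 1 + K * 2 `^ b by rewrite addr_gt0// mulr_gt0// powR_gt0.
exists L; first by rewrite /L !mulr_gt0 ?powR_gt0.
move=> z n j hj; have n0 := nuv_gt0 hnu n.
have t0 := half_pow_gt0 (R := R) n; have tS := half_powS (R := R) n.
have zu : cmod z <= rn n + 4^-1 * 2 ^- n.
  by rewrite -(subrK (lat n j) z); apply: le_trans (cmodD _ _) _; rewrite cmod_lat addrC lerD2l.
have zl : rn n - 4^-1 * 2 ^- n <= cmod z.
  by have := cmod_subl (lat n j) z; rewrite cmod_lat cmodC; lra.
have hz : disk z by apply: le_lt_trans zu _; rewrite /rn; lra.
have z0 := weight_gt0 hnu hz; have [q1 q2] := one_sub_cmod_sqr hz.
have p0 : 0 < 1 - cmod z ^+ 2 by apply: lt_le_trans q1; rewrite subr_gt0.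
have e1 : (2 ^- n) `^ alpha <= 4 `^ `|alpha| * (1 - cmod z ^+ 2) `^ alpha.
  by apply: powR_comparable => //; move: zu zl; rewrite /rn; lra.
have e2 : (nuv n)^-1 <= (1 + K * 2 `^ b) / nu z.
  rewrite ler_pdivlMr// mulrC ler_pdivrMr//.
  (* Level 0 has no predecessor, but there nu(z) <= nu(0) = nu(r_0). Otherwise |z| >= [rn n.-1], and
     one step of the growth condition suffices. *)
  have [n1|n1] := eqVneq n 0%N.
    rewrite mulrDl mul1r; apply: le_trans (_ : nuv n <= _); last by rewrite lerDl !mulr_ge0 ?powR_ge0// ltW.
    by apply: weight_anti => //; rewrite cmod_rn n1 rn0 cmod_ge0.
  have E : n = n.-1.+1 by rewrite prednK// lt0n.
  have h := hK n.-1 n (leq_pred n); rewrite {2}E subSn// subnn expr1 in h.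
  apply: le_trans (_ : K * 2 `^ b * nuv n <= _); last by rewrite ler_wpM2r ?(ltW n0)// lerDr.
  apply: le_trans h; apply: weight_anti => //; rewrite cmod_rn.
  apply: le_trans zl; rewrite /rn; have := half_powS (R := R) n.-1; rewrite -E; lra.
have e3 : ks (lat n j) <= (5 / 4) `^ (alpha + 3) * ks z.
  apply: kernel_sup_comparable => //; first exact: disk_lat.
  move=> w hw; rewrite (_ : 5 / 4 = 1 + 4^-1); last by field.
  apply: comparable_denominators => //; last exact: ltW.
  by rewrite cmodC cmod_lat /rn subKr.
rewrite /area_density /lattice_term /=.
apply: (@le_trans _ _ (4 `^ `|alpha| * (1 - cmod z ^+ 2) `^ alpha * ((1 + K * 2 `^ b) / nu z) * ((5 / 4) `^ (alpha + 3) * ks z))).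
  apply: ler_pM => //; first by rewrite divr_ge0 ?powR_ge0// ltW.
    by apply: kernel_sup_alpha_ge0; exact: disk_lat.
  by apply: ler_pM => //; rewrite ?powR_ge0// invr_ge0 ltW.
rewrite /L le_eqVlt; apply/orP; left; apply/eqP; ring.
Qed.


Definition unit_disk : set (R * R) := [set p | disk (p.1 +i* p.2)].

Definition integrand (p : R * R) : \bar R := (area_density (p.1 +i* p.2) * ks (p.1 +i* p.2))%:E.

Lemma density_ge0 z : disk z -> 0 <= area_density z * ks z.
Proof.
by move=> hz; rewrite mulr_ge0 ?kernel_sup_alpha_ge0// divr_ge0 ?powR_ge0// ltW// weight_gt0.
Qed.

Lemma measurable_squares (I : Type) (s : seq I) (a : I -> R) (z : I -> C) (h : I -> R) :
  measurable_fun [set: R * R] (fun p => \sum_(i <- s) (a i)%:E * (\1_(square (z i) (h i)) p)%:E)%E.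
Proof.
apply: emeasurable_sum => i; apply: measurable_funeM; apply/measurable_EFinP.
exact: measurable_indic (measurable_square _ _).
Qed.

(** By [near_lattice] the squares of half side 9 * 2^-n cover the disk. They overlap and may leave
    it, which only enlarges the majorant, a measurable step function integrated over the whole
    plane. *)
Lemma integral_le_lattice : lattice_condition nu mu g phi (alpha + 3) ->
  (\int[area]_(p in unit_disk) integrand p < +oo)%E.
Proof.
move=> [B hB]; have [K K0 hK] := density_upper.
pose a n (j : 'I_(2 ^ n)) : R := K * lattice_term (n, j : nat).
pose G n (p : R * R) : \bar R :=
  (\sum_(j < 2 ^ n) (a n j)%:E * (\1_(square (lat n j) (9 * 2 ^- n)) p)%:E)%E.
have a0 n j : 0 <= a n j by rewrite mulr_ge0 ?lattice_term_ge0// ltW.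
have G0 n p : (0 <= G n p)%E.
  by apply: sume_ge0 => j _; rewrite mule_ge0// lee_fin.
have h0 n : 0 <= 9 * 2 ^- n :> R by rewrite mulr_ge0// half_pow_ge0.
have mG n : measurable_fun [set: R * R] (G n) by exact: measurable_squares.
apply: (@le_lt_trans _ _ (\int[area]_p \sum_(0 <= n <oo) G n p)%E).
  apply: ge0_subset_integral_le.
  - by move=> p hp; rewrite lee_fin; exact: density_ge0.
  - by move=> p; apply: nneseries_ge0 => n _ _.
  move=> p hp; set z := p.1 +i* p.2 : C; have hz : disk z by [].
  have [n [j [jn z1 z2 hj]]] := near_lattice hz.
  apply: (@le_trans _ _ (G n p)); last first.
    apply: le_trans (nneseries_lim_ge n.+1 (fun k _ _ => G0 k p)).
    by rewrite big_nat_recr//= leeDr// sume_ge0.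
  rewrite /G (bigD1 (Ordinal jn)) //=; apply: (@le_trans _ _ (a n (Ordinal jn))%:E); last first.
    rewrite indicE mem_set ?mule1; last exact: square_in.
    by rewrite leeDl// sume_ge0// => i _; rewrite mule_ge0// lee_fin.
  by rewrite lee_fin; exact: hK.
rewrite integral_nneseries//.
apply: (@le_lt_trans _ _ (K * (18 ^+ 2 * B))%:E); last exact: ltry.
apply: lime_le; first by apply: is_cvg_nneseries => n _ _; apply: integral_ge0.
apply: nearW => P; rewrite big_mkord.
rewrite (eq_bigr (fun n : 'I_P => (\sum_(j < 2 ^ n) a n j * (2 * (9 * 2 ^- n)) ^+ 2)%:E)); last first.
  by move=> n _; exact: (integral_squares (index_enum 'I_(2 ^ n)) (fun j => lat n j) (a0 n) (fun=> h0 n)).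
rewrite sumEFin lee_fin.
rewrite (_ : \sum_(n < P) _ = K * \sum_(x <- lattice_seq P) lattice_term x * (18 * 2 ^- x.1) ^+ 2).
  by rewrite sum_lattice_term ler_wpM2l ?(ltW K0)// ler_wpM2l ?exprn_ge0.
rewrite (sum_lattice_seq P (fun n j => lattice_term (n, j) * (18 * 2 ^- n) ^+ 2)) mulr_sumr.
apply: eq_bigr => n _; rewrite mulr_sumr; apply: eq_bigr => j _; rewrite /a.
by rewrite (_ : 2 * (9 * 2 ^- n) = 18 * 2 ^- n); [ring|rewrite mulrA -natrM].
Qed.

(** Circles of levels n < m are at least 2^-n / 2 apart, more than the two radii together; on one
    circle [rt_sep] gives a spacing of at least 2 * 2^-n, again more than the two radii. *)
Lemma lattice_separated n j m i (z : C) : (j < 2 ^ n)%N -> (i < 2 ^ m)%N ->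
  cmod (z - lat n j) <= 4^-1 * 2 ^- n -> cmod (z - lat m i) <= 4^-1 * 2 ^- m -> (n, j) = (m, i).
Proof.
move=> jn im hj hi.
have lev n' m' j' i' : cmod (z - lat n' j') <= 4^-1 * 2 ^- n' -> cmod (z - lat m' i') <= 4^-1 * 2 ^- m' -> (m' <= n')%N.
  move=> h1 h2; rewrite leqNgt; apply/negP => nm.
  have t0 := half_pow_gt0 (R := R) n'; have tS := half_powS (R := R) n'.
  have tm : 2 ^- m' <= 2 ^- n'.+1 :> R by exact: half_pow_homo.
  have := cmod_subl z (lat n' j'); have := cmod_subl (lat m' i') z; rewrite (cmodC _ z) !cmod_lat /rn.
  lra.
have E : n = m by apply/eqP; rewrite eqn_leq (lev m n i j)// (lev n m j i).
case: m / E im hi => im hi; congr (_, _).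
have sep k l : (k < l)%N -> (l < 2 ^ n)%N -> cmod (z - lat n k) <= 4^-1 * 2 ^- n ->
    cmod (z - lat n l) <= 4^-1 * 2 ^- n -> False.
  move=> kl ln h1 h2; have n0 : n != 0%N by apply: contraTneq ln => ->; rewrite expn0 ltnS leqn0 gtn_eqF// (leq_ltn_trans _ kl).
  have E : n = n.-1.+1 by rewrite prednK// lt0n.
  have r2 : 2^-1 <= rn n :> R by rewrite E; exact: rn_geV2.
  have nd : ~~ (2 ^ n %| l - k)%N.
    by rewrite gtnNdvd ?subn_gt0// (leq_ltn_trans (leq_subr _ _) ln).
  have := @rt_sep R _ _ nd; have t0 := half_pow_gt0 (R := R) n => h3.
  have h4 : cmod (lat n l - lat n k : C) = rn n * cmod (1 - rt n ^+ (l - k) : C).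
    rewrite /lat -(subnK (ltnW kl)) addnC exprD addKn -mulrBr cmodM cmod_rn; congr (_ * _).
    by rewrite -{2}[rt n ^+ k]mulr1 -mulrBr cmodM cmod_rtX mul1r cmodC.
  have := cmodB3 z (lat n l) (lat n k); rewrite h4 (cmodC _ z).
  have := ler_pM (_ : 0 <= 2^-1) (_ : 0 <= 4 / 2 ^+ n) r2 h3; rewrite invr_ge0 ler0n => /(_ isT).
  rewrite divr_ge0 ?exprn_ge0// => /(_ isT); lra.
by case: (ltngtP j i) => // h; exfalso; [exact: sep h _ hj hi|exact: sep h _ hi hj].
Qed.

(** Squares of half side 2^-n / 8 stay within 2^-n / 4 of their centres, hence are disjoint and
    inside the disk, and a step function on them lies below the integrand. The 16 undoes the squared
    side (2^-n / 4)^2. *)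
Lemma lattice_le_integral : (\int[area]_(p in unit_disk) integrand p < +oo)%E ->
  lattice_condition nu mu g phi (alpha + 3).
Proof.
have F0 p : unit_disk p -> (0 <= integrand p)%E by move=> hp; rewrite lee_fin; exact: density_ge0.
have := integral_ge0 area F0; case E : (integral _ _ _) => [V| |] // _ _.
have [K K0 hK] := density_lower; exists (K * 16 * V) => P.
pose a x : R := K^-1 * lattice_term x.
have a0 x : 0 <= a x by rewrite mulr_ge0 ?lattice_term_ge0// invr_ge0 ltW.
pose h (x : nat * nat) : R := 8^-1 * 2 ^- x.1.
have h0 x : 0 <= h x by rewrite mulr_ge0// half_pow_ge0.
pose Q x := square (lat x.1 x.2) (h x).
have hQ x p : Q x p -> cmod ((p.1 +i* p.2) - lat x.1 x.2) <= 4^-1 * 2 ^- x.1.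
  by move=> /square_out H; apply: le_trans H _; rewrite /h; lra.
have QD x p : Q x p -> unit_disk p.
  move=> /hQ H; change (cmod (p.1 +i* p.2 : C) < 1); rewrite -(subrK (lat x.1 x.2) (p.1 +i* p.2)).
  apply: le_lt_trans (cmodD _ _) _; rewrite cmod_lat /rn; have := half_pow_gt0 (R := R) x.1; lra.
have val x p : ((a x)%:E * (\1_(Q x) p)%:E)%E = (if p \in Q x then a x else 0)%:E.
  by rewrite indicE; case: ifP => _; rewrite ?mule1 ?mule0.
have us : uniq (lattice_seq P) by apply: uniq_pairs => [|n]; rewrite iota_uniq.
have key : (\int[area]_p \sum_(x <- lattice_seq P) (a x)%:E * (\1_(Q x) p)%:E <= V%:E)%E.
  rewrite -E; apply: ge0_integral_le_subset => //.
  - by move=> p; apply: sume_ge0 => x _; rewrite mule_ge0// lee_fin.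
  - move=> p hp; rewrite (eq_bigr _ (fun x _ => val x p)) sumEFin lee_fin.
    apply: at_most_one_sum => //; first exact: density_ge0.
      move=> [n j] _ /set_mem /hQ H; rewrite /a mulrC ler_pdivrMr// mulrC.
      exact: hK H.
    move=> [n j] [m i] /allpairsPdep [n' [j' [_ hj' [-> ->]]]] /allpairsPdep [m' [i' [_ hi' [-> ->]]]].
    move=> /set_mem /hQ H1 /set_mem /hQ H2; apply: lattice_separated H1 H2.
      by move: hj'; rewrite mem_iota.
    by move: hi'; rewrite mem_iota.
  - move=> p hp; rewrite big1// => x _; rewrite val memNset// => /QD //.
rewrite integral_squares// lee_fin in key.
have E2 : \sum_(x <- lattice_seq P) a x * (2 * h x) ^+ 2 =
    K^-1 * ((4^-1) ^+ 2 * \sum_(n < P) level_weight nu (alpha + 3 - 1) n * \sum_(j < 2 ^ n) ks (lat n j)).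
  rewrite -sum_lattice_term mulr_sumr; apply: eq_bigr => x _; rewrite /a /h.
  by rewrite (_ : 2 * (8^-1 * 2 ^- x.1) = 4^-1 * 2 ^- x.1); [ring|rewrite mulrA; congr (_ * _); field].
move: key; rewrite E2 mulrC ler_pdivrMr// => key; lra.
Qed.

Lemma integral_condition :
  (disk_integral (fun zeta => ereal_sup [set ((mu z * cmod (g z)) /
      cmod (1 - (conjc zeta : C) * phi z) `^ (alpha + 3))%:E | z in disk]
      * ((1 - cmod zeta ^+ 2) `^ alpha / nu zeta)%:E) < +oo)%E <->
  lattice_condition nu mu g phi (alpha + 3).
Proof.
rewrite /disk_integral (@eq_integral _ _ _ area unit_disk integrand); last first.
  by move=> p /set_mem hp; rewrite integrand_kernel_sup// -EFinM mulrC.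
have p0 : (0 < (pi^-1 : R)%:E)%E by rewrite lte_fin invr_gt0 pi_gt0.
have F0 p : unit_disk p -> (0 <= integrand p)%E by move=> hp; rewrite lee_fin; exact: density_ge0.
split=> [h|/integral_le_lattice].
  apply: lattice_le_integral; have := integral_ge0 area F0; move: h.
  move: (\int[area]_(p in unit_disk) integrand p)%E => -[r _ _|h _|_ //]; first exact: ltry.
  by move: h; rewrite gt0_muley.
have := integral_ge0 area F0; case: (integral _ _ _) => // r _ _.
by rewrite -EFinM ltry.
Qed.

End IntegralCondition.

(** * Passing between domains and targets, and the equivalence *)

Section NuclearInclusions.
Context {R : realType}.
Local Notation C := (cplx R).

(** The same expansion serves: functionals restrict with a dual norm that can only decrease, and the
    vectors keep their norm in the larger target. *)
Lemma nuclear_sub (V W : lmodType C) (X X' : nspace V) (Y Y' : nspace W) (T : V -> W) :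
  (forall x, X' x -> X x) -> nnorm X' = nnorm X -> X' 0 -> (nnorm X 0 <= 1)%E ->
  (forall y, Y y -> Y' y) -> nnorm Y' = nnorm Y -> (forall y, 0 <= nnorm Y y)%E ->
  nuclear X Y T -> nuclear X' Y' T.
Proof.
move=> sX nX X0 n0 sY nY nY0 [hT [x' [y [hx hy hs hc]]]]; split=> [x /sX /hT /sY//|].
have dle l : (dual_norm X' l <= dual_norm X l)%E.
  by apply: ereal_sup_le => _ [u [hu hu1] <-]; exists u => //; split; [exact: sX|rewrite -nX].
have d0 l : (0 <= dual_norm X' l)%E.
  apply: (@le_trans _ _ (cmod (l 0))%:E); first by rewrite lee_fin cmod_ge0.
  by apply: ereal_sup_ubound; exists 0 => //; split; rewrite ?nX.
exists x', y; split.
- move=> k; have [hl hf] := hx k; split; last exact: le_lt_trans (dle _) hf.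
  by move=> a u v /sX hu /sX hv; exact: hl.
- by move=> k; exact: sY.
- apply: le_lt_trans hs; apply: lee_nneseries => k _; first by rewrite nY mule_ge0.
  by rewrite nY lee_wpmul2r.
- by move=> x /sX /hc; rewrite nY.
Qed.

(** At r = 1/2 the base is 3/4, whose logarithm is nonzero. This identifies the exponent hidden in
    [normal_pair] with the given alpha, and so yields b - 1 < alpha. *)
Lemma product_exponent_unique (nu omega : C -> R) (a a' : R) :
  product_is_power nu omega a -> product_is_power nu omega a' -> a = a'.
Proof.
have h0 : (0 : R) <= 2^-1 by rewrite invr_ge0.
have h1 : (2^-1 : R) < 1 by rewrite invf_lt1// ltr1n.
move=> /(_ _ h0 h1) e /(_ _ h0 h1); rewrite e => /(congr1 (@ln R)).
set t := 1 - _; have t0 : 0 < t by rewrite /t expr2; lra.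
have t1 : t < 1 by rewrite /t expr2; lra.
rewrite !ln_powR => /mulIf; apply; rewrite lt_eqF//; apply: ln_lt0; by rewrite t0.
Qed.

End NuclearInclusions.

Unset Implicit Arguments.
Theorem corollary9 (R : realType) (nu mu omega : cplx R -> R) (alpha : R)
    (g phi : cplx R -> cplx R)
    (hnu : normal_weight nu) (hmu : normal_weight mu)
    (halpha : -1 < alpha)
    (hpair : normal_pair nu omega)
    (hprod : product_is_power nu omega alpha)
    (hg : Bloch0 mu g)
    (hphi : analytic_self_map phi)
    (hS : bounded_operator (Hinf nu) (Bloch mu) (S_op g phi)) :
  [<-> nuclear (Hzero nu) (Bloch mu) (S_op g phi);
       nuclear (Hinf nu) (Bloch mu) (S_op g phi);
       nuclear (Hzero nu) (Bloch0 mu) (S_op g phi);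
       nuclear (Hinf nu) (Bloch0 mu) (S_op g phi);
       (disk_integral (fun zeta =>
          ereal_sup [set ((mu z * cmod (g z)) /
              cmod (1 - (conjc zeta : cplx R) * phi z) `^ (alpha + 3))%:E | z in disk]
          * ((1 - cmod zeta ^+ 2) `^ alpha / nu zeta)%:E) < +oo)%E].
Proof.
have [hrn _ [c hc]] := hnu; have [hrm _ [cm hcm]] := hmu.
have [_ _ _ [alpha' [b [hb hba hprod']]]] := hpair.
rewrite (product_exponent_unique hprod' hprod) in hba.
(* N has to exceed b + 1 for the test functions, to be at least alpha + 2 for raising the exponent
   alpha + 3 to N + 1, and to be at least 2 for the circle sums. *)
pose N := (Num.bound (`|b| + `|alpha| + 3)).+2.
have hN : `|b| + `|alpha| + 3 < N%:R.
  apply: lt_le_trans (archi_boundP _) _; first by rewrite !addr_ge0.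
  by rewrite ler_nat; exact: leq_trans (leqnSn _) (leqnSn _).
have N2 : (2 <= N)%N by [].
have [b0 _] := hb; have := ler_norm b; have := ler_norm alpha => h1 h2.
have bN : b + 1 < N%:R by have := normr_ge0 alpha; lra.
have aN : alpha + 3 <= N.+1%:R by rewrite -natr1; have := normr_ge0 b; lra.
have a2 : 2 <= alpha + 3 by lra.
have ba : b + 2 < alpha + 3 by lra.
have a0 : 0 <= alpha + 3 by lra.
have ad : nuclear (Hzero nu) (Bloch mu) (S_op g phi) -> lattice_condition nu mu g phi (alpha + 3).
  move=> /(nuclear_lattice hrn hb hc hrm hcm hg hphi N2 bN).
  exact: (lattice_condition_down hrn hb hc hrm hcm hg hphi a2 ba (ler0n R N.+1)).
have da : lattice_condition nu mu g phi (alpha + 3) -> nuclear (Hinf nu) (Bloch0 mu) (S_op g phi).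
  move=> /(lattice_condition_up hrn hrm hcm hg hphi a0 aN).
  exact: (lattice_nuclear hrn hb hrm hcm hg hphi (ltnW N2)).
have z0 : Hzero nu 0 by exact: Hzero0.
have i0 : Hinf nu 0 by exact: Hzero_sub_Hinf.
have n1 : (weighted_sup nu (0%R : cplx R -> cplx R) <= 1)%E.
  apply/weighted_sup_leP => z _; rewrite (_ : (0 : cplx R -> cplx R) z = 0)//.
  by rewrite cmod0 mulr0.
have zi : forall f, Hzero nu f -> Hinf nu f := Hzero_sub_Hinf hrn.
have bb : forall f, Bloch0 mu f -> Bloch mu f := Bloch0_sub_Bloch hrm.
have nb : forall f, (0 <= bloch_norm mu f)%E := bloch_norm_ge0 hrm.
have ic := integral_condition hrn hb hrm hcm hg hphi halpha.
(* Every implication of the cycle goes through L(alpha + 3): [ad] starts from the weakest statement,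
   [da] reaches the strongest, [ic] translates (e), and [nuclear_sub] supplies the inclusions. *)
tfae.
- by move=> /ad /da; exact: nuclear_sub.
- by move=> h; apply: nuclear_sub (da (ad _)) => //; apply: nuclear_sub h.
- by move=> h; apply: da; apply: ad; apply: nuclear_sub h.
- by move=> h; apply/ic; apply: ad; apply: nuclear_sub h.
- by move=> /ic /da; exact: nuclear_sub.
Qed.
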